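(* Let $m\neq n$ be nonnegative integers. Let $SU(m|n)$ and $s(AN)$ denote the graded real Poisson-Lie supergroups given by $\mathcal H/I$ and $\mathcal H/J$, with the Poisson-Lie superbrackets and graded $\bigstar$-structures induced from those of $\mathcal H=\mathcal{SL}_{m|n}[[y_{ij},z_{ij}]]$ (defined in the context), and let $(\mathfrak g,\phi_G)$ and $(\mathfrak b,\phi_B)$ be their graded real Lie superalgebras. Let $\mathfrak g^*$ and $\mathfrak b^*$ be the linear duals of $\mathfrak g$ and $\mathfrak b$. Then: (1) the Poisson-Lie superbracket and the graded $\bigstar$-structure of $SU(m|n)$ induce on $\mathfrak g^*$ a structure of graded real Lie superalgebra $(\mathfrak g^*,\varphi_G)$ which is isomorphic to $(\mathfrak b,\phi_B)$; (2) the Poisson-Lie superbracket and the graded $\bigstar$-structure of $s(AN)$ induce on $\mathfrak b^*$ a structure of graded real Lie superalgebra $(\mathfrak b^*,\varphi_B)$ which is isomorphic to $(\mathfrak g,\phi_G)$.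
   Context: Parities: $|i|=0$ for $1\le i\le m$ and $|i|=1$ for $m+1\le i\le m+n$; $|f|\in\mathbb Z/2$ is the parity of a homogeneous element $f$. Sweedler notation $\Delta(f)=f'\otimes f''$. Tensor products of formal power series superalgebras are completed. $\mathbb C[[x_{ij}]]$ ($1\le i,j\le m+n$) is the supercommutative superalgebra of formal power series in generators $x_{ij}$ of parity $|i|+|j|$, a Hopf superalgebra with $\Delta(x_{ij})=1\otimes x_{ij}+x_{ij}\otimes1+\sum_k x_{ik}\otimes x_{kj}$, $\varepsilon(x_{ij})=0$, $S(x_{ij})=-\delta_{ij}+((1+X)^{-1})_{ij}$, where $X=(x_{ij})$ and $\Delta,\varepsilon,S$ are superalgebra morphisms. $\mathcal{SL}_{m|n}[[x_{ij}]]$ is its quotient by the Hopf ideal generated by $\mathrm{sdet}(1+X)-1$, where $\mathrm{sdet}\begin{pmatrix}A&B\\C&D\end{pmatrix}=\det(A-BD^{-1}C)/\det D$ ($A$ of size $m\times m$, $D$ of size $n\times n$). $\mathcal H=\mathcal{SL}_{m|n}[[y_{ij},z_{ij}]]=\mathcal{SL}_{m|n}[[y_{ij}]]\otimes\mathcal{SL}_{m|n}[[z_{ij}]]$. The graded $\bigstar$-structure of $\mathcal H$ is the even, antilinear, multiplicative map ($(fg)^\bigstar=f^\bigstar g^\bigstar$) given on generators by $y_{ij}^\bigstar=(-1)^{(|i|+|j|)|j|}S(z_{ji})$, $z_{ij}^\bigstar=(-1)^{(|i|+|j|)|j|}S(y_{ji})$; it satisfies $(f^\bigstar)^\bigstar=(-1)^{|f|}f$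 and is compatible with $\Delta,\varepsilon,S$ (with complex conjugation on $\mathbb C$). $I\subset\mathcal H$ is the Hopf ideal generated by $y_{ij}-z_{ij}$ for all $i,j$. $J\subset\mathcal H$ is the Hopf ideal generated by $y_{ji}$ and $z_{ij}$ for all $i>j$ and by $S(y_{ii})-z_{ii}$ for all $i$. Both are stable under $\bigstar$, so $\mathcal H/I$ and $\mathcal H/J$ inherit graded $\bigstar$-structures. An $\varepsilon$-derivation of a Hopf superalgebra $H$ is a linear map $\delta:H\to\mathbb C$ with $\delta(fg)=\varepsilon(f)\delta(g)+\delta(f)\varepsilon(g)$; it is even if it vanishes on $H_1$ and odd if it vanishes on $H_0$. The $\varepsilon$-derivations form the Lie superalgebra of $H$, with bracket $[\delta_1,\delta_2](f)=\delta_1(f')\delta_2(f'')-(-1)^{|\delta_1||\delta_2|}\delta_2(f')\delta_1(f'')$. $sl(m|n,\mathbb C)$ is the Lie superalgebra of complex $(m+n)\times(m+n)$ supermatrices $M=\begin{pmatrix}P&Q\\R&T\end{pmatrix}$ with $\mathrm{Str}M=\mathrm{tr}P-\mathrm{tr}T=0$ (even: $Q=R=0$; odd: $P=T=0$). The Lie superalgebra $\mathfrak d$ of $\mathcal H$ consists of the $\varepsilon$-derivations $\delta_{(A,B)}$, $A,B\in sl(m|n,\mathbb C)$, with $\delta_{(A,B)}(y_{ij})=A_{ij}$, $\delta_{(A,B)}(z_{ij})=B_{ij}$; it is identified with $sl(m|n,\mathbb C)\oplus sl(m|n,\mathbb C)$ and carries the scalar product $((A,B),(C,D))_{\mathfrak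 d}=-\tfrac i2\mathrm{Str}(AC)+\tfrac i2\mathrm{Str}(BD)$. A graded real structure on a complex Lie superalgebra is an even antilinear map $\phi$ with $\phi^2(x)=(-1)^{|x|}x$ and $\phi([x,y])=[\phi(x),\phi(y)]$; a graded real Lie superalgebra is a complex Lie superalgebra with a graded real structure. An isomorphism of graded real Lie superalgebras is an isomorphism of complex Lie superalgebras intertwining the graded real structures. On $\mathfrak d$ one has the graded real structure $\phi(\delta)(f)=\overline{\delta(f^\bigstar)}$. The Lie superalgebra of $\mathcal H/I$ is identified with $\mathfrak g=\{(A,A)\}\subset\mathfrak d$ (the $\varepsilon$-derivations vanishing on $I$), and that of $\mathcal H/J$ with $\mathfrak b=\{(A,B): A \text{ lower triangular},\ B\text{ upper triangular},\ \text{the diagonal parts satisfy } A_0+B_0=0\}\subset\mathfrak d$ (those vanishing on $J$). Both are stable under $\phi$; $\phi_G=\phi|_{\mathfrak g}$, $\phi_B=\phi|_{\mathfrak b}$. One has $\mathfrak d=\mathfrak g\dotplus\mathfrak b$ as vector spaces; $P_{\mathfrak g},P_{\mathfrak b}$ are the corresponding projections, and $R_{\mathfrak d}=P_{\mathfrak b}-P_{\mathfrak g}$. For homogeneous $h\in\mathfrak d$, viewed as an $\varepsilon$-derivation $\delta_h$: $\nabla^R_h(f)=\delta_h(f')f''$ and $\nabla^L_h(f)=(-1)^{|h|(|f|+1)}f'\delta_h(f'')$. The Poisson-Lie superbracket on $\mathcal H$ is $$\{f,g\}=\frac12\sum_{a,b}(-1)^{|f||a|}(R_{\mathfrak d}(\hat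 h_a),\hat h_b)_{\mathfrak d}\bigl[\nabla^L_{h_a}f\,\nabla^L_{h_b}g-\nabla^R_{h_a}f\,\nabla^R_{h_b}g\bigr],$$ where $(h_a)$ is a homogeneous basis of $\mathfrak d$, $(\hat h_a)$ is its dual basis ($(h_a,\hat h_b)_{\mathfrak d}=\delta_{ab}$) and $|a|=|h_a|$. The ideals $I$ and $J$ are Poisson ideals ($\{I,\mathcal H\}\subset I$, $\{J,\mathcal H\}\subset J$), so the bracket descends to $\mathcal H/I$ and $\mathcal H/J$, making them graded real Poisson-Lie supergroups (super-Jacobi, super-antisymmetric, super-Leibniz bracket, for which $\Delta$ is a Poisson morphism and $\{f^\bigstar,g^\bigstar\}=\{f,g\}^\bigstar$). Induced structure on the dual: for $(H,\bigstar,\{\cdot,\cdot\}_H)$ a graded real Poisson-Lie supergroup with counit $\varepsilon_H$ and Lie superalgebra $\mathfrak h$, the linear dual of $\mathfrak h$ is $\mathfrak h^*=\ker\varepsilon_H/(\ker\varepsilon_H)^2$, with pairing $\langle\delta,\Omega_H(f)\rangle=\delta(f)$, where $\Omega_H:\ker\varepsilon_H\to\ker\varepsilon_H/(\ker\varepsilon_H)^2$ is the projection; its induced graded real Lie superalgebra structure is $[\Omega_H(f),\Omega_H(g)]_{\mathfrak h^*}=\Omega_H(\{f,g\}_H)$, $\varphi(\Omega_H(f))=\Omega_H(f^\bigstar)$, for $f,g\in\ker\varepsilon_H$. Applying this to $H=\mathcal H/I$ and $H=\mathcal H/J$ gives $(\mathfrak g^*,\varphi_G)$ and $(\mathfrak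 b^*,\varphi_B)$. *)

(* Defs.v *)
From HB Require Import structures.
From mathcomp Require Import all_boot all_order all_algebra.
From mathcomp Require Import complex ring.
From mathcomp Require Import boolp classical_sets functions reals.

Set Implicit Arguments.
Unset Strict Implicit.
Unset Printing Implicit Defensive.

Import Order.TTheory GRing.Theory Num.Theory.
Local Open Scope ring_scope.
Local Open Scope classical_set_scope.

(* Formal power series in supercommuting generators x_k, k : K, where x_k is
   odd iff par k. A series is given by its coefficients on the basis of
   monomials x^a := \prod_k x_k ^ (a k), the factors being taken in the order of
   the enumeration of K; only the exponents which are at most 1 on the odd
   generators occur. *)
Section PowerSeries.
Variables (C : numClosedFieldType) (K : finType) (par : pred K).

Definition expo := {ffun K -> nat}.
Implicit Types a b c : expo.

Definition reduced a := [forall k, par k ==> (a k <= 1)%N].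
Definition edeg a : nat := (\sum_k a k)%N.
Definition epar a : bool := odd (\sum_(k | par k) a k).

(* x^a * x^b = (-1) ^ esign a b x^(a + b) if a + b is reduced, 0 otherwise. *)
Definition esign a b : nat :=
  (\sum_(k | par k) \sum_(l | par l && (enum_rank l < enum_rank k)%N)
    a k * b l)%N.

Definition ebox d : seq expo :=
  [seq [ffun k => nat_of_ord (u k)] | u : {ffun K -> 'I_d.+1}].

Definition eunit k : expo := [ffun l => nat_of_bool (l == k)].

Record sps := Sps {
  coef : expo -> C;
  coef_reduced : forall a, ~~ reduced a -> coef a = 0 }.

HB.instance Definition _ := gen_eqMixin sps.
HB.instance Definition _ := gen_choiceMixin sps.

Lemma spsP f g : coef f =1 coef g <-> f = g.
Proof.
split=> [|->//]; case: f g => [f hf] [g hg] /= /funext fg.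
by case: _ / fg in hg *; congr Sps; exact: Prop_irrelevance.
Qed.

Lemma mksps_subproof (F : expo -> C) a :
  ~~ reduced a -> (if reduced a then F a else 0) = 0.
Proof. by move/negbTE->. Qed.

Definition mksps (F : expo -> C) : sps := Sps (@mksps_subproof F).

Definition sps_zero := mksps (fun=> 0).
Definition sps_one := mksps (fun a => (a == 0)%:R).
Definition sps_opp f := mksps (fun a => - coef f a).
Definition sps_add f g := mksps (fun a => coef f a + coef g a).
Definition sps_scale (z : C) f := mksps (fun a => z * coef f a).
Definition sps_mul f g := mksps (fun c =>
  \sum_(a <- ebox (edeg c)) \sum_(b <- ebox (edeg c) | a + b == c)
    (-1) ^+ esign a b * (coef f a * coef g b)).

Lemma coef_mksps F a : reduced a -> coef (mksps F) a = F a.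
Proof. by move=> /= ->. Qed.

Lemma spsPr f g : (forall a, reduced a -> coef f a = coef g a) -> f = g.
Proof.
move=> fg; apply/spsP => a; have [/fg //|ra] := boolP (reduced a).
by rewrite !coef_reduced.
Qed.

Lemma sps_addA : associative sps_add.
Proof. by move=> f g h; apply: spsPr => a ra /=; rewrite ra addrA. Qed.
Lemma sps_addC : commutative sps_add.
Proof. by move=> f g; apply: spsPr => a ra /=; rewrite ra addrC. Qed.
Lemma sps_add0 : left_id sps_zero sps_add.
Proof. by move=> f; apply: spsPr => a ra /=; rewrite ra add0r. Qed.
Lemma sps_addN : left_inverse sps_zero sps_opp sps_add.
Proof. by move=> f; apply: spsPr => a ra /=; rewrite ra addNr. Qed.

HB.instance Definition _ :=
  GRing.isZmodule.Build sps sps_addA sps_addC sps_add0 sps_addN.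

Lemma coefD f g a : coef (f + g) a = coef f a + coef g a.
Proof.
rewrite /=; case: ifPn => // ra.
by rewrite !coef_reduced // addr0.
Qed.

Lemma sps_scaleA z w f : sps_scale z (sps_scale w f) = sps_scale (z * w) f.
Proof. by apply: spsPr => a ra /=; rewrite ra mulrA. Qed.
Lemma sps_scale1 : left_id 1 sps_scale.
Proof. by move=> f; apply: spsPr => a ra /=; rewrite ra mul1r. Qed.
Lemma sps_scaleDr : right_distributive sps_scale +%R.
Proof. by move=> z f g; apply: spsPr => a ra; rewrite coefD !coef_mksps // mulrDr. Qed.
Lemma sps_scaleDl f : {morph sps_scale^~ f : z w / z + w}.
Proof. by move=> z w; apply: spsPr => a ra; rewrite coefD !coef_mksps // mulrDl. Qed.

HB.instance Definition _ :=
  GRing.Zmodule_isLmodule.Build C sps sps_scaleA sps_scale1 sps_scaleDr sps_scaleDl.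

Lemma ebox_uniq d : uniq (ebox d).
Proof.
rewrite map_inj_uniq ?enum_uniq // => u v /ffunP uv; apply/ffunP => k.
by apply: val_inj; have := uv k; rewrite !ffunE.
Qed.

Lemma mem_ebox d a : (a \in ebox d) = [forall k, (a k <= d)%N].
Proof.
apply/mapP/forallP => [[u _ ->] k|ad]; first by rewrite ffunE -ltnS ltn_ord.
exists [ffun k => inord (a k)]; first by rewrite mem_enum.
by apply/ffunP => k; rewrite !ffunE inordK // ltnS.
Qed.

Lemma leq_edeg a k : (a k <= edeg a)%N.
Proof. by rewrite /edeg (bigD1 k) //= leq_addr. Qed.

Lemma mem_ebox_edeg d a b c :
  (edeg c <= d)%N -> a + b = c -> (a \in ebox d) /\ (b \in ebox d).
Proof.
move=> cd abc; rewrite !mem_ebox; split; apply/forallP => k;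
  (apply: leq_trans cd; apply: leq_trans (leq_edeg _ k)); rewrite -abc ffunE.
  exact: leq_addr.
exact: leq_addl.
Qed.

Lemma ebox_widen d e (P : pred expo) (F : expo -> C) :
    (forall a, P a -> a \in ebox d) -> (forall a, P a -> a \in ebox e) ->
  \sum_(a <- ebox d | P a) F a = \sum_(a <- ebox e | P a) F a.
Proof.
move=> Pd Pe; rewrite -big_filter -[RHS]big_filter; apply: perm_big.
apply: uniq_perm; rewrite ?filter_uniq ?ebox_uniq // => a.
by rewrite !mem_filter; case: (boolP (P a)) => // Pa; rewrite Pd ?Pe.
Qed.

Lemma coef_mul_box f g d c : reduced c -> (edeg c <= d)%N ->
  coef (sps_mul f g) c =
  \sum_(a <- ebox d) \sum_(b <- ebox d | a + b == c)
    (-1) ^+ esign a b * (coef f a * coef g b).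
Proof.
move=> rc cd; have main e : (edeg c <= e)%N ->
    \sum_(a <- ebox e) \sum_(b <- ebox e | a + b == c)
      (-1) ^+ esign a b * (coef f a * coef g b) =
    \sum_(a <- ebox e | a \in ebox (edeg c)) \sum_(b <- ebox (edeg c) | a + b == c)
      (-1) ^+ esign a b * (coef f a * coef g b).
  move=> ce; rewrite [RHS]big_mkcond /=; apply: eq_bigr => a _.
  transitivity (\sum_(b <- ebox (edeg c) | a + b == c)
      (-1) ^+ esign a b * (coef f a * coef g b)).
    apply: ebox_widen => b /eqP abc; first by case: (mem_ebox_edeg ce abc).
    by case: (mem_ebox_edeg (leqnn _) abc).
  case: ifPn => // /negP na; rewrite big1_seq // => b /andP[/eqP abc _].
  by case: na; case: (mem_ebox_edeg (leqnn _) abc).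
rewrite coef_mksps // main // [RHS]main //; apply: ebox_widen => // a.
rewrite !mem_ebox => /forallP ac; apply/forallP => k.
exact: leq_trans (ac k) cd.
Qed.

Lemma esignDl a b c : esign (a + b) c = (esign a c + esign b c)%N.
Proof.
rewrite /esign -big_split; apply: eq_bigr => k _; rewrite -big_split.
by apply: eq_bigr => l _; rewrite ffunE mulnDl.
Qed.
Lemma esignDr a b c : esign a (b + c) = (esign a b + esign a c)%N.
Proof.
rewrite /esign -big_split; apply: eq_bigr => k _; rewrite -big_split.
by apply: eq_bigr => l _; rewrite ffunE mulnDr.
Qed.

Lemma reducedDl a b : reduced (a + b) -> reduced a.
Proof.
move=> /forallP r; apply/forallP => k; apply/implyP => pk.
by apply: leq_trans (implyP (r k) pk); rewrite ffunE leq_addr.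
Qed.
Lemma reducedDr a b : reduced (a + b) -> reduced b.
Proof. by rewrite addrC; exact: reducedDl. Qed.

Lemma edegDl a b : (edeg a <= edeg (a + b)%R)%N.
Proof. by apply: leq_sum => k _; rewrite ffunE leq_addr. Qed.
Lemma edegDr a b : (edeg b <= edeg (a + b)%R)%N.
Proof. by rewrite addrC edegDl. Qed.


Lemma sum_assoc (G : expo -> expo -> expo -> C) c (B := ebox (edeg c)) :
  \sum_(p <- B) \sum_(e <- B | p + e == c)
     \sum_(a <- B) \sum_(b <- B | a + b == p) G a b e =
  \sum_(a <- B) \sum_(b <- B) \sum_(e <- B)
     (if a + b + e == c then G a b e else 0).
Proof.
transitivity (\sum_(p <- B) \sum_(e <- B) \sum_(a <- B) \sum_(b <- B)
    (if (p + e == c) && (a + b == p) then G a b e else 0)).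
  apply: eq_bigr => p _; rewrite big_mkcond; apply: eq_bigr => e _.
  case: ifP => _ /=; first by apply: eq_bigr => a _; rewrite big_mkcond.
  by rewrite big1 // => a _; rewrite big1.
rewrite exchange_big /=; under eq_bigr do rewrite exchange_big /=.
rewrite exchange_big /=; apply: eq_bigr => a _.
under eq_bigr do rewrite exchange_big /=.
rewrite exchange_big /=; apply: eq_bigr => b _; apply: eq_bigr => e _.
case: eqP => [abe|nabe]; last first.
  rewrite big1 // => p _; case: ifP => // /andP[/eqP pe /eqP ab].
  by case: nabe; rewrite ab.
have [abB _] := mem_ebox_edeg (leqnn _) abe.
rewrite (bigD1_seq (a + b)) ?ebox_uniq //= abe !eqxx /=.
by rewrite big1 ?addr0 // => p /negbTE pab; rewrite [a + b == p]eq_sym pab andbF.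
Qed.

Lemma sps_mulA : associative sps_mul.
Proof.
move=> f g h; apply: spsPr => c rc.
pose G a b e := (-1) ^+ (esign a b + esign a e + esign b e)
      * (coef f a * coef g b * coef h e).
rewrite coef_mksps // [RHS]coef_mksps //; set B := ebox _; symmetry.
transitivity (\sum_(p <- B) \sum_(e <- B | p + e == c)
     \sum_(a <- B) \sum_(b <- B | a + b == p) G a b e).
  apply: eq_bigr => p _; apply: eq_bigr => e /eqP pec.
  rewrite (@coef_mul_box _ _ (edeg c)); last 2 first.
  - by apply: (@reducedDl _ e); rewrite pec.
  - by rewrite -pec edegDl.
  rewrite mulr_suml mulr_sumr; apply: eq_bigr => a _.
  rewrite mulr_suml mulr_sumr; apply: eq_bigr => b /eqP <-.
  by rewrite /G esignDl !exprD; ring.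
rewrite sum_assoc; symmetry.
transitivity (\sum_(p <- B) \sum_(a <- B | p + a == c)
     \sum_(b <- B) \sum_(e <- B | b + e == p) G a b e).
  under eq_bigr do rewrite big_mkcond.
  rewrite exchange_big; apply: eq_bigr => p _.
  rewrite -big_mkcond; apply: eq_big => [a|a /eqP apc]; first by rewrite addrC.
  rewrite (@coef_mul_box _ _ (edeg c)); last 2 first.
  - by apply: (@reducedDr a); rewrite apc.
  - by rewrite -apc edegDr.
  rewrite !mulr_sumr; apply: eq_bigr => b _.
  rewrite !mulr_sumr; apply: eq_bigr => e /eqP <-.
  by rewrite /G esignDr !exprD; ring.
rewrite (sum_assoc (fun b e a => G a b e)).
under eq_bigr do rewrite exchange_big /=.
rewrite exchange_big /=; apply: eq_bigr => a _; apply: eq_bigr => b _.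
by apply: eq_bigr => e _; rewrite [b + e + a]addrC addrA.
Qed.

Lemma esign0l a : esign 0 a = 0%N.
Proof. by rewrite /esign big1 // => k _; rewrite big1 // => l _; rewrite ffunE. Qed.
Lemma esign0r a : esign a 0 = 0%N.
Proof.
by rewrite /esign big1 // => k _; rewrite big1 // => l _; rewrite ffunE muln0.
Qed.
Lemma reduced0 : reduced 0.
Proof. by apply/forallP => k; rewrite ffunE implybT. Qed.

Lemma sps_mul1l : left_id sps_one sps_mul.
Proof.
move=> f; apply: spsPr => c rc; rewrite coef_mksps //.
have [B0 Bc] := mem_ebox_edeg (leqnn _) (add0r c).
rewrite (bigD1_seq 0) ?ebox_uniq //= [X in _ + X]big1 => [|a /negbTE a0].
  rewrite addr0 (big_rem c) //= add0r eqxx esign0l reduced0 eqxx !mul1r.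
  rewrite big1_seq ?addr0 // => b /andP[/eqP]; rewrite add0r => ->.
  by rewrite mem_rem_uniq ?ebox_uniq // inE eqxx.
by rewrite big1 // => b _; rewrite a0 if_same mul0r mulr0.
Qed.

Lemma sps_mul1r : right_id sps_one sps_mul.
Proof.
move=> f; apply: spsPr => c rc; rewrite coef_mksps //.
have [Bc B0] := mem_ebox_edeg (leqnn _) (addr0 c).
rewrite (bigD1_seq c) ?ebox_uniq //= [X in _ + X]big1 => [|a /negbTE ac].
  rewrite addr0 (big_rem 0) //= addr0 eqxx esign0r reduced0 eqxx mul1r mulr1.
  rewrite big1_seq ?addr0 // => b /andP[_ ]; rewrite mem_rem_uniq ?ebox_uniq //.
  by rewrite inE => /andP[/negbTE-> _]; rewrite if_same !mulr0.
rewrite big1 // => b /eqP abc; case: eqP => [b0|_]; last by rewrite if_same !mulr0.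
by move: ac; rewrite -abc b0 addr0 eqxx.
Qed.

Lemma sps_mulDl : left_distributive sps_mul +%R.
Proof.
move=> f g h; apply: spsPr => c rc; rewrite coefD !coef_mksps // -big_split.
apply: eq_bigr => a _; rewrite -big_split; apply: eq_bigr => b _.
by rewrite coefD mulrDl mulrDr.
Qed.
Lemma sps_mulDr : right_distributive sps_mul +%R.
Proof.
move=> f g h; apply: spsPr => c rc; rewrite coefD !coef_mksps // -big_split.
apply: eq_bigr => a _; rewrite -big_split; apply: eq_bigr => b _.
by rewrite coefD !mulrDr.
Qed.

Lemma sps_one_neq0 : sps_one != 0.
Proof.
apply/eqP => /spsP /(_ 0) /=; rewrite reduced0 eqxx => /eqP.
by rewrite oner_eq0.
Qed.

HB.instance Definition _ := GRing.Zmodule_isNzRing.Build sps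
  sps_mulA sps_mul1l sps_mul1r sps_mulDl sps_mulDr sps_one_neq0.

(* The constant term *)
Definition eps f : C := coef f 0.
Definition gen k : sps := mksps (fun a => (a == eunit k)%:R).
Definition conjs f : sps := mksps (fun a => (coef f a)^*).

(* The component of parity p, and the elements of parity p *)
Definition hpart (p : bool) f : sps :=
  mksps (fun a => if epar a == p then coef f a else 0).
Definition homog (p : bool) f : Prop := hpart p f = f.

Definition is_ideal (I : set sps) : Prop :=
  [/\ I 0, forall f g, I f -> I g -> I (f + g) &
      forall f g, I g -> I (f * g) /\ I (g * f)].
Definition ideal_gen (G : set sps) : set sps := smallest is_ideal G.

End PowerSeries.
Arguments mksps {C K par} F.
Arguments gen {C K par} k.

Section Substitution.
Variables (C : numClosedFieldType).
Variables (K K' : finType) (par : pred K) (par' : pred K').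

(* The continuous algebra morphism x_k |-> g k, where each g k has the parity of
   x_k and no constant term: as (g k)_k ^ a has no term of degree < edeg a, only
   the exponents a with edeg a <= edeg b contribute to the coefficient at b. *)
Definition subst (g : K -> sps C par') (f : sps C par) : sps C par' :=
  mksps (fun b => \sum_(a <- ebox K (edeg b))
    coef f a * coef (\prod_k g k ^+ a k) b).

End Substitution.

Section Inverse.
Variable R : nzRingType.

(* The two-sided inverse, for a possibly noncommutative R *)
Definition rinv (u : R) : R := xget u [set v | u * v = 1 /\ v * u = 1].
Definition mxinv p (M : 'M[R]_p) : 'M[R]_p :=
  xget M [set L | M *m L = 1%:M /\ L *m M = 1%:M].

Definition sdet m n (M : 'M[R]_(m + n)) : R :=
  \det (ulsubmx M - ursubmx M *m mxinv (drsubmx M) *m dlsubmx M)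
    * rinv (\det (drsubmx M)).

End Inverse.

Local Open Scope quotient_scope.
Section VectorQuotient.
Variables (F : nzRingType) (V : lmodType F).

Definition is_subspace (W : set V) : Prop :=
  W 0 /\ forall z x y, W x -> W y -> W (z *: x + y).

Definition lspan (G : set V) : set V := smallest is_subspace G.

Lemma lspan_subspace G : is_subspace (lspan G).
Proof.
split=> [W [[W0 _] _] //|z x y Wx Wy W WP].
by case: (WP) => -[_ Wl] _; apply: Wl; [exact: Wx|exact: Wy].
Qed.

Variable G : set V.

Definition vquot_equiv : rel V := fun x y => `[< lspan G (x - y) >].

Lemma vquot_equiv_is_equiv : equiv_class_of vquot_equiv.
Proof.
have [s0 sl] := lspan_subspace G.
have sN x : lspan G x -> lspan G (- x).
  by move=> sx; rewrite -[- x]addr0 -scaleN1r; exact: sl.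
split=> [x|x y|y x z]; first by rewrite /vquot_equiv subrr; exact/asboolP.
  by apply/asboolP/asboolP => /sN; rewrite opprB.
move=> /asboolP xy /asboolP yz; apply/asboolP.
by have := sl 1 _ _ xy yz; rewrite scale1r addrA subrK.
Qed.

Canonical vquot_equiv_equiv := EquivRelPack vquot_equiv_is_equiv.
Canonical vquot_equiv_direct := defaultEncModRel vquot_equiv.

(* The quotient of V by the subspace spanned by G *)
Definition vquot : Type := {eq_quot vquot_equiv}.
HB.instance Definition _ := Choice.on vquot.
HB.instance Definition _ := EqQuotient.on vquot.

Definition vquot_add (x y : vquot) : vquot := \pi_vquot (repr x + repr y).
Definition vquot_opp (x : vquot) : vquot := \pi_vquot (- repr x).
Definition vquot_scale (z : F) (x : vquot) : vquot := \pi_vquot (z *: repr x).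

Lemma vquotP x y : \pi_vquot x = \pi_vquot y <-> lspan G (x - y).
Proof.
by split=> [/eqP|xy]; [|apply/eqP]; rewrite eqmodE /= => //; [move/asboolP|apply/asboolP].
Qed.

Lemma vquot_repr x : lspan G (repr (\pi_vquot x) - x).
Proof. by apply/vquotP; rewrite reprK. Qed.

Lemma vquot_piD x y : \pi_vquot (x + y) = vquot_add (\pi_vquot x) (\pi_vquot y).
Proof.
apply/esym/vquotP; have [_ sl] := lspan_subspace G.
have := sl 1 _ _ (vquot_repr x) (vquot_repr y).
by rewrite scale1r opprD addrACA.
Qed.
Lemma vquot_piZ z x : \pi_vquot (z *: x) = vquot_scale z (\pi_vquot x).
Proof.
apply/esym/vquotP; have [s0 sl] := lspan_subspace G.
by have := sl z _ _ (vquot_repr x) s0; rewrite addr0 scalerBr.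
Qed.
Lemma vquot_piN x : \pi_vquot (- x) = vquot_opp (\pi_vquot x).
Proof. by rewrite -scaleN1r vquot_piZ /vquot_scale scaleN1r. Qed.

Lemma vquot_addA : associative vquot_add.
Proof.
move=> x y z; elim/quotW: x => x; elim/quotW: y => y; elim/quotW: z => z.
by rewrite -(vquot_piD y z) -(vquot_piD x y) -(vquot_piD x) -(vquot_piD _ z) addrA.
Qed.
Lemma vquot_addC : commutative vquot_add.
Proof. by move=> x y; rewrite /vquot_add addrC. Qed.
Lemma vquot_add0 : left_id (\pi_vquot 0) vquot_add.
Proof. by move=> x; elim/quotW: x => x; rewrite -(vquot_piD 0 x) add0r. Qed.
Lemma vquot_addN : left_inverse (\pi_vquot 0) vquot_opp vquot_add.
Proof. by move=> x; elim/quotW: x => x; rewrite -(vquot_piN x) -(vquot_piD _ x) addNr. Qed.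

HB.instance Definition _ :=
  GRing.isZmodule.Build vquot vquot_addA vquot_addC vquot_add0 vquot_addN.

Lemma vquot_scaleA z w x :
  vquot_scale z (vquot_scale w x) = vquot_scale (z * w) x.
Proof. by elim/quotW: x => x; rewrite -(vquot_piZ w x) -(vquot_piZ z) -(vquot_piZ _ x) scalerA. Qed.
Lemma vquot_scale1 : left_id 1 vquot_scale.
Proof. by move=> x; elim/quotW: x => x; rewrite -(vquot_piZ 1 x) scale1r. Qed.
Lemma vquot_scaleDr : right_distributive vquot_scale +%R.
Proof.
move=> z x y; elim/quotW: x => x; elim/quotW: y => y.
apply/esym; rewrite -(vquot_piZ z x) -(vquot_piZ z y).
rewrite -[LHS]vquot_piD -[X in _ = vquot_scale _ X]vquot_piD.
by rewrite -(vquot_piZ z (x + y)) scalerDr.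
Qed.
Lemma vquot_scaleDl x : {morph vquot_scale^~ x : z w / z + w}.
Proof.
by elim/quotW: x => x z w; rewrite -!(vquot_piZ _ x) scalerDl; exact: vquot_piD.
Qed.

HB.instance Definition _ := GRing.Zmodule_isLmodule.Build F vquot
  vquot_scaleA vquot_scale1 vquot_scaleDr vquot_scaleDl.

Definition vpi (x : V) : vquot := \pi_vquot x.

Lemma vpi_linear : linear vpi.
Proof. by move=> z x y; rewrite /vpi vquot_piD vquot_piZ. Qed.

HB.instance Definition _ := GRing.isLinear.Build F V vquot _ vpi vpi_linear.

End VectorQuotient.

(* A super vector space is given by two independent subspaces gcomp false (even)
   and gcomp true (odd) of an ambient vector space; its underlying space is their
   sum, and the bracket and the real structure only matter there. *)
Record grlie (C : numClosedFieldType) := GrLie {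
  ambient :> lmodType C;
  gcomp : bool -> set ambient;
  lbr : ambient -> ambient -> ambient;
  lphi : ambient -> ambient }.
Arguments gcomp {C} g.
Arguments lbr {C} g.
Arguments lphi {C} g.

Definition lspace (C : numClosedFieldType) (L : grlie C) : set L :=
  [set x | exists x0 x1, [/\ gcomp L false x0, gcomp L true x1 & x = x0 + x1]].
Arguments lspace {C} L.

Record is_lie_superalgebra (C : numClosedFieldType) (L : grlie C) : Prop := {
  comp_subspace : forall p, is_subspace (gcomp L p);
  comp_direct : forall x, gcomp L false x -> gcomp L true x -> x = 0;
  lbr_comp : forall p q x y,
    gcomp L p x -> gcomp L q y -> gcomp L (p (+) q) (lbr L x y);
  lbr_linearl : forall z x x' y, lspace L x -> lspace L x' -> lspace L y ->
    lbr L (z *: x + x') y = z *: lbr L x y + lbr L x' y;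
  lbr_linearr : forall z x y y', lspace L x -> lspace L y -> lspace L y' ->
    lbr L x (z *: y + y') = z *: lbr L x y + lbr L x y';
  lbr_anti : forall p q x y, gcomp L p x -> gcomp L q y ->
    lbr L x y = - ((-1) ^+ (p && q) *: lbr L y x);
  lbr_jacobi : forall p q r x y z, gcomp L p x -> gcomp L q y -> gcomp L r z ->
    lbr L x (lbr L y z) =
      lbr L (lbr L x y) z + (-1) ^+ (p && q) *: lbr L y (lbr L x z) }.

Record is_graded_real (C : numClosedFieldType) (L : grlie C) : Prop := {
  lphi_comp : forall p x, gcomp L p x -> gcomp L p (lphi L x);
  lphi_antilinear : forall z x y, lspace L x -> lspace L y ->
    lphi L (z *: x + y) = z^* *: lphi L x + lphi L y;
  lphi_square : forall p x, gcomp L p x -> lphi L (lphi L x) = (-1) ^+ p *: x;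
  lphi_lbr : forall x y, lspace L x -> lspace L y ->
    lphi L (lbr L x y) = lbr L (lphi L x) (lphi L y) }.

Definition is_graded_real_lie (C : numClosedFieldType) (L : grlie C) : Prop :=
  is_lie_superalgebra L /\ is_graded_real L.

Record is_grlie_iso (C : numClosedFieldType) (L M : grlie C) (F : L -> M) : Prop := {
  iso_linear : forall z x y, lspace L x -> lspace L y ->
    F (z *: x + y) = z *: F x + F y;
  iso_comp : forall p x, gcomp L p x -> gcomp M p (F x);
  iso_bij : set_bij (lspace L) (lspace M) F;
  iso_lbr : forall x y, lspace L x -> lspace L y ->
    F (lbr L x y) = lbr M (F x) (F y);
  iso_lphi : forall x, lspace L x -> F (lphi L x) = lphi M (F x) }.

Definition grlie_iso (C : numClosedFieldType) (L M : grlie C) : Prop :=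
  exists F : L -> M, is_grlie_iso F.

Section Supergroup.
Variables (C : numClosedFieldType) (m n : nat).

Definition ipar (i : 'I_(m + n)) : bool := (m <= i)%N.

(* (false, (i, j)) is the index of y_ij and (true, (i, j)) that of z_ij. *)
Definition gidx : finType := (bool * ('I_(m + n) * 'I_(m + n)))%type.
Definition gpar : pred gidx := fun k => ipar k.2.1 (+) ipar k.2.2.

(* C[[y_ij, z_ij]], of which H, H/I and H/J are quotients *)
Local Notation hser := (sps C gpar).
Implicit Types f g : hser.

Definition xgen (s : bool) (i j : 'I_(m + n)) : hser := gen (s, (i, j)).
Definition y_ := xgen false.
Definition z_ := xgen true.
Definition xmx (s : bool) : 'M[hser]_(m + n) := \matrix_(i, j) xgen s i j.

(* The completed tensor square of hser, as a power series superalgebra: inl k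
   stands for x_k (x) 1 and inr k for 1 (x) x_k. As inl k precedes inr l in the
   enumeration, x^a (x) x^b is the monomial of exponent ejoin a b. *)
Definition gpar2 : pred (gidx + gidx) :=
  fun s => match s with inl k => gpar k | inr k => gpar k end.
Local Notation hser2 := (sps C gpar2).

Definition ejoin (a b : expo gidx) : expo (gidx + gidx)%type :=
  [ffun s => match s with inl k => a k | inr k => b k end].

Definition coprod (f : hser) : hser2 :=
  subst (fun k : gidx => let: (s, (i, j)) := k in
    gen (inr k) + gen (inl k)
    + \sum_l gen (inl (s, (i, l))) * gen (inr (s, (l, j)))) f.

Definition antipode (f : hser) : hser :=
  subst (fun k : gidx => let: (s, (i, j)) := k in
    - (i == j)%:R + mxinv (1%:M + xmx s) i j : hser) f.

Definition star (f : hser) : hser :=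
  subst (fun k : gidx => let: (s, (i, j)) := k in
    (-1) ^+ ((ipar i (+) ipar j) && ipar j) * antipode (xgen (~~ s) j i))
    (conjs f).

(* The two-sided ideals generated by the relations below are Hopf ideals, hence
   they are also the Hopf ideals generated by these relations. *)
Definition sl_rel : set hser := [set sdet (1%:M + xmx s) - 1 | s in setT].

(* The preimages of I and J in hser: hser / idealI = H/I, hser / idealJ = H/J. *)
Definition idealI : set hser :=
  ideal_gen (sl_rel `|` [set f | exists i j, f = y_ i j - z_ i j]).
Definition idealJ : set hser :=
  ideal_gen (sl_rel
    `|` [set f | exists i j : 'I_(m + n), (j < i)%N /\ (f = y_ j i \/ f = z_ i j)]
    `|` [set f | exists i, f = antipode (y_ i i) - z_ i i]).

Definition str (A : 'M[C]_(m + n)) : C := \tr (ulsubmx A) - \tr (drsubmx A).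

(* h = (A, B) stands for the epsilon-derivation delta h with values A_ij on y_ij
   and B_ij on z_ij; conversely ofder recovers h from delta h. *)
Definition dtype : lmodType C := ('M[C]_(m + n) * 'M[C]_(m + n))%type.
Implicit Types h : dtype.

Definition hval h (k : gidx) : C :=
  if k.1 then h.2 k.2.1 k.2.2 else h.1 k.2.1 k.2.2.
Definition delta h f : C := \sum_k hval h k * coef f (eunit k).
Definition ofder (d : hser -> C) : dtype :=
  (\matrix_(i, j) d (y_ i j), \matrix_(i, j) d (z_ i j)).

Definition hhom (p : bool) h : Prop := forall k, gpar k != p -> hval h k = 0.
Definition hcomp (p : bool) h : dtype :=
  let cut (A : 'M[C]_(m + n)) :=
    \matrix_(i, j) (if ipar i (+) ipar j == p then A i j else 0) in
  (cut h.1, cut h.2).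

(* For F = f' (x) f'': delta h f' * delta h' f'', delta h f' * f'' and
   f' * delta h f'' *)
Definition delta2 h h' (F : hser2) : C :=
  \sum_k \sum_l hval h k * hval h' l * coef F (ejoin (eunit k) (eunit l)).
Definition contractl h (F : hser2) : hser :=
  mksps (fun b => \sum_k hval h k * coef F (ejoin (eunit k) b)).
Definition contractr h (F : hser2) : hser :=
  mksps (fun a => \sum_k hval h k * coef F (ejoin a (eunit k))).

Definition dbr h h' : dtype :=
  ofder (fun f => \sum_(p : bool) \sum_(q : bool)
    (delta2 (hcomp p h) (hcomp q h') (coprod f)
     - (-1) ^+ (p && q) * delta2 (hcomp q h') (hcomp p h) (coprod f))).
Definition dphi h : dtype := ofder (fun f => (delta h (star f))^*).

Definition dspace : set dtype := [set h | str h.1 = 0 /\ str h.2 = 0].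
Definition gspace : set dtype := [set h | dspace h /\ h.1 = h.2].
Definition bspace : set dtype := [set h | [/\ dspace h,
  forall i j : 'I_(m + n), (i < j)%N -> h.1 i j = 0,
  forall i j : 'I_(m + n), (j < i)%N -> h.2 i j = 0 &
  forall i, h.1 i i + h.2 i i = 0]].

Definition sublie (E : set dtype) : grlie C :=
  @GrLie C dtype (fun p => E `&` hhom p) dbr dphi.
Definition glie := sublie gspace.
Definition blie := sublie bspace.

Definition dform h h' : C :=
  - ('i / 2) * str (h.1 *m h'.1) + 'i / 2 * str (h.2 *m h'.2).

(* The component along E1 in the direct sum of E1 and E2 *)
Definition dproj (E1 E2 : set dtype) h : dtype :=
  xget 0 [set x | E1 x /\ E2 (h - x)].
Definition Rd h : dtype := dproj bspace gspace h - dproj gspace bspace h.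

(* p is the parity of h. *)
Definition nablaR h f : hser := contractl h (coprod f).
Definition nablaL (p : bool) h f : hser :=
  \sum_(q : bool) (-1) ^+ (p && ~~ q) *: contractr h (coprod (hpart q f)).

Section Bracket.
Variables (T : finType) (h hd : T -> dtype) (ph : T -> bool).

Definition is_homog_basis : Prop :=
  [/\ forall a, dspace (h a), forall a, hhom (ph a) (h a) &
      forall x, dspace x ->
        exists! c : {ffun T -> C}, x = \sum_a c a *: h a].
Definition is_dual_basis : Prop :=
  (forall a, dspace (hd a)) /\ (forall a b, dform (h a) (hd b) = (a == b)%:R).

Definition pbr f g : hser :=
  2^-1 *: \sum_(p : bool) \sum_a \sum_b
    ((-1) ^+ (p && ph a) * dform (Rd (hd a)) (hd b)) *:
      (nablaL (ph a) (h a) (hpart p f) * nablaL (ph b) (h b) g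
       - nablaR (h a) (hpart p f) * nablaR (h b) g).

End Bracket.

(* ker eps / (ker eps)^2 for the Hopf superalgebra hser / K: Omega K f, for
   eps f = 0, is the class modulo (ker eps)^2 of the class of f modulo K. *)
Definition ker_eps_sq (K : set hser) : set (vquot K) :=
  [set u | exists f g, [/\ eps f = 0, eps g = 0 & u = vpi K (f * g)]].
Arguments ker_eps_sq K : clear implicits.
Definition cotangent (K : set hser) : lmodType C := vquot (ker_eps_sq K).
Definition Omega (K : set hser) f : cotangent K :=
  vpi (ker_eps_sq K) (vpi K f).

Definition dual_comp (K : set hser) (p : bool) : set (cotangent K) :=
  [set Omega K f | f in [set f | eps f = 0 /\ homog p f]].
Arguments dual_comp K p : clear implicits.

(* A bracket and an antilinear map on the dual of the Lie superalgebra of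
   hser / K which are induced by the bracket pb and by the star structure *)
Definition is_induced (K : set hser) (pb : hser -> hser -> hser)
    (br : cotangent K -> cotangent K -> cotangent K)
    (phi : cotangent K -> cotangent K) : Prop :=
  (forall f g, eps f = 0 -> eps g = 0 ->
     br (Omega K f) (Omega K g) = Omega K (pb f g)) /\
  (forall f, eps f = 0 -> phi (Omega K f) = Omega K (star f)).

Definition dual_lie (K : set hser) br phi : grlie C :=
  @GrLie C (cotangent K) (dual_comp K) br phi.

End Supergroup.

(* Main.v *)
(* The form of d identifies the linear part of a function f in the kernel of the
   counit with an element [hat f] of d: (x, hat f) = delta_x f. For E = g and
   E' = b (case H/I), or E = b and E' = g (case H/J), both subalgebras are
   isotropic and stable under phi, and d is their direct sum. A function is zero
   in the cotangent space of the quotient iff its linear part vanishes on E, that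
   is, iff hat f lies in the orthogonal of E, which is E; hence P_E' (hat f)
   identifies the cotangent space with E'. Invariance of the form gives, in
   parities p and q,
     hat {f, g} = (-1)^(pq) ([R hat f, hat g] + [hat f, R hat g]) / 2
   where R is sg on E' and - sg on E (with sg = 1 or -1), so the
   bracket induced on E' is sg (-1)^(pq) [ , ]. Moreover
   hat (f^star) = (-1)^p phi (hat f). Multiplying even elements by sg and odd
   elements by 'i turns these into the bracket and the real structure of E'. *)
From HB Require Import structures.
From Pilot Require Import Defs.
From mathcomp Require Import all_boot all_order all_algebra.
From mathcomp Require Import fingroup perm complex ring zify.
From mathcomp Require Import boolp classical_sets functions reals.
Import Pilot.Defs.

Set Implicit Arguments.
Unset Strict Implicit.
Unset Printing Implicit Defensive.

Import Order.TTheory GRing.Theory Num.Theory.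
Local Open Scope ring_scope.

(** * Power series *)

(** The cotangent space sees a series only through its constant and linear coefficients, so the
    antipode, the star structure, the superdeterminant and the Poisson bracket enter through their
    first-order parts at the unit. The obstacle is the coproduct: brackets of epsilon-derivations
    read its coefficients of bidegree (1,1), to which the quadratic part of a function also
    contributes. That contribution is supersymmetric, so it cancels in every supercommutator.

    The rescaling factors are forced. If even elements are multiplied by t0 and odd ones by t1,
    turning sg (-1)^(pq) [ , ] into [ , ] requires t0 t0 = sg t0 and t1 t1 = - sg t0, that is t0 =
    sg and t1 t1 = -1. As 'i is not real, the same factor absorbs the sign (-1)^p of the star
    structure.

    The axioms of a graded real Lie superalgebra are not checked on the cotangent space itself: they
    are pulled back along an injective map to E'. *)

Section Series.
Variables (C : numClosedFieldType) (K : finType) (par : pred K).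
Local Notation S := (sps C par).
Implicit Types (f g : S) (a b c : expo K) (k l : K).

(** The subtraction is truncated, so this is the complement of [a] in [c] only when
    [a + csub c a = c]; statements that use it carry this condition or a substitute for it. *)
Definition csub c a : expo K := [ffun k => (c k - a k)%N].

Lemma csubK a b : csub (a + b) a = b.
Proof. by apply/ffunP => k; rewrite !ffunE; exact: addKn. Qed.

(* [s] only has to list the left factors [a] of the decompositions [a + b = c]
   that contribute. *)
Lemma coef_mul_seq f g c (s : seq (expo K)) : reduced par c -> uniq s ->
    (forall a, a \in s -> a + csub c a = c) ->
    (forall a b, a + b = c -> a \notin s -> coef f a * coef g b = 0) ->
  coef (f * g) c =
    \sum_(a <- s) (-1) ^+ esign par a (csub c a) * (coef f a * coef g (csub c a)).
Proof.
move=> rc us sP nsP.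
rewrite [LHS](@coef_mul_box C K par f g (edeg c) c rc (leqnn _)).
pose B := ebox K (edeg c).
transitivity (\sum_(a <- B) if a \in s then (-1) ^+ esign par a (csub c a) *
    (coef f a * coef g (csub c a)) else 0).
  apply: eq_bigr => a _; case: ifPn => [/sP ac|ans]; last first.
    by rewrite big1 // => b /eqP abc; rewrite (nsP _ _ abc ans) mulr0.
  have [_ bB] := mem_ebox_edeg (leqnn _) ac.
  rewrite big_mkcond (bigD1_seq (csub c a)) ?ebox_uniq //= ac eqxx big1 ?addr0 //.
  move=> b bn; case: eqP => // abc; case/eqP: bn.
  by rewrite -abc csubK.
rewrite -big_mkcond -big_filter; apply: perm_big; apply: uniq_perm => //.
  by rewrite filter_uniq // ebox_uniq.
move=> a; rewrite mem_filter; case: (boolP (a \in s)) => //= /sP ac.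
by case: (mem_ebox_edeg (leqnn _) ac).
Qed.

Lemma edegD a b : edeg (a + b) = (edeg a + edeg b)%N.
Proof. by rewrite /edeg -big_split; apply: eq_bigr => k _; rewrite ffunE. Qed.

Lemma edeg0 : edeg (0 : expo K) = 0%N.
Proof. by rewrite /edeg big1 // => k _; rewrite ffunE. Qed.

Lemma edeg_eunit k : edeg (eunit k) = 1%N.
Proof.
rewrite /edeg (bigD1 k) //= ffunE eqxx big1 // => l /negbTE lk.
by rewrite ffunE lk.
Qed.

Lemma edeg_eq0 a : edeg a = 0%N -> a = 0.
Proof.
move/eqP; rewrite sum_nat_eq0 => /forallP a0; apply/ffunP => k; rewrite ffunE.
exact/eqP/(implyP (a0 k)).
Qed.

Lemma edeg_pick a : a <> 0 -> exists k b, a = eunit k + b.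
Proof.
move=> a0; have [k ak|az] := pickP (fun k => 0 < a k)%N; last first.
  by case: a0; apply/ffunP => k; rewrite ffunE; have := az k; case: (a k).
exists k, (csub a (eunit k)); apply/ffunP => l; rewrite !ffunE.
case: eqP => [->|_]; last by rewrite subn0.
by rewrite -[LHS](subnKC ak).
Qed.

Lemma edeg_eq1 a : edeg a = 1%N -> exists k, a = eunit k.
Proof.
move=> a1; have [|k [b abk]] := @edeg_pick a; first by move=> a0; rewrite a0 edeg0 in a1.
exists k; move: a1; rewrite abk edegD edeg_eunit => -[/edeg_eq0->].
by rewrite addr0.
Qed.

Lemma eunit_neq0 k : eunit k != 0 :> expo K.
Proof. by apply/eqP => /(congr1 (@edeg K)); rewrite edeg_eunit edeg0. Qed.

Lemma eunit_inj : injective (@eunit K).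
Proof.
by move=> k l /ffunP/(_ k); rewrite !ffunE eqxx; case: eqP.
Qed.

Lemma reduced_eunit k : reduced par (eunit k).
Proof. by apply/forallP => l; apply/implyP => _; rewrite ffunE; case: eqP. Qed.

Lemma eunit_decomp k a b : a + b = eunit k ->
  (a = 0 /\ b = eunit k) \/ (a = eunit k /\ b = 0).
Proof.
move=> abk; have := congr1 (@edeg K) abk; rewrite edegD edeg_eunit.
case ea: (edeg a) => [|n].
  by move: abk; rewrite (edeg_eq0 ea) add0r; left.
rewrite addSn => -[/eqP]; rewrite addn_eq0 => /andP[_ /eqP/edeg_eq0 b0].
by move: abk; rewrite b0 addr0; right.
Qed.

Definition lin f k := coef f (eunit k).

Lemma eps0 : eps (0 : S) = 0.
Proof. by rewrite /eps coef_mksps ?reduced0. Qed.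
Lemma coef_zero a : coef (0 : S) a = 0.
Proof. by rewrite /= if_same. Qed.

Lemma coef_scale (z : C) f a : coef (z *: f) a = z * coef f a.
Proof. by rewrite /=; case: ifPn => // ra; rewrite coef_reduced // mulr0. Qed.

Lemma coef_opp f a : coef (- f) a = - coef f a.
Proof. by rewrite -scaleN1r coef_scale mulN1r. Qed.

Lemma coef_bigsum (I : Type) (r : seq I) (P : pred I) (F : I -> S) a :
  coef (\sum_(i <- r | P i) F i) a = \sum_(i <- r | P i) coef (F i) a.
Proof.
apply: (big_morph (fun f : S => coef f a)) => [f g|]; [exact: coefD|exact: coef_zero].
Qed.

Lemma epsD f g : eps (f + g) = eps f + eps g.
Proof. exact: coefD. Qed.
Lemma epsN f : eps (- f) = - eps f.
Proof. exact: coef_opp. Qed.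
Lemma epsZ z f : eps (z *: f) = z * eps f.
Proof. exact: coef_scale. Qed.

Lemma eps1 : eps (1 : S) = 1.
Proof. by rewrite /eps /= reduced0 eqxx. Qed.

Lemma lin1 k : lin 1 k = 0.
Proof. by rewrite /lin /= (negbTE (eunit_neq0 k)) if_same. Qed.

Lemma linD f g k : lin (f + g) k = lin f k + lin g k.
Proof. exact: coefD. Qed.
Lemma linN f k : lin (- f) k = - lin f k.
Proof. exact: coef_opp. Qed.
Lemma linZ z f k : lin (z *: f) k = z * lin f k.
Proof. exact: coef_scale. Qed.

Lemma eps_gen k : eps (gen k : S) = 0.
Proof. by rewrite /eps /= eq_sym (negbTE (eunit_neq0 k)) if_same. Qed.

Lemma coef_gen k l : coef (gen k : S) (eunit l) = (l == k)%:R.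
Proof. by rewrite /= reduced_eunit (inj_eq eunit_inj). Qed.

Lemma coef_one a : (0 < edeg a)%N -> coef (1 : S) a = 0.
Proof.
by move=> a0 /=; case: (a =P 0) => [a_eq|]; [rewrite a_eq edeg0 in a0|rewrite if_same].
Qed.

Lemma coef_gen_deg k a : edeg a != 1%N -> coef (gen k : S) a = 0.
Proof.
by move=> a1 /=; case: (a =P eunit k) => [a_eq|];
  [rewrite a_eq edeg_eunit in a1|rewrite if_same].
Qed.

Lemma lin_gen k l : lin (gen k) l = (l == k)%:R.
Proof. exact: coef_gen. Qed.

Lemma epsE f : eps f = coef f 0.
Proof. by []. Qed.

Lemma coef_eunit f k : coef f (eunit k) = lin f k.
Proof. by []. Qed.

Lemma csub0 a : csub a 0 = a.
Proof. by apply/ffunP => k; rewrite !ffunE subn0. Qed.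
Lemma csubxx a : csub a a = 0.
Proof. by apply/ffunP => k; rewrite !ffunE subnn. Qed.

Lemma epsM f g : eps (f * g) = eps f * eps g.
Proof.
rewrite /eps (@coef_mul_seq _ _ _ [:: 0]) ?reduced0 //.
- by rewrite big_seq1 csub0 esign0l mul1r.
- by move=> a; rewrite inE => /eqP->; rewrite csub0 addr0.
- move=> a b ab0; have := congr1 (@edeg K) ab0.
  rewrite edegD edeg0 => /eqP; rewrite addn_eq0 inE => /andP[/eqP/edeg_eq0-> _].
  by rewrite eqxx.
Qed.

Lemma linM f g k : lin (f * g) k = eps f * lin g k + lin f k * eps g.
Proof.
rewrite /lin /eps (@coef_mul_seq _ _ _ [:: 0; eunit k]) ?reduced_eunit //.
- rewrite big_cons big_seq1 csub0 csubxx esign0l esign0r !mul1r //.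
- by rewrite /= inE eq_sym eunit_neq0.
- move=> a; rewrite !inE => /orP[]/eqP->; first by rewrite csub0 add0r.
  by rewrite csubxx addr0.
- by move=> a b /eunit_decomp[][-> _]; rewrite !inE eqxx ?orbT.
Qed.

Lemma eps_prod (I : Type) (r : seq I) (F : I -> S) :
  eps (\prod_(i <- r) F i) = \prod_(i <- r) eps (F i).
Proof. exact: (big_morph (@eps C K par) epsM eps1). Qed.

(** Order at least [d] in the filtration by total degree. The filtration is multiplicative and
    separated, which gives the convergence used to invert matrices. *)
Definition vanish (d : nat) f : Prop := forall a, (edeg a < d)%N -> coef f a = 0.

Lemma vanishD d f g : vanish d f -> vanish d g -> vanish d (f + g).
Proof. by move=> vf vg a ad; rewrite coefD vf // vg // addr0. Qed.

Lemma vanish_sum d (I : Type) (r : seq I) (P : pred I) (F : I -> S) :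
  (forall i, P i -> vanish d (F i)) -> vanish d (\sum_(i <- r | P i) F i).
Proof. by move=> vF a ad; rewrite coef_bigsum big1 // => i /vF ->. Qed.

Lemma vanishM d e f g : vanish d f -> vanish e g -> vanish (d + e) (f * g).
Proof.
move=> vf vg c cd; have [rc|rc] := boolP (reduced par c); last exact: coef_reduced.
rewrite (@coef_mul_seq _ _ _ [::]) ?big_nil // => a b abc _.
have := cd; rewrite -abc edegD => abd.
case: (ltnP (edeg a) d) => [/vf->|da]; first by rewrite mul0r.
by rewrite vg ?mulr0 // -(ltn_add2l d); apply: leq_ltn_trans abd; rewrite leq_add2r.
Qed.

Lemma vanish1 f : eps f = 0 -> vanish 1 f.
Proof. by move=> f0 a; rewrite ltnS leqn0 => /eqP/edeg_eq0->. Qed.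

Lemma vanish_le d e f : (d <= e)%N -> vanish e f -> vanish d f.
Proof. by move=> de ve a ad; apply: ve; exact: leq_trans de. Qed.

Lemma vanish_all f : (forall d, vanish d f) -> f = 0.
Proof. by move=> v; apply/spsP => a; rewrite coef_zero (v (edeg a).+1). Qed.

(** * Inverse of a matrix congruent to the identity modulo the kernel of the counit *)

Section MatrixInverse.
Variables (p : nat) (N : 'M[S]_p).
Hypothesis N0 : forall i j, eps (N i j) = 0.

Let mvanish d (M : 'M[S]_p) := forall i j, vanish d (M i j).

Lemma mvanishM d e (A B : 'M[S]_p) :
  mvanish d A -> mvanish e B -> mvanish (d + e) (A *m B).
Proof.
by move=> vA vB i j; rewrite mxE; apply: vanish_sum => k _; exact: vanishM.
Qed.

Lemma mvanish_exp d : mvanish d ((- N) ^+ d).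
Proof.
elim: d => [|d IH] i j; first by move=> a.
rewrite exprS -mulmxE; apply: (@mvanishM 1) => // {}i {}j.
by rewrite mxE; apply: vanish1; rewrite epsN N0 oppr0.
Qed.

Definition geom d : 'M[S]_p := \sum_(i < d.+1) (- N) ^+ i.
(** As the power i of [- N] has order at least i, the coefficient at [a] is stationary from the
    partial sum of index [edeg a] on, and it is read there. *)
Definition geom_lim : 'M[S]_p :=
  \matrix_(i, j) mksps (fun a => coef (geom (edeg a) i j) a).

Lemma geom_mulr d : (1 + N) * geom d = 1 - (- N) ^+ d.+1.
Proof.
rewrite /geom; elim: d => [|d IH].
  by rewrite big_ord1 expr0 mulr1 expr1 opprK.
rewrite big_ord_recr mulrDr IH /= mulrDl mul1r [in RHS]exprS mulNr opprK.
by rewrite addrA subrK.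
Qed.

Lemma geom_mull d : geom d * (1 + N) = 1 - (- N) ^+ d.+1.
Proof.
rewrite /geom; elim: d => [|d IH].
  by rewrite big_ord1 expr0 mul1r expr1 opprK.
rewrite big_ord_recr mulrDl IH /= mulrDr mulr1 [in RHS]exprSr mulrN opprK.
by rewrite addrA subrK.
Qed.

Lemma geom_diff d e : (e <= d)%N -> mvanish e.+1 (geom d - geom e).
Proof.
move=> ed i j; rewrite /geom -!(big_mkord xpredT (fun i => (- N) ^+ i)).
rewrite (@big_cat_nat _ _ _ e.+1 0 d.+1) //= addrAC subrr add0r big_nat.
rewrite summxE; apply: vanish_sum => l /andP[el _].
by apply: (vanish_le el); exact: mvanish_exp.
Qed.

Lemma geom_limP d : mvanish d.+1 (geom_lim - geom d).
Proof.
move=> i j a; rewrite ltnS => ad; rewrite !mxE coefD coef_opp.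
have [ra|ra] := boolP (reduced par a); last by rewrite !coef_reduced ?subrr.
rewrite coef_mksps //; have := @geom_diff d (edeg a) ad i j a (leqnn _).
rewrite 2!mxE coefD coef_opp => /eqP; rewrite subr_eq0 => /eqP->.
by rewrite subrr.
Qed.

(* The inverse is the coefficientwise limit of the geometric series. *)
Lemma mx_inv_exists : exists L, (1%:M + N) *m L = 1%:M /\ L *m (1%:M + N) = 1%:M.
Proof.
have vDN A : mvanish 0 A by [].
(* The filtration is separated, so an identity may be checked up to every order. *)
have fin (A : 'M[S]_p) : (forall d, mvanish d.+1 (A - 1)) -> A = 1.
  move=> vA; apply/eqP; rewrite -subr_eq0; apply/eqP/matrixP => i j.
  rewrite [RHS]mxE; apply: vanish_all => d; exact: vanish_le (vA d i j).
have canc (x y : 'M[S]_p) : x + (1 - y) - 1 = x - y.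
  by rewrite -addrA [1 - y - 1]addrAC subrr add0r.
exists geom_lim; rewrite mulmxE; split; apply: fin => d.
  (* The limit is the partial sum of index [d] plus a remainder of order d + 1; telescoping leaves a
     power of [- N] of the same order. *)
  rewrite -[geom_lim](subrK (geom d)) mulrDr geom_mulr canc.
  move=> i j; rewrite mxE; apply: vanishD.
    by apply: (@mvanishM 0) => //; exact: geom_limP.
  by rewrite mxE -mulN1r; apply: (@vanishM 0) => //; exact: mvanish_exp.
rewrite -[geom_lim](subrK (geom d)) mulrDl geom_mull canc.
move=> i j; rewrite mxE; apply: vanishD.
  by rewrite -[d.+1]addn0; apply: mvanishM => //; exact: geom_limP.
by rewrite mxE -mulN1r; apply: (@vanishM 0) => //; exact: mvanish_exp.
Qed.

End MatrixInverse.

End Series.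

(** * Factorisations in degree two, and parity *)

Section LowDegree.
Variables (C : numClosedFieldType) (K : finType) (par : pred K).
Local Notation S := (sps C par).
Implicit Types (f g u v : S) (a b c : expo K) (k l s t : K).

Lemma coef_gen_mul k g c : reduced par c -> coef (gen k * g) c =
  if (0 < c k)%N then (-1) ^+ esign par (eunit k) (csub c (eunit k)) *
    coef g (csub c (eunit k)) else 0.
Proof.
move=> rc; rewrite (@coef_mul_seq _ _ _ _ _ _ (if (0 < c k)%N then [:: eunit k] else
  [::])) //.
- case: ifP => ck; rewrite ?big_nil // big_seq1.
  by rewrite coef_gen eqxx mul1r.
- by case: ifP.
- move=> a; case: ifP => // ck; rewrite inE => /eqP->.
  apply/ffunP => l; rewrite !ffunE; case: eqP => [->|_];
    first by rewrite [LHS](subnKC ck).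
  by rewrite subn0 [LHS]add0n.
- move=> a b abc na; rewrite /=; case: (a =P eunit k) => [ak|_];
  last by rewrite if_same mul0r.
  have ck : (0 < c k)%N by rewrite -abc !ffunE ak !ffunE eqxx; exact: ltn0Sn.
  by rewrite ck ak inE eqxx in na.
Qed.

(** Each monomial of [f] is divided by one generator chosen in its support, so the quotients
    recombine without overlap even for an infinite series. This puts [f] in the square of the kernel
    of the counit, as a finite sum of products. *)
Lemma ker_decomp f : eps f = 0 -> (forall k, lin f k = 0) ->
  exists g : K -> S, (forall k, eps (g k) = 0) /\ f = \sum_k gen k * g k.
Proof.
move=> f0 f1; pose first c := [pick k | (0 < c k)%N].
exists (fun k => mksps (fun b => if first (eunit k + b) == Some k
  then (-1) ^+ esign par (eunit k) b * coef f (eunit k + b) else 0)); split.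
  move=> k; rewrite /eps coef_mksps ?reduced0 // addr0.
  by rewrite [coef f _]f1 mulr0 if_same.
apply: spsPr => c rc; rewrite coef_bigsum.
transitivity (\sum_k if first c == Some k then coef f c else 0).
  rewrite /first; case: pickP => [k ck|c0].
    rewrite (bigD1 k) //= eqxx big1 ?addr0 // => l /negbTE lk.
    by rewrite (inj_eq Some_inj) eq_sym lk.
  rewrite big1 ?addr0 //; have -> : c = 0; last exact: f0.
  by apply/ffunP => k; rewrite ffunE; have := c0 k; case: (c k).
apply: eq_bigr => k _; rewrite coef_gen_mul //.
case: ifP => [/eqP|] fc; last first.
  case: ifP => // ck; have kc : eunit k + csub c (eunit k) = c.
    apply/ffunP => l; rewrite !ffunE; case: eqP => [->|_];
      first by rewrite [LHS](subnKC ck).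
    by rewrite subn0 [LHS]add0n.
  by rewrite /= kc fc if_same mulr0.
have ck : (0 < c k)%N by move: fc; rewrite /first; case: pickP => // l cl [<-].
have kc : eunit k + csub c (eunit k) = c.
  apply/ffunP => l; rewrite !ffunE; case: eqP => [->|_];
    first by rewrite [LHS](subnKC ck).
  by rewrite subn0 [LHS]add0n.
rewrite ck coef_mksps; last by apply: (@reducedDr _ _ (eunit k)); rewrite kc.
(* The sign built into [g k] cancels the one created by moving [gen k] back in front. *)
by rewrite kc fc eqxx mulrA -expr2 sqrr_sign mul1r.
Qed.

Lemma sum_linear d (F : expo K -> C) : (0 < d)%N ->
    (forall a, edeg a != 1%N -> F a = 0) ->
  \sum_(a <- ebox K d) F a = \sum_k F (eunit k).
Proof.
move=> d0 F1; transitivity (\sum_(a <- ebox K d | edeg a == 1%N) F a).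
  by rewrite [RHS]big_mkcond; apply: eq_bigr => a _; case: ifPn => // /F1.
rewrite -big_filter -(big_map (@eunit K) xpredT); apply: perm_big; apply: uniq_perm.
- by rewrite filter_uniq ?ebox_uniq.
- by rewrite map_inj_uniq ?index_enum_uniq //; exact: eunit_inj.
move=> a; rewrite mem_filter; apply/andP/mapP => [[/eqP/edeg_eq1[k ->] _]|[k _ ->]].
  by exists k; rewrite ?mem_index_enum.
rewrite edeg_eunit mem_ebox; split=> //; apply/forallP => l; rewrite ffunE.
by apply: leq_trans d0; case: eqP.
Qed.

Lemma esign_eunit s t : esign par (eunit s) (eunit t) =
  [&& par s, par t & (enum_rank t < enum_rank s)%N].
Proof.
rewrite /esign; have [ps|ps] := boolP (par s); last first.
  rewrite big1 // => k pk; rewrite big1 // => l _; rewrite ffunE.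
  by case: eqP => // ks; rewrite ks (negbTE ps) in pk.
rewrite (bigD1 s) //= [X in (_ + X)%N]big1 ?addn0; last first.
  by move=> k /andP[_ /negbTE ks]; rewrite big1 // => l _; rewrite ffunE ks.
have [pt|pt] := boolP (_ && _).
  rewrite (bigD1 t) //= !ffunE !eqxx big1 // => l /andP[_ /negbTE lt].
  by rewrite !ffunE lt muln0.
rewrite big1 // => l pl; rewrite !ffunE; case: (l =P t) => [lt|_]; last by rewrite muln0.
by rewrite lt (negbTE pt) in pl.
Qed.

Lemma csubC a b : csub (a + b) b = a.
Proof. by rewrite addrC csubK. Qed.

Lemma reduced_eunit2 s t : s != t -> reduced par (eunit s + eunit t).
Proof.
move=> st; apply/forallP => k; apply/implyP => _; rewrite !ffunE.
case: (k =P s) => [->|_]; first by rewrite (negbTE st).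
by case: (k == t).
Qed.

Lemma edeg2_decomp a b c : a + b = c -> edeg c = 2%N ->
  [\/ a = 0, b = 0 | exists s t, a = eunit s /\ b = eunit t].
Proof.
move=> <-; rewrite edegD; case ea: (edeg a) => [|[|n]] e2.
- by constructor 1; exact: edeg_eq0.
- constructor 3; have [s as_] := edeg_eq1 ea; have [t bt] := @edeg_eq1 _ b ltac:(lia).
  by exists s, t.
- by constructor 2; apply: edeg_eq0; lia.
Qed.

Lemma eunit2_inj s t s' t' : s != t -> eunit s + eunit t = eunit s' + eunit t' :> expo K
  ->
  (s' = s /\ t' = t) \/ (s' = t /\ t' = s).
Proof.
move=> st e; have := congr1 (fun a : expo K => a s) e;
  have := congr1 (fun a : expo K => a t) e.
rewrite !ffunE !eqxx (negbTE st) [t == s]eq_sym (negbTE st).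
have [ts|ts] := eqVneq t s'; have [st'|st'] := eqVneq s t' => // ; first by right.
- by rewrite -ts (negbTE st).
- by rewrite -st' [t == s]eq_sym (negbTE st).
by case: (t =P t') => [<-|] //; case: (s =P s') => [<-|] //; left.
Qed.

(** Without constant terms, a quadratic monomial of a product can only arise as linear times linear,
    in the two possible orders. *)
Lemma coef_mul_eunit2 u v s t : s != t -> eps u = 0 -> eps v = 0 ->
  coef (u * v) (eunit s + eunit t) =
    (-1) ^+ esign par (eunit s) (eunit t) * (lin u s * lin v t)
    + (-1) ^+ esign par (eunit t) (eunit s) * (lin u t * lin v s).
Proof.
move=> st u0 v0.
rewrite (@coef_mul_seq _ _ _ _ _ _ [:: eunit s; eunit t]) ?reduced_eunit2 //.
- by rewrite big_cons big_seq1 csubK csubC.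
- by rewrite /= inE (inj_eq (@eunit_inj K)) st.
- move=> a; rewrite !inE => /orP[]/eqP->; first by rewrite csubK.
  by rewrite csubC addrC.
move=> a b abst nast.
have [||[s' [t' [as' bt']]]] := edeg2_decomp abst ltac:(by rewrite edegD !edeg_eunit).
- by move=> ->; rewrite [coef u _]u0 mul0r.
- by move=> ->; rewrite [coef v _]v0 mulr0.
case/negP: nast; rewrite !inE as'; subst a b.
by case: (eunit2_inj st (esym abst)) => -[-> _]; rewrite eqxx ?orbT.
Qed.

(** A coefficientwise form of [homog], which passes to sums and products directly. *)
Definition parity_of (p : bool) f : Prop := forall a, epar par a != p -> coef f a = 0.

Lemma eparD a b : epar par (a + b) = epar par a (+) epar par b.
Proof.
rewrite /epar -oddD -big_split; congr odd; apply: eq_bigr => k _.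
by rewrite ffunE.
Qed.

Lemma epar0 : epar par 0 = false.
Proof. by rewrite /epar big1 // => k _; rewrite ffunE. Qed.

Lemma epar_eunit k : epar par (eunit k) = par k.
Proof.
rewrite /epar big_mkcond (bigD1 k) //= big1 => [|l /negbTE lk].
  by rewrite addn0 ffunE eqxx; case: (par k).
by rewrite ffunE lk if_same.
Qed.

Lemma parity_ofM p q f g :
  parity_of p f -> parity_of q g -> parity_of (p (+) q) (f * g).
Proof.
move=> fp gq c cpq; have [rc|rc] := boolP (reduced par c); last exact: coef_reduced.
rewrite (@coef_mul_seq _ _ _ _ _ _ [::]) ?big_nil // => a b abc _.
have [ap|/fp->] := eqVneq (epar par a) p; last by rewrite mul0r.
have [bq|/gq->] := eqVneq (epar par b) q; last by rewrite mulr0.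
by rewrite -abc eparD ap bq eqxx in cpq.
Qed.

Lemma parity_of1 : parity_of false 1.
Proof.
move=> a /=; case: (a =P 0) => [->|_]; first by rewrite epar0.
by rewrite if_same.
Qed.

Lemma parity_ofX n p f : parity_of p f -> parity_of (odd n && p) (f ^+ n).
Proof.
move=> fp; elim: n => [|n IH]; first exact: parity_of1.
rewrite exprS; have -> : odd n.+1 && p = p (+) (odd n && p) by rewrite /=;
  case: p (odd n) {fp IH} => [] [].
exact: parity_ofM.
Qed.

Lemma parity_ofD p f g : parity_of p f -> parity_of p g -> parity_of p (f + g).
Proof. by move=> fp gp a ap; rewrite coefD fp // gp // addr0. Qed.

Lemma parity_of_sum p (I : Type) (r : seq I) (P : pred I) (F : I -> S) :
  (forall i, P i -> parity_of p (F i)) -> parity_of p (\sum_(i <- r | P i) F i).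
Proof. by move=> Fp a ap; rewrite coef_bigsum big1 // => i /Fp ->. Qed.

Lemma parity_of_gen k : parity_of (par k) (gen k).
Proof.
move=> a /=; case: (a =P _) => [->|_]; first by rewrite epar_eunit eqxx.
by rewrite if_same.
Qed.

End LowDegree.

(** * Substitution of series without constant term *)

Section Subst.
Variables (C : numClosedFieldType) (K K' : finType) (par : pred K) (par' : pred K').
Variable g : K -> sps C par'.
Implicit Types (f : sps C par) (a : expo K) (b : expo K').
Hypothesis g0 : forall k, eps (g k) = 0.

Lemma prod_exp0 : \prod_k g k ^+ ((0%R : expo K) k) = 1.
Proof. by rewrite big1 // => k _; rewrite ffunE. Qed.

Lemma prod_eunit k : \prod_l g l ^+ (eunit k l) = g k.
Proof.
rewrite (eq_bigr (fun l => if l == k then g l else 1)) => [|l _].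
  by rewrite -big_mkcond big_pred1_eq.
by rewrite ffunE; case: eqP => // ->; rewrite expr1.
Qed.

(** Isolates a product of two factors from a monomial of degree at least two, inside any
    multiplicatively closed class [A]; linear functionals that kill such products then ignore the
    monomial. *)
Lemma prod_exp_ge2 a (A : sps C par' -> Prop) :
    (forall k, A (g k)) -> (forall u v, A u -> A v -> A (u * v)) ->
  (1 < edeg a)%N -> exists u v, [/\ A u, A v & \prod_k g k ^+ a k = u * v].
Proof.
move=> Ag AM; pose r := flatten [seq nseq (a k) k | k <- index_enum K].
have -> : \prod_k g k ^+ a k = \prod_(k <- r) g k.
  rewrite big_flatten big_map; apply: eq_bigr => k _.
  by rewrite big_nseq; elim: (a k) => //= n <-; rewrite exprS.
have -> : edeg a = size r.
  by rewrite size_flatten /shape -map_comp sumnE big_map; apply: eq_bigr => k _ /=;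
    rewrite size_nseq.
have Ar k s : A (\prod_(x <- k :: s) g x).
  elim: s k => [|l s IH] k; first by rewrite big_seq1.
  by rewrite big_cons; exact: AM.
clearbody r; by case: r => [|k [|l s]] // _; exists (g k), (\prod_(x <- l :: s) g x);
  split=> //; exact: big_cons.
Qed.

Lemma eps_subst f : eps (subst g f) = eps f.
Proof.
rewrite /eps coef_mksps ?reduced0 // edeg0 (bigD1_seq 0) ?ebox_uniq //=; last first.
  by rewrite mem_ebox; apply/forallP => k; rewrite ffunE.
rewrite prod_exp0 [coef 1 0]eps1 mulr1 big1_seq ?addr0 // => a /andP[/eqP a0].
rewrite mem_ebox => /forallP az; case: a0; apply/ffunP => k; rewrite ffunE.
by apply/eqP; rewrite -leqn0.
Qed.

Definition coef_comb (bs : seq (C * expo K')) (F : sps C par') : C :=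
  \sum_(zb <- bs) zb.1 * coef F zb.2.

(* A combination of coefficients that kills 1 and all products only sees the
   linear part of the substituted series. *)
Lemma subst_first_order (A : sps C par' -> Prop) (d : nat) bs f :
    (0 < d)%N -> (forall zb, zb \in bs -> reduced par' zb.2 /\ edeg zb.2 = d) ->
    (forall k, A (g k)) -> (forall u v, A u -> A v -> A (u * v)) ->
    coef_comb bs 1 = 0 -> (forall u v, A u -> A v -> coef_comb bs (u * v) = 0) ->
  coef_comb bs (subst g f) = \sum_k lin f k * coef_comb bs (g k).
Proof.
move=> d0 bsd Ag AM D1 DM.
(* All exponents in [bs] have the same degree [d], so their coefficients are sums over one common
   box and the combination can be taken inside. *)
transitivity (\sum_(a <- ebox K d) coef f a * coef_comb bs (\prod_k g k ^+ a k)).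
  rewrite /coef_comb big_seq; under [RHS]eq_bigr do rewrite big_seq mulr_sumr.
  rewrite exchange_big /=; apply: eq_bigr => zb /bsd[rb db].
  rewrite rb db mulr_sumr; apply: eq_bigr => a _.
  by rewrite mulrCA.
rewrite sum_linear //; first by apply: eq_bigr => k _; rewrite prod_eunit.
move=> a; case ea: (edeg a) => [|[|n]] // _.
  by rewrite (edeg_eq0 ea) prod_exp0 D1 mulr0.
have [|u [v [Au Av ->]]] := @prod_exp_ge2 a A Ag AM; first by rewrite ea.
by rewrite DM // mulr0.
Qed.

Lemma lin_subst f k : lin (subst g f) k = \sum_l lin f l * lin (g l) k.
Proof.
have DE F : coef_comb [:: (1, eunit k)] F = lin F k by rewrite /coef_comb big_seq1 mul1r.
rewrite -DE (@subst_first_order (fun u => eps u = 0) 1) //.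
- by apply: eq_bigr => l _; rewrite DE.
- by move=> zb; rewrite inE => /eqP->; split; [exact: reduced_eunit|exact: edeg_eunit].
- by move=> u v u0 v0; rewrite epsM u0 mul0r.
- by rewrite DE lin1.
- by move=> u v u0 v0; rewrite DE linM u0 v0 mulr0 mul0r addr0.
Qed.

Hypothesis gpar : forall k, parity_of (par k) (g k).

Lemma parity_prod_exp a : parity_of (epar par a) (\prod_k g k ^+ a k).
Proof.
rewrite /epar; elim: (index_enum K) => [|k r IH]; first by rewrite !big_nil;
  exact: parity_of1.
rewrite !big_cons.
have -> : odd (if par k then a k + \sum_(j <- r | par j) a j else \sum_(j <- r | par j)
  a j)
    = (odd (a k) && par k) (+) odd (\sum_(j <- r | par j) a j).
  by case: (par k); rewrite ?oddD ?andbT ?andbF.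
by apply: parity_ofM => //; exact: parity_ofX.
Qed.

Lemma coef_subst_hpart q f b : coef (subst g (hpart q f)) b =
  if epar par' b == q then coef (subst g f) b else 0.
Proof.
have [rb|rb] := boolP (reduced par' b); last by rewrite !coef_reduced ?if_same.
rewrite !coef_mksps //.
transitivity (\sum_(a <- ebox K (edeg b)) if epar par' b == q then coef f a * coef
  (\prod_k g k ^+ a k) b else 0).
  apply: eq_bigr => a _; have [ra|ra] := boolP (reduced par a); last first.
    by rewrite (coef_reduced f ra) (coef_reduced (hpart q f) ra) !mul0r if_same.
  rewrite (coef_mksps _ ra); have [ab|ab] := eqVneq (epar par' b) (epar par a).
    by rewrite ab; case: eqP => // _; rewrite mul0r.
  by rewrite (parity_prod_exp ab) !mulr0 if_same.
by case: eqP => // _; rewrite big1.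
Qed.

End Subst.

Arguments lin : simpl never.
Arguments eps : simpl never.
Arguments coef : simpl never.

(** * First-order parts *)

Section FirstOrder.
Variables (C : numClosedFieldType) (K : finType) (par : pred K).
Local Notation S := (sps C par).
Implicit Types (f g u v : S) (k : K).

Lemma eps_sum (I : Type) (r : seq I) (P : pred I) (F : I -> S) :
  eps (\sum_(i <- r | P i) F i) = \sum_(i <- r | P i) eps (F i).
Proof. exact: coef_bigsum. Qed.
Lemma lin_sum (I : Type) (r : seq I) (P : pred I) (F : I -> S) k :
  lin (\sum_(i <- r | P i) F i) k = \sum_(i <- r | P i) lin (F i) k.
Proof. exact: coef_bigsum. Qed.

Lemma eps_natr j : eps (j%:R : S) = j%:R.
Proof. by elim: j => [|j IH]; rewrite ?eps0 // -addn1 !natrD epsD IH eps1. Qed.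
Lemma lin_natr j k : lin (j%:R : S) k = 0.
Proof. by elim: j => [|j IH]; rewrite ?[lin _ _]coef_zero // -addn1 !natrD linD IH lin1
  addr0. Qed.

Lemma sign_scale (e : nat) f : (-1) ^+ e * f = (-1) ^+ e *: f.
Proof. by rewrite -[in RHS]signr_odd -[in LHS]signr_odd; case: (odd e);
  rewrite ?expr1 ?expr0 ?mul1r ?scale1r ?mulN1r ?scaleN1r. Qed.

Section Inverse.
Variables (p : nat) (M : 'M[S]_p).
Hypothesis Mid : forall i j, eps (M i j) = (i == j)%:R.

Lemma mxinvP : M *m mxinv M = 1%:M /\ mxinv M *m M = 1%:M.
Proof.
apply: (@xgetPex _ M [set L | M *m L = 1%:M /\ L *m M = 1%:M]%classic).
have -> : M = 1%:M + (M - 1%:M) by rewrite addrC subrK.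
apply: mx_inv_exists => i j; rewrite !mxE epsD epsN Mid.
by rewrite eps_natr subrr.
Qed.

(** A fixed-point form of the inverse: [M - 1%:M] has no constant term, so the right-hand side
    determines first the constant and then the linear part. *)
Lemma mxinvE : mxinv M = 1%:M - (M - 1%:M) *m mxinv M.
Proof. by rewrite mulmxBl mxinvP.1 mul1mx opprB addrC subrK. Qed.

Lemma epsM1 i j : eps ((M - 1%:M) i j) = 0.
Proof. by rewrite !mxE epsD epsN Mid eps_natr subrr. Qed.

Lemma eps_mxinv i j : eps (mxinv M i j) = (i == j)%:R.
Proof.
rewrite mxinvE [X in eps X]mxE [(- _ : 'M__) i j]mxE epsD epsN [X in X - _]/= mxE.
rewrite eps_natr mxE eps_sum big1 ?subr0 // => l _.
by rewrite epsM epsM1 mul0r.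
Qed.

Lemma lin_mxinv i j k : lin (mxinv M i j) k = - lin (M i j) k.
Proof.
rewrite mxinvE [X in lin X]mxE [(- _ : 'M__) i j]mxE linD linN mxE.
rewrite lin_natr sub0r mxE lin_sum (bigD1 j) //= big1 => [|l /negbTE lj].
  rewrite addr0 linM epsM1 mul0r add0r eps_mxinv eqxx mulr1.
  by rewrite !mxE linD linN lin_natr subr0.
by rewrite linM epsM1 mul0r eps_mxinv lj mulr0 addr0.
Qed.

Lemma eps_prod_0 (I : eqType) (r : seq I) (F : I -> S) :
  has (fun i => eps (F i) == 0) r -> eps (\prod_(i <- r) F i) = 0.
Proof.
by rewrite eps_prod => /hasP[i ir /eqP i0]; rewrite (big_rem i) //= i0 mul0r.
Qed.

Lemma lin_prod_0 (I : eqType) (r : seq I) (F : I -> S) k :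
  (1 < count (fun i => eps (F i) == 0%R) r)%N -> lin (\prod_(i <- r) F i) k = 0.
Proof.
elim: r => // i r IH /=; case: eqP => /= [i0|_]; last first.
  by rewrite add0n big_cons linM => c; rewrite IH // mulr0 eps_prod_0 ?mulr0 ?addr0 //
    has_count; lia.
rewrite add1n ltnS -has_count => h.
by rewrite big_cons linM i0 mul0r eps_prod_0 // mulr0 addr0.
Qed.

Lemma lin_prod_1 (I : Type) (r : seq I) (F : I -> S) k :
  (forall i, eps (F i) = 1) -> lin (\prod_(i <- r) F i) k = \sum_(i <- r) lin (F i) k.
Proof.
move=> F1; elim: r => [|i r IH]; first by rewrite !big_nil lin1.
have r1 : eps (\prod_(j <- r) F j) = 1 by rewrite eps_prod big1.
by rewrite !big_cons linM IH F1 r1 mul1r mulr1 addrC.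
Qed.

Lemma eps_det : eps (\det M) = 1.
Proof.
rewrite /determinant eps_sum (bigD1 (1%g : 'S_p)) //= [X in _ + X]big1 => [|s s1].
  rewrite addr0 odd_perm1 mul1r eps_prod big1 // => i _.
  by rewrite perm1 Mid eqxx.
rewrite sign_scale epsZ eps_prod_0 ?mulr0 //; apply/hasP.
have [i si|sid] := pickP (fun i => s i != i).
  by exists i; rewrite ?mem_index_enum // Mid [i == _]eq_sym (negbTE si).
by case/eqP: s1; apply/permP => i; rewrite perm1; apply/eqP/negbFE/sid.
Qed.

Lemma lin_det k : lin (\det M) k = \sum_i lin (M i i) k.
Proof.
rewrite /determinant lin_sum (bigD1 (1%g : 'S_p)) //= [X in _ + X]big1 => [|s s1].
  rewrite addr0 odd_perm1 mul1r lin_prod_1.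
    by apply: eq_bigr => i _; rewrite perm1.
  by move=> i; rewrite perm1 Mid eqxx.
rewrite sign_scale linZ lin_prod_0 ?mulr0 //.
have [i si|sid] := pickP (fun i => s i != i); last first.
  by case/eqP: s1; apply/permP => i; rewrite perm1; apply/eqP/negbFE/sid.
(* A permutation other than the identity moves two distinct indices, [i] and [s i]; both factors
   lack a constant term, so the product has order at least two. *)
rewrite -size_filter; apply: (@uniq_leq_size _ [:: i; s i]).
  by rewrite /= inE eq_sym si.
move=> j; rewrite !inE mem_filter mem_index_enum andbT Mid => /orP[]/eqP->.
  by rewrite [i == _]eq_sym (negbTE si).
by rewrite (inj_eq perm_inj) [i == _]eq_sym (negbTE si).
Qed.

End Inverse.

(** The geometric series for 1 x 1 matrices. *)
Lemma rinvP u : eps u = 1 -> u * rinv u = 1 /\ rinv u * u = 1.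
Proof.
move=> u1; apply: (@xgetPex _ u [set v | u * v = 1 /\ v * u = 1]%classic).
have [|L [uL Lu]] := @mx_inv_exists C K par 1 (u - 1)%:M.
  by move=> i j; rewrite !ord1 mxE epsD epsN u1 eps1 subrr.
exists (L 0 0).
have e : (1%:M + (u - 1)%:M : 'M[S]_1) = u%:M by rewrite -raddfD addrC /= subrK.
rewrite e in uL Lu.
move/matrixP/(_ 0 0): uL; move/matrixP/(_ 0 0): Lu.
by rewrite mul_scalar_mx !mxE big_ord1 !mxE eqxx !mulr1n.
Qed.

Lemma eps_rinv u : eps u = 1 -> eps (rinv u) = 1.
Proof. by move=> u1; have [/(congr1 (@eps _ _ _))] := rinvP u1;
  rewrite epsM u1 mul1r eps1. Qed.

Lemma lin_rinv u k : eps u = 1 -> lin (rinv u) k = - lin u k.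
Proof.
move=> u1; have [/(congr1 (fun f => lin f k))] := rinvP u1.
rewrite linM u1 (eps_rinv u1) mul1r mulr1 lin1 => /eqP.
by rewrite addr_eq0 => /eqP.
Qed.

End FirstOrder.

(** * First-order parts of the antipode, the star structure and the superdeterminant *)

Section Supergroup.
Variables (C : numClosedFieldType) (m n : nat).
Local Notation hser := (sps C (@gpar m n)).
Local Notation dt := (dtype C m n).
Local Notation idx := (gidx m n).
Local Notation xm := (@xmx C m n).
Implicit Types (f g : hser) (h x : dt) (i j : 'I_(m + n)) (s : bool).

Lemma deltaE h f : delta h f = \sum_k hval h k * lin f k.
Proof. by []. Qed.

Lemma lin_xgen s i j k : lin (xgen C s i j) k = (k == (s, (i, j)))%:R.
Proof. exact: coef_gen. Qed.

Lemma delta_xgen h s i j : delta h (xgen C s i j) = hval h (s, (i, j)).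
Proof.
rewrite deltaE (bigD1 (s, (i, j))) //= big1 => [|k /negbTE kn].
  by rewrite lin_xgen eqxx mulr1 addr0.
by rewrite lin_xgen kn mulr0.
Qed.

Lemma eps_unit_xmx s i j : eps ((1%:M + xm s) i j) = (i == j)%:R.
Proof. by rewrite !mxE epsD eps_gen addr0 eps_natr. Qed.

Lemma lin_unit_xmx s i j k : lin ((1%:M + xm s) i j) k = (k == (s, (i, j)))%:R.
Proof. by rewrite !mxE linD lin_natr add0r lin_xgen. Qed.

Lemma eps_antipode s i j : eps (antipode (xgen C s i j)) = 0.
Proof. by rewrite /antipode eps_subst eps_gen. Qed.

Lemma eps_antipode_gen s i j : eps (- (i == j)%:R + mxinv (1%:M + xm s) i j : hser) = 0.
Proof. by rewrite epsD epsN eps_natr (eps_mxinv (eps_unit_xmx s)) addNr. Qed.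

Lemma lin_antipode s i j k :
  lin (antipode (xgen C s i j)) k = - (k == (s, (i, j)))%:R.
Proof.
rewrite /antipode lin_subst; last by case=> s' [i' j']; exact: eps_antipode_gen.
rewrite (bigD1 (s, (i, j))) //= big1 => [|l /negbTE ln];
  last by rewrite lin_xgen ln mul0r.
rewrite lin_xgen eqxx mul1r addr0 linD linN lin_natr oppr0 add0r.
by rewrite (lin_mxinv (eps_unit_xmx s)) lin_unit_xmx.
Qed.

Lemma eps_starE f : eps (star f) = (eps f)^*.
Proof. by rewrite /star eps_subst /eps coef_mksps // reduced0. Qed.

(** To first order the antipode is minus the identity, so the star structure exchanges the
    generators of index [k] and [kbar k] up to sign. *)
Definition kbar (k : idx) : idx := (~~ k.1, (k.2.2, k.2.1)).
Definition ssgn (k : idx) : C :=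
  (-1) ^+ ((ipar k.2.1 (+) ipar k.2.2) && ipar k.2.2).

Lemma kbarK : involutive kbar.
Proof. by case=> s [i j]; rewrite /kbar /= negbK. Qed.

Lemma lin_star f k : lin (star f) k = - ((lin f (kbar k))^* * ssgn (kbar k)).
Proof.
rewrite /star lin_subst; last first.
  by case=> s [i j]; rewrite sign_scale epsZ eps_antipode mulr0.
rewrite (bigD1 (kbar k)) //= big1 => [|[s [i j]] kl].
  case: k => s [i j]; rewrite /kbar /= sign_scale linZ lin_antipode negbK eqxx.
  by rewrite addr0 /lin coef_mksps ?reduced_eunit // mulrN1 mulrN.
rewrite sign_scale linZ lin_antipode; case: eqP => [ke|]; last by rewrite oppr0 !mulr0.
by case/eqP: kl; rewrite ke /kbar /= negbK.
Qed.

Lemma hval_ofder (d : hser -> C) s i j : hval (ofder d) (s, (i, j)) = d (xgen C s i j).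
Proof. by case: s; rewrite /hval /= mxE. Qed.

Lemma hvalP h x : (forall k, hval h k = hval x k) -> h = x.
Proof.
case: h x => [A B] [A' B'] e; congr pair; apply/matrixP => i j.
  exact: (e (false, (i, j))).
exact: (e (true, (i, j))).
Qed.

Lemma hval_dphi h k : hval (dphi h) k = - (ssgn k * (hval h (kbar k))^*).
Proof.
case: k => s [i j]; rewrite hval_ofder deltaE rmorph_sum.
rewrite (bigD1 (kbar (s, (i, j)))) //= big1 => [|k kn].
  rewrite addr0 lin_star kbarK lin_xgen eqxx conjC1 mul1r rmorphM rmorphN.
  by rewrite /ssgn rmorphXn rmorphN1 mulrN mulrC.
rewrite lin_star lin_xgen; case: eqP => [ke|_].
  by case/eqP: kn; rewrite -ke kbarK.
by rewrite conjC0 mul0r oppr0 mulr0 conjC0.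
Qed.

(** [dphi] records values on generators only; since the linear part of [star f] depends only on that
    of [f], its defining formula extends to every function. *)
Lemma delta_star h f : delta h (star f) = (delta (dphi h) f)^*.
Proof.
rewrite !deltaE rmorph_sum (reindex_inj (inv_inj kbarK)); apply: eq_bigr => k _.
rewrite lin_star kbarK hval_dphi !rmorphM rmorphN rmorphM /= conjCK.
by rewrite [(ssgn k)^*]rmorphXn rmorphN1 -/(ssgn k); ring.
Qed.

Lemma strE (A : 'M[C]_(m + n)) : str A = \sum_i (-1) ^+ ipar i * A i i.
Proof.
rewrite big_split_ord /= /str /mxtrace; congr (_ + _).
  by apply: eq_bigr => i _; rewrite !mxE /ipar /= leqNgt ltn_ord mul1r.
rewrite -sumrN; apply: eq_bigr => i _.
by rewrite !mxE /ipar /= leq_addr mulN1r.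
Qed.

Section Sdet.
Variable s : bool.
Let M := 1%:M + xm s.
Let U := ulsubmx M - ursubmx M *m mxinv (drsubmx M) *m dlsubmx M.

Let ulE a b : ulsubmx M a b = M (lshift n a) (lshift n b).
Proof. by rewrite mxE mxE. Qed.
Let urE a b : ursubmx M a b = M (lshift n a) (rshift m b).
Proof. by rewrite mxE mxE. Qed.
Let dlE a b : dlsubmx M a b = M (rshift m a) (lshift n b).
Proof. by rewrite mxE mxE. Qed.
Let drE a b : drsubmx M a b = M (rshift m a) (rshift m b).
Proof. by rewrite mxE mxE. Qed.

Let eps_dr (a b : 'I_n) : eps (drsubmx M a b) = (a == b)%:R.
Proof. by rewrite drE eps_unit_xmx eq_rshift. Qed.

Let UE a b : U a b = M (lshift n a) (lshift n b) -
  \sum_l (ursubmx M *m mxinv (drsubmx M)) a l * M (rshift m l) (lshift n b).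
Proof.
rewrite [LHS]mxE [(- _ : 'M__) a b]mxE ulE; congr (_ - _); rewrite mxE.
by apply: eq_bigr => l _; rewrite dlE.
Qed.

Let eps_U (a b : 'I_m) : eps (U a b) = (a == b)%:R.
Proof.
rewrite UE epsD epsN eps_unit_xmx eq_lshift eps_sum big1 ?subr0 // => l _.
by rewrite epsM eps_unit_xmx eq_rlshift mulr0.
Qed.

(** The correction in the Schur complement is a product with both off-diagonal blocks, hence of
    order two. *)
Let lin_U (a : 'I_m) k : lin (U a a) k = lin (M (lshift n a) (lshift n a)) k.
Proof.
rewrite UE linD linN lin_sum big1 ?subr0 // => l _.
rewrite linM eps_unit_xmx eq_rlshift mulr0 addr0 mxE eps_sum big1 ?mul0r // => p _.
by rewrite epsM urE eps_unit_xmx eq_lrshift mul0r.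
Qed.

Lemma eps_sdet : eps (sdet M) = 1.
Proof. by rewrite /sdet epsM -/U (eps_det eps_U) mul1r eps_rinv // eps_det. Qed.

(** The inverse of the lower determinant contributes minus a trace: the differential of the
    superdeterminant at the unit is the supertrace. *)
Lemma delta_sdet h : delta h (sdet M) = str (if s then h.2 else h.1).
Proof.
have e k : lin (sdet M) k = \sum_i (-1) ^+ ipar i * lin (M i i) k.
  rewrite /sdet linM -/U (eps_det eps_U) mul1r lin_rinv ?eps_rinv ?(eps_det eps_dr) //.
  rewrite mulr1 (lin_det eps_U) (lin_det eps_dr) big_split_ord /= [LHS]addrC -sumrN.
  congr (_ + _); apply: eq_bigr => i _.
    by rewrite lin_U /ipar /= leqNgt ltn_ord mul1r.
  by rewrite drE /ipar /= leq_addr mulN1r.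
rewrite deltaE strE; under eq_bigr do rewrite e mulr_sumr.
rewrite exchange_big; apply: eq_bigr => i _.
transitivity ((-1) ^+ ipar i * delta h (xgen C s i i)).
  rewrite deltaE mulr_sumr; apply: eq_bigr => k _.
  by rewrite lin_unit_xmx lin_xgen mulrCA.
by rewrite delta_xgen; case: s.
Qed.

End Sdet.

End Supergroup.

(** Ensures that a left tensor factor followed by a right one is already an ordered monomial, so
    that only the opposite order costs a Koszul sign. *)
Lemma enum_rank_inl_inr (A B : finType) (a : A) (b : B) :
  (enum_rank (inl a : A + B)%type < enum_rank (inr b : A + B)%type)%N.
Proof.
have e (x : (A + B)%type) : enum_rank x = index x (sum_enum A B) :> nat.
  rewrite /enum_rank enum_rank_in.unlock insubdK; first by rewrite enumT unlock.
  by rewrite /in_mem /= cardE index_mem mem_enum.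
have inl_mem c : (inl c : A + B)%type \in [seq inl y | y <- Finite.enum A].
  by rewrite map_f // -enumT mem_enum.
rewrite !e /sum_enum !index_cat inl_mem.
case: ifP => [/mapP[]//|_]; apply: leq_trans (leq_addr _ _).
by rewrite index_mem inl_mem.
Qed.

Local Opaque gen subst lin eps coef.

(** * Coproduct and Poisson bracket *)

Section Coproduct.
Variables (C : numClosedFieldType) (m n : nat).
Local Notation hser := (sps C (@gpar m n)).
Local Notation hser2 := (sps C (@gpar2 m n)).
Local Notation dt := (dtype C m n).
Local Notation idx := (gidx m n).
Implicit Types (f g : hser) (F u v : hser2) (h x : dt) (i j : 'I_(m + n)) (s : bool) (k
  l p q : idx).

Lemma ejoin_eunit p q : ejoin (eunit p) (eunit q) = eunit (inl p) + eunit (inr q).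
Proof. by apply/ffunP => -[k|k]; rewrite !ffunE ?addr0 ?add0r. Qed.
Lemma ejoinl p : ejoin (eunit p) 0 = eunit (inl p).
Proof. by apply/ffunP => -[k|k]; rewrite !ffunE. Qed.
Lemma ejoinr p : ejoin 0 (eunit p) = eunit (inr p).
Proof. by apply/ffunP => -[k|k]; rewrite !ffunE. Qed.

Definition coprod_gen k : hser2 :=
  gen (inr k) + gen (inl k)
    + \sum_l gen (inl (k.1, (k.2.1, l))) * gen (inr (k.1, (l, k.2.2))).

Lemma coprodE f : coprod f = subst coprod_gen f.
Proof. by congr (subst _ f); apply: funext => -[s [i j]]. Qed.

Lemma eps_coprod_gen k : eps (coprod_gen k) = 0.
Proof.
by rewrite !epsD !eps_gen !add0r eps_sum big1 // => l _; rewrite epsM eps_gen mul0r.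
Qed.

Lemma lin_coprod_gen k t :
  lin (coprod_gen k) t = (t == inr k)%:R + (t == inl k)%:R.
Proof.
rewrite !linD lin_sum [X in _ + X]big1 ?addr0.
  by rewrite (lin_gen C (@gpar2 m n) (inr k)) (lin_gen C (@gpar2 m n) (inl k)).
by move=> l _; rewrite linM !eps_gen mul0r mulr0 addr0.
Qed.

Lemma parity_of_coprod_gen k : parity_of (gpar k) (coprod_gen k).
Proof.
apply: parity_ofD; first apply: parity_ofD.
- exact: (@parity_of_gen C (idx + idx)%type (@gpar2 m n) (inr k)).
- exact: (@parity_of_gen C (idx + idx)%type (@gpar2 m n) (inl k)).
apply: parity_of_sum => l _.
have -> : gpar k = gpar2 (inl (k.1, (k.2.1, l))) (+) gpar2 (inr (k.1, (l, k.2.2))).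
  by rewrite /gpar2 /gpar /=; case: (ipar l) (ipar k.2.1) (ipar k.2.2) => [] [] [].
by apply: parity_ofM; exact: parity_of_gen.
Qed.

Definition sgn2 p q : C := (-1) ^+ (gpar p && gpar q).

Lemma sgn2C p q : sgn2 p q = sgn2 q p.
Proof. by rewrite /sgn2 andbC. Qed.
Lemma sgn2_sqr p q : sgn2 p q * sgn2 p q = 1.
Proof. by rewrite -expr2 sqrr_sign. Qed.

Lemma coef2M u v p q : eps u = 0 -> eps v = 0 ->
  coef (u * v) (ejoin (eunit p) (eunit q)) =
    lin u (inl p) * lin v (inr q) + sgn2 p q * (lin u (inr q) * lin v (inl p)).
Proof.
move=> u0 v0; rewrite ejoin_eunit coef_mul_eunit2 // !esign_eunit enum_rank_inl_inr.
by rewrite ltnNge ltnW ?enum_rank_inl_inr // /= !andbF andbT mul1r andbC.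
Qed.

Definition cop2 f p q : C := coef (coprod f) (ejoin (eunit p) (eunit q)).

(** The structure constants of matrix multiplication. *)
Definition copgen2 k p q : C :=
  \sum_l (p == (k.1, (k.2.1, l)))%:R * (q == (k.1, (l, k.2.2)))%:R.

Lemma copgen2E k p q : coef (coprod_gen k) (ejoin (eunit p) (eunit q)) = copgen2 k p q.
Proof.
rewrite !coefD coef_bigsum ejoin_eunit.
have d2 : edeg (eunit (inl p) + eunit (inr q) : expo (idx + idx)%type) = 2%N.
  by rewrite edegD !edeg_eunit.
rewrite coef_gen_deg ?d2 // coef_gen_deg ?d2 // !add0r; apply: eq_bigr => l _.
rewrite -ejoin_eunit coef2M; [|exact: eps_gen|exact: eps_gen].
rewrite !lin_gen.
by rewrite mul0r mulr0 addr0 !(inj_eq inl_inj) !(inj_eq inr_inj).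
Qed.

(* The quadratic part of f contributes supersymmetrically to the bilinear part of
   the coproduct, so only the linear part of f survives. *)
Lemma cop2_anti f p q : cop2 f p q - sgn2 p q * cop2 f q p =
  \sum_k lin f k * (copgen2 k p q - sgn2 p q * copgen2 k q p).
Proof.
pose bs := [:: (1 : C, ejoin (eunit p) (eunit q));
  (- sgn2 p q, ejoin (eunit q) (eunit p))].
have DE F : coef_comb bs F =
    coef F (ejoin (eunit p) (eunit q)) - sgn2 p q * coef F (ejoin (eunit q) (eunit p)).
  by rewrite /coef_comb big_cons big_seq1 /= mul1r mulNr.
rewrite /cop2 -DE coprodE.
(* The class consists of series without constant term whose linear part is the same on both tensor
   legs. It contains the coproducts of the generators, and the super-antisymmetrised coefficient
   vanishes on products of two of its members. *)
rewrite (@subst_first_order _ _ _ _ _ _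
  (fun u => eps u = 0 /\ forall k, lin u (inl k) = lin u (inr k)) 2) //.
- by apply: eq_bigr => k _; rewrite DE !copgen2E.
- by move=> zb; rewrite !inE => /orP[]/eqP->; rewrite ejoin_eunit edegD !edeg_eunit
  reduced_eunit2.
- move=> k; rewrite eps_coprod_gen; split=> // l; rewrite !lin_coprod_gen add0r addr0.
  by rewrite (inj_eq inl_inj) (inj_eq inr_inj).
- move=> u v [u0 us] [v0 vs]; rewrite epsM u0 mul0r; split=> // k.
  by rewrite !linM u0 v0 !mulr0 !mul0r.
- have c1 a b : coef (1 : hser2) (ejoin (eunit a) (eunit b)) = 0.
    by rewrite ejoin_eunit; apply: coef_one; rewrite edegD !edeg_eunit.
  by rewrite DE (c1 p q) (c1 q p) mulr0 subrr.
- move=> u v [u0 us] [v0 vs]; rewrite DE !coef2M // !us !vs (sgn2C q p).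
  move: (lin u (inr p)) (lin v (inr q)) (lin u (inr q)) (lin v (inr p)) => a b c d.
  move: (sgn2 p q) (sgn2_sqr p q) => t tt.
  by transitivity ((1 - t * t) * (a * b)); [ring|rewrite tt subrr mul0r].
Qed.

(** The supercommutator evaluated on [f]. The signs are attached to the indices, so arbitrary [h]
    and [x] are covered without splitting them into homogeneous parts. *)
Definition dbrv f h x : C :=
  \sum_p \sum_q hval h p * hval x q * (cop2 f p q - sgn2 p q * cop2 f q p).

(** By [cop2_anti] only the linear part of [f] matters: this is the fact that the bracket of two
    epsilon-derivations is again one. *)
Lemma dbrv_lin f h x : dbrv f h x = \sum_k lin f k * dbrv (gen k) h x.
Proof.
have e g : dbrv g h x = \sum_k lin g k *
    \sum_p \sum_q hval h p * hval x q * (copgen2 k p q - sgn2 p q * copgen2 k q p).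
  rewrite /dbrv; under [RHS]eq_bigr do rewrite mulr_sumr.
  rewrite [RHS]exchange_big; apply: eq_bigr => p _.
  under [RHS]eq_bigr do rewrite mulr_sumr.
  rewrite [RHS]exchange_big; apply: eq_bigr => q _.
  by rewrite cop2_anti mulr_sumr; apply: eq_bigr => k _; rewrite mulrCA.
rewrite e; apply: eq_bigr => k _; rewrite e [X in _ = _ * X](bigD1 k) //=.
rewrite [X in _ = _ * (_ + X)]big1 => [|l /negbTE lk].
  by rewrite lin_gen eqxx mul1r addr0.
by rewrite lin_gen lk mul0r.
Qed.

Lemma hval_hcomp b h k : hval (hcomp b h) k = if gpar k == b then hval h k else 0.
Proof. by case: k => -[] [i j]; rewrite /hval /= mxE. Qed.

Lemma hval_dbr h x k : hval (dbr h x) k = dbrv (gen k) h x.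
Proof.
case: k => s [i j]; rewrite hval_ofder; rewrite -/(gen _) /dbrv /xgen.
set f := gen _.
pose G (b c : bool) p q := (if gpar p == b then hval h p else 0) * (if gpar q == c then
  hval x q else 0)
     * (cop2 f p q - sgn2 p q * cop2 f q p).
(* For each pair of indices, exactly one pair of parities in the definition of [dbr] contributes. *)
transitivity (\sum_(b : bool) \sum_(c : bool) \sum_p \sum_q G b c p q).
  apply: eq_bigr => b _; apply: eq_bigr => c _.
  rewrite /delta2 [X in _ - _ * X]exchange_big mulr_sumr -sumrB; apply: eq_bigr => p _.
  rewrite mulr_sumr -sumrB; apply: eq_bigr => q _;
    rewrite !hval_hcomp /G -/(cop2 _ _ _) -/(cop2 _ _ _) /sgn2.
  case: eqP => [->|_]; last by rewrite !(mul0r, mulr0) subrr.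
  case: eqP => [->|_]; last by rewrite !(mul0r, mulr0) subrr.
  by move: (cop2 f p q) (cop2 f q p) ((-1) ^+ _) (hval h p) (hval x q) => *; ring.
rewrite !big_bool /= -!big_split; apply: eq_bigr => p _; rewrite -!big_split;
  apply: eq_bigr => q _.
by rewrite /G; case: (gpar p); case: (gpar q); rewrite /= !(mul0r, mulr0, addr0, add0r).
Qed.

Lemma delta_dbr h x f : delta (dbr h x) f = dbrv f h x.
Proof.
by rewrite dbrv_lin deltaE; apply: eq_bigr => k _; rewrite hval_dbr mulrC.
Qed.

Lemma lin_hpart b f k : lin (hpart b f) k = if gpar k == b then lin f k else 0.
Proof. by rewrite -!coef_eunit coef_mksps ?reduced_eunit // epar_eunit. Qed.

Lemma lin_coprod f t : lin (coprod f) t = match t with inl k => lin f k | inr k => lin f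
  k end.
Proof.
rewrite coprodE lin_subst; last exact: eps_coprod_gen.
under eq_bigr do rewrite lin_coprod_gen.
case: t => k; rewrite (bigD1 k) //= big1 => [|l /negbTE lk].
- by rewrite add0r eqxx mulr1 addr0.
- by rewrite add0r (inj_eq inl_inj) eq_sym lk mulr0.
- by rewrite eqxx !addr0 mulr1.
by rewrite (inj_eq inr_inj) eq_sym lk addr0 mulr0.
Qed.

Lemma cop2_hpart b f p q : cop2 (hpart b f) p q = if gpar p (+) gpar q == b then cop2 f
  p q else 0.
Proof.
rewrite /cop2 !coprodE (coef_subst_hpart parity_of_coprod_gen) ejoin_eunit eparD.
by rewrite !epar_eunit.
Qed.

Lemma eps_nablaR h f : eps (nablaR h f) = delta h f.
Proof.
rewrite epsE coef_mksps ?reduced0 //; apply: eq_bigr => k _.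
by rewrite ejoinl coef_eunit lin_coprod.
Qed.

(** A derivation of parity b only sees the part of [f] of parity b, where the sign of the left
    translation is (-1)^(b(b+1)) = 1. *)
Lemma eps_nablaL b h f : hhom b h -> eps (nablaL b h f) = delta h f.
Proof.
move=> hb; rewrite eps_sum.
transitivity (\sum_(c : bool) \sum_k hval h k * lin (hpart c f) k).
  apply: eq_bigr => c _; rewrite epsZ epsE coef_mksps ?reduced0 // mulr_sumr.
  apply: eq_bigr => k _; rewrite ejoinr coef_eunit lin_coprod lin_hpart.
  have [kb|/hb->] := eqVneq (gpar k) b; last by rewrite !mul0r mulr0.
  case: eqP => [<-|_]; last by rewrite !mulr0.
  by rewrite kb andbN mul1r.
rewrite exchange_big; apply: eq_bigr => k _; rewrite big_bool !lin_hpart.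
by rewrite coef_eunit; case: (gpar k); rewrite /= mulr0 ?add0r ?addr0.
Qed.

(** At the unit the left and right translations by [h] have the same value; their first-order parts
    differ by the adjoint action of [h]. *)
Lemma delta_nablaLR b h x f : hhom b h ->
  delta x (nablaL b h f) - delta x (nablaR h f) = - delta (dbr h x) f.
Proof.
move=> hb; rewrite delta_dbr /dbrv -[RHS]sumrN.
transitivity (\sum_l \sum_k hval h k * hval x l * (sgn2 k l * cop2 f l k - cop2 f k l));
  last first.
  rewrite exchange_big; apply: eq_bigr => k _; rewrite -[RHS]sumrN; apply: eq_bigr => l _.
  by rewrite -mulrN opprB.
rewrite !deltaE -sumrB; apply: eq_bigr => l _; rewrite -mulrBr.
transitivity (hval x l * \sum_k hval h k * (sgn2 k l * cop2 f l k - cop2 f k l));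
  last first.
  by rewrite mulr_sumr; apply: eq_bigr => k _; rewrite mulrCA mulrA.
congr (_ * _).
have -> : lin (nablaR h f) l = \sum_k hval h k * cop2 f k l.
  by rewrite -coef_eunit coef_mksps ?reduced_eunit.
have -> : lin (nablaL b h f) l = \sum_k hval h k * (sgn2 k l * cop2 f l k).
  rewrite /nablaL lin_sum.
  transitivity (\sum_(c : bool) \sum_k hval h k * ((-1) ^+ (b && ~~ c) * cop2 (hpart c
    f) l k)).
    apply: eq_bigr => c _; rewrite linZ -coef_eunit coef_mksps ?reduced_eunit //
      mulr_sumr.
    by apply: eq_bigr => k _; rewrite mulrCA.
  (* Only the component of parity c = |k| + |l| contributes, and with |k| = b the exponent b(c + 1)
     reduces to |k||l| modulo two. *)
  rewrite exchange_big; apply: eq_bigr => k _; rewrite big_bool !cop2_hpart /sgn2 /=.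
  have [<-|/hb->] := eqVneq (gpar k) b; last by rewrite !(mul0r, addr0).
  by case: (gpar k); case: (gpar l) => /=; rewrite !(mulr0, addr0, add0r, mul1r).
by rewrite -sumrB; apply: eq_bigr => k _; rewrite mulrBr.
Qed.

Lemma delta_mul x f g : delta x (f * g) = eps f * delta x g + delta x f * eps g.
Proof.
rewrite !deltaE mulr_sumr mulr_suml -big_split; apply: eq_bigr => k _.
by rewrite linM /=; ring.
Qed.
Lemma delta_sum x (I : Type) (r : seq I) (P : pred I) (F : I -> hser) :
  delta x (\sum_(i <- r | P i) F i) = \sum_(i <- r | P i) delta x (F i).
Proof.
rewrite deltaE; under [RHS]eq_bigr do rewrite deltaE.
by rewrite exchange_big; apply: eq_bigr => k _; rewrite lin_sum mulr_sumr.
Qed.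
Lemma deltaZ x (z : C) f : delta x (z *: f) = z * delta x f.
Proof. by rewrite !deltaE mulr_sumr; apply: eq_bigr => k _; rewrite linZ mulrCA. Qed.
Lemma deltaD x f g : delta x (f + g) = delta x f + delta x g.
Proof. by rewrite !deltaE -big_split; apply: eq_bigr => k _; rewrite linD mulrDr. Qed.
Lemma deltaN x f : delta x (- f) = - delta x f.
Proof. by rewrite -scaleN1r deltaZ mulN1r. Qed.

Section Bracket.
Variables (T : finType) (h hd : T -> dt) (ph : T -> bool).
Hypothesis hhomh : forall a, hhom (ph a) (h a).
Local Notation r a b := (dform (Rd (hd a)) (hd b)).

Lemma eps_pbr f g : eps (pbr h hd ph f g) = 0.
Proof.
rewrite epsZ eps_sum big1 ?mulr0 // => b _; rewrite eps_sum big1 // => a _.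
rewrite eps_sum big1 // => c _; rewrite epsZ epsD epsN !epsM !eps_nablaL // !eps_nablaR.
by rewrite subrr mulr0.
Qed.

(** Left and right translations agree at the unit, so the Leibniz rule leaves differences of their
    first-order parts, which are adjoint actions. *)
Lemma delta_pbr x f g : delta x (pbr h hd ph f g) =
  - 2^-1 * \sum_(b : bool) \sum_a \sum_c (-1) ^+ (b && ph a) * r a c *
    (delta (h a) (hpart b f) * delta (dbr (h c) x) g
     + delta (dbr (h a) x) (hpart b f) * delta (h c) g).
Proof.
rewrite deltaZ mulNr -mulrN; congr (_ * _); rewrite delta_sum -sumrN.
apply: eq_bigr => b _; rewrite delta_sum -sumrN; apply: eq_bigr => a _.
rewrite delta_sum -sumrN; apply: eq_bigr => c _; rewrite deltaZ -[RHS]mulrN;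
  congr (_ * _).
rewrite deltaD deltaN !delta_mul !eps_nablaL // !eps_nablaR.
have := delta_nablaLR x g (@hhomh c); have := delta_nablaLR x (hpart b f) (@hhomh a).
move/eqP; rewrite subr_eq => /eqP-> /eqP; rewrite subr_eq => /eqP->.
ring.
Qed.

End Bracket.

(** On a generator the coproduct has bidegree (1,1) part given by matrix multiplication, whence the
    entries of the matrix supercommutator. *)
Lemma hval_dbrE h x s i j : hval (dbr h x) (s, (i, j)) =
  \sum_l (hval h (s, (i, l)) * hval x (s, (l, j))
    - sgn2 (s, (i, l)) (s, (l, j)) * (hval x (s, (i, l)) * hval h (s, (l, j)))).
Proof.
rewrite hval_dbr /dbrv.
have e p q : cop2 (gen (s, (i, j))) p q - sgn2 p q * cop2 (gen (s, (i, j))) q p =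
    copgen2 (s, (i, j)) p q - sgn2 p q * copgen2 (s, (i, j)) q p.
  rewrite cop2_anti (bigD1 (s, (i, j))) //= big1 => [|l /negbTE lk].
    by rewrite lin_gen eqxx mul1r addr0.
  by rewrite lin_gen lk mul0r.
have sel (F : idx -> idx -> C) : \sum_p \sum_q F p q * copgen2 (s, (i, j)) p q =
    \sum_l F (s, (i, l)) (s, (l, j)).
  rewrite /copgen2 /=.
  under eq_bigr do under eq_bigr do rewrite mulr_sumr.
  under eq_bigr do rewrite exchange_big.
  rewrite exchange_big; apply: eq_bigr => l _ /=.
  rewrite (bigD1 (s, (i, l))) //= [X in _ + X]big1 ?addr0 => [|p /negbTE pl]; last first.
    by rewrite big1 // => q _; rewrite pl mul0r mulr0.
  rewrite (bigD1 (s, (l, j))) //= big1 ?addr0 => [|q /negbTE ql];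
    last by rewrite ql !mulr0.
  by rewrite !eqxx !mulr1.
under eq_bigr do under eq_bigr do rewrite e mulrBr mulrA.
under eq_bigr do rewrite sumrB.
rewrite sumrB sel [X in _ - X]exchange_big sel -sumrB; apply: eq_bigr => l _.
by rewrite (sgn2C (s, (l, j))); ring.
Qed.

End Coproduct.

(** * The Lie superalgebra d and its form *)

Section Double.
Variables (C : numClosedFieldType) (m n : nat).
Local Notation dt := (dtype C m n).
Local Notation idx := (gidx m n).
Local Notation dspace := (@dspace C m n).
Local Notation gspace := (@gspace C m n).
Local Notation bspace := (@bspace C m n).
Local Notation M := 'M[C]_(m + n).
Implicit Types (h x y w : dt) (i j l : 'I_(m + n)) (s b c p q r : bool) (k : idx) (A B X
  Y W : M).

Lemma hvalD h x k : hval (h + x) k = hval h k + hval x k.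
Proof. by case: k => -[] [i j]; rewrite /hval /= mxE. Qed.
Lemma hvalZ (z : C) h k : hval (z *: h) k = z * hval h k.
Proof. by case: k => -[] [i j]; rewrite /hval /= mxE. Qed.
Lemma hvalN h k : hval (- h) k = - hval h k.
Proof. by rewrite -scaleN1r hvalZ mulN1r. Qed.
Lemma hval0 k : hval (0 : dt) k = 0.
Proof. by rewrite -(scale0r (0 : dt)) hvalZ mul0r. Qed.

Lemma hcomp_linear b : linear (hcomp b : dt -> dt).
Proof.
move=> z h x; apply: hvalP => k; rewrite hvalD hvalZ !hval_hcomp hvalD hvalZ.
by case: ifP; rewrite ?mulr0 ?addr0.
Qed.
HB.instance Definition _ b := GRing.isLinear.Build C dt dt _ (hcomp b) (hcomp_linear b).

Lemma hhomP b h : hhom b h <-> hcomp b h = h.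
Proof.
split=> [hb|<- k kb]; last by rewrite hval_hcomp (negbTE kb).
by apply: hvalP => k; rewrite hval_hcomp; case: eqVneq => // /hb.
Qed.

Lemma hhom_hcomp b h : hhom b (hcomp b h).
Proof. by move=> k kb; rewrite hval_hcomp (negbTE kb). Qed.

Lemma hcomp_hhom b c h : hhom b h -> hcomp c h = if b == c then h else 0.
Proof.
move=> hb; apply: hvalP => k; rewrite hval_hcomp.
have [kb|kb] := eqVneq (gpar k) b.
  by rewrite kb; case: ifP; rewrite ?hval0.
by rewrite (hb k kb) if_same; case: ifP => _; rewrite ?hval0 ?(hb k kb).
Qed.

Lemma hcompE h : h = hcomp false h + hcomp true h.
Proof.
apply: hvalP => k; rewrite hvalD !hval_hcomp.
by case: (gpar k); rewrite /= ?addr0 ?add0r.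
Qed.

Lemma hhomZ b z h : hhom b h -> hhom b (z *: h).
Proof. by move=> hb k /hb; rewrite hvalZ => ->; rewrite mulr0. Qed.
Lemma hhomD b h x : hhom b h -> hhom b x -> hhom b (h + x).
Proof. by move=> hb xb k kb; rewrite hvalD hb // xb // addr0. Qed.

Definition wgt k : C := (if k.1 then 'i / 2 else - ('i / 2)) * (-1) ^+ ipar k.2.1.
Definition ktr k : idx := (k.1, (k.2.2, k.2.1)).

Lemma ktrK : involutive ktr.
Proof. by case=> s [i j]. Qed.
Lemma gpar_ktr k : gpar (ktr k) = gpar k.
Proof. by rewrite /gpar /= addbC. Qed.

Lemma sum_idx (F : idx -> C) :
  \sum_k F k = \sum_i \sum_j F (false, (i, j)) + \sum_i \sum_j F (true, (i, j)).
Proof.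
rewrite addrC !pair_bigA /=.
transitivity (\sum_(s : bool) \sum_(ij : 'I_(m + n) * 'I_(m + n)) F (s, ij)).
  by rewrite pair_bigA; apply: eq_bigr => -[].
by rewrite big_bool; congr (_ + _); apply: eq_bigr => -[].
Qed.

Lemma str_mulE A B : str (A *m B) = \sum_i \sum_j (-1) ^+ ipar i * (A i j * B j i).
Proof.
rewrite strE; apply: eq_bigr => i _; rewrite mxE mulr_sumr.
by apply: eq_bigr => j _.
Qed.

Lemma dformE h x : dform h x = \sum_k wgt k * (hval h k * hval x (ktr k)).
Proof.
rewrite sum_idx /dform !str_mulE; congr (_ + _); rewrite mulr_sumr;
  apply: eq_bigr => i _; rewrite mulr_sumr; apply: eq_bigr => j _; exact: mulrA.
Qed.

Lemma dform_linearl z h x y : dform (z *: h + x) y = z * dform h y + dform x y.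
Proof.
rewrite !dformE mulr_sumr -big_split; apply: eq_bigr => k _ /=.
by rewrite hvalD hvalZ; ring.
Qed.
Lemma dform_linearr z h x y : dform y (z *: h + x) = z * dform y h + dform y x.
Proof.
rewrite !dformE mulr_sumr -big_split; apply: eq_bigr => k _ /=.
by rewrite hvalD hvalZ; ring.
Qed.
Lemma dform0l x : dform 0 x = 0.
Proof. by rewrite dformE big1 // => k _; rewrite hval0 mul0r mulr0. Qed.
Lemma dform0r x : dform x 0 = 0.
Proof. by rewrite dformE big1 // => k _; rewrite hval0 !mulr0. Qed.
Lemma dformZl z h y : dform (z *: h) y = z * dform h y.
Proof. by rewrite -[z *: h]addr0 dform_linearl dform0l addr0. Qed.
Lemma dformZr z h y : dform y (z *: h) = z * dform y h.
Proof. by rewrite -[z *: h]addr0 dform_linearr dform0r addr0. Qed.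
Lemma dformDl h x y : dform (h + x) y = dform h y + dform x y.
Proof. by rewrite -[h]scale1r dform_linearl scale1r mul1r. Qed.
Lemma dformDr h x y : dform y (h + x) = dform y h + dform y x.
Proof. by rewrite -[h]scale1r dform_linearr scale1r mul1r. Qed.
Lemma dformNl h y : dform (- h) y = - dform h y.
Proof. by rewrite -scaleN1r dformZl mulN1r. Qed.
Lemma dformNr h y : dform y (- h) = - dform y h.
Proof. by rewrite -scaleN1r dformZr mulN1r. Qed.
Lemma dform_suml (I : Type) (t : seq I) (P : pred I) (F : I -> dt) y :
  dform (\sum_(i <- t | P i) F i) y = \sum_(i <- t | P i) dform (F i) y.
Proof. by apply: (big_morph (fun h => dform h y)) => [h x|];
  [exact: dformDl|exact: dform0l]. Qed.
Lemma dform_sumr (I : Type) (t : seq I) (P : pred I) (F : I -> dt) y :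
  dform y (\sum_(i <- t | P i) F i) = \sum_(i <- t | P i) dform y (F i).
Proof. by apply: (big_morph (fun h => dform y h)) => [h x|];
  [exact: dformDr|exact: dform0r]. Qed.

Lemma dform_hcomp b h x : dform (hcomp b h) x = dform h (hcomp b x).
Proof.
rewrite !dformE; apply: eq_bigr => k _; rewrite !hval_hcomp gpar_ktr.
by case: ifP; rewrite ?mul0r ?mulr0.
Qed.

Lemma dform_neq b c h x : hhom b h -> hhom c x -> b != c -> dform h x = 0.
Proof.
move=> hb xc /negbTE bc; move/hhomP: (hb) => <-.
by rewrite dform_hcomp (hcomp_hhom _ xc) eq_sym bc dform0r.
Qed.

Lemma dformC b h x : hhom b h -> dform h x = (-1) ^+ b * dform x h.
Proof.
move=> hb; rewrite !dformE mulr_sumr [RHS](reindex_inj (inv_inj ktrK)).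
apply: eq_bigr => k _; rewrite ktrK.
have [<-|/hb->] := eqVneq (gpar k) b; last by rewrite !(mul0r, mulr0).
rewrite /wgt /= /gpar; move: (if _ then _ else _) => z.
by case: (ipar k.2.1); case: (ipar k.2.2); rewrite /= ?expr0 ?expr1; ring.
Qed.

Lemma dbr_linearl z h x y : dbr (z *: h + x) y = z *: dbr h y + dbr x y.
Proof.
apply: hvalP => -[s [i j]]; rewrite hvalD hvalZ !hval_dbrE mulr_sumr -big_split.
by apply: eq_bigr => l _ /=; rewrite !hvalD !hvalZ; ring.
Qed.
Lemma dbr_linearr z h x y : dbr y (z *: h + x) = z *: dbr y h + dbr y x.
Proof.
apply: hvalP => -[s [i j]]; rewrite hvalD hvalZ !hval_dbrE mulr_sumr -big_split.
by apply: eq_bigr => l _ /=; rewrite !hvalD !hvalZ; ring.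
Qed.
Lemma dbr0l y : dbr 0 y = 0.
Proof. by apply: (@addrI _ (dbr 0 y)); rewrite -[X in _ + X]scale1r addrC -dbr_linearl
  scaler0 !addr0. Qed.
Lemma dbr0r y : dbr y 0 = 0.
Proof. by apply: (@addrI _ (dbr y 0)); rewrite -[X in _ + X]scale1r addrC -dbr_linearr
  scaler0 !addr0. Qed.
Lemma dbrDl h x y : dbr (h + x) y = dbr h y + dbr x y.
Proof. by rewrite -[h]scale1r dbr_linearl !scale1r. Qed.
Lemma dbrDr h x y : dbr y (h + x) = dbr y h + dbr y x.
Proof. by rewrite -[h]scale1r dbr_linearr !scale1r. Qed.
Lemma dbrZl z h y : dbr (z *: h) y = z *: dbr h y.
Proof. by rewrite -[z *: h]addr0 dbr_linearl dbr0l addr0. Qed.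
Lemma dbrZr z h y : dbr y (z *: h) = z *: dbr y h.
Proof. by rewrite -[z *: h]addr0 dbr_linearr dbr0r addr0. Qed.
Lemma dbr_suml (I : Type) (t : seq I) (P : pred I) (F : I -> dt) y :
  dbr (\sum_(i <- t | P i) F i) y = \sum_(i <- t | P i) dbr (F i) y.
Proof. by apply: (big_morph (fun h => dbr h y)) => [h x|];
  [exact: dbrDl|exact: dbr0l]. Qed.

Lemma hhom_dbr b c h x : hhom b h -> hhom c x -> hhom (b (+) c) (dbr h x).
Proof.
move=> hb xc [s [i j]] ij; rewrite hval_dbrE big1 // => l _.
have e : gpar (s, (i, l)) (+) gpar (s, (l, j)) = gpar (s, (i, j)).
  by rewrite /gpar /=; case: (ipar l) (ipar i) (ipar j) => [] [] [].
have z y w b' c' : hhom b' y -> hhom c' w -> b' (+) c' = b (+) c ->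
    hval y (s, (i, l)) * hval w (s, (l, j)) = 0.
  move=> yb wc bc; have [yb'|/yb->] := eqVneq (gpar (s, (i, l))) b';
    last by rewrite mul0r.
  have [wc'|/wc->] := eqVneq (gpar (s, (l, j))) c'; last by rewrite mulr0.
  by move: ij; rewrite -e yb' wc' bc eqxx.
by rewrite (z _ _ _ _ hb xc) // (z _ _ _ _ xc hb) 1?addbC // mulr0 subrr.
Qed.

Definition mbr b A B : M := A *m B - (-1) ^+ b *: (B *m A).

Lemma dbr_hom b c h x : hhom b h -> hhom c x ->
  dbr h x = (mbr (b && c) h.1 x.1, mbr (b && c) h.2 x.2).
Proof.
move=> hb xc; apply: hvalP => -[s [i j]]; rewrite hval_dbrE.
transitivity (\sum_l hval h (s, (i, l)) * hval x (s, (l, j))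
    - (-1) ^+ (b && c) * \sum_l hval x (s, (i, l)) * hval h (s, (l, j))).
  rewrite mulr_sumr -sumrB; apply: eq_bigr => l _; congr (_ - _).
  have [xc'|/xc->] := eqVneq (gpar (s, (i, l))) c; last by rewrite !(mul0r, mulr0).
  have [hb'|/hb->] := eqVneq (gpar (s, (l, j))) b; last by rewrite !(mul0r, mulr0).
  by rewrite /sgn2 xc' hb' andbC.
by case: s; rewrite /hval /= !mxE.
Qed.

Definition mhom b A := forall i j, ipar i (+) ipar j != b -> A i j = 0.

Lemma hhom_mhom b h : hhom b h -> mhom b h.1 /\ mhom b h.2.
Proof. by move=> hb; split=> i j ij; [exact: (hb (false, (i, j)))|exact: (hb (true, (i,
  j)))]. Qed.

(** A nonzero entry of [A] at (i, j) forces |i| + |j| = b, which is the discrepancy between the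
    signs of the two supertraces; hence no parity is imposed on [B]. *)
Lemma str_mulC b A B : mhom b A -> str (A *m B) = (-1) ^+ b * str (B *m A).
Proof.
move=> Ab; rewrite !str_mulE mulr_sumr exchange_big /=; apply: eq_bigr => j _.
rewrite mulr_sumr; apply: eq_bigr => i _.
have [<-|/Ab->] := eqVneq (ipar i (+) ipar j) b; last by rewrite !(mul0r, mulr0).
rewrite signr_addb; case: (ipar i); case: (ipar j); rewrite /= ?expr0 ?expr1; ring.
Qed.

Lemma mhomM b c A B : mhom b A -> mhom c B -> mhom (b (+) c) (A *m B).
Proof.
move=> Ab Bc i j ij; rewrite mxE big1 // => l _.
have [ab|/Ab->] := eqVneq (ipar i (+) ipar l) b; last by rewrite mul0r.
have [bc|/Bc->] := eqVneq (ipar l (+) ipar j) c; last by rewrite mulr0.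
by move: ij; rewrite -ab -bc; case: (ipar l) (ipar i) (ipar j) => [] [] [].
Qed.

Lemma str_odd A : mhom true A -> str A = 0.
Proof.
by move=> A1; rewrite strE big1 // => i _; rewrite A1 ?mulr0 // addbb.
Qed.

Lemma strD A B : str (A + B) = str A + str B.
Proof. by rewrite !strE -big_split; apply: eq_bigr => i _; rewrite mxE mulrDr. Qed.
Lemma strZ z A : str (z *: A) = z * str A.
Proof. by rewrite !strE mulr_sumr; apply: eq_bigr => i _; rewrite mxE mulrCA. Qed.
Lemma strN A : str (- A) = - str A.
Proof. by rewrite -scaleN1r strZ mulN1r. Qed.

(** The natural sign would involve pr. It is written with p(p + q), which agrees with it when p + q
    + r is even; when p + q + r is odd all the supertraces vanish. The sign is thus independent of
    the parity of [X], so that [dform_invariant] holds for arbitrary [x]. *)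
Lemma str_invariant p q r Y X W : mhom p Y -> mhom r X -> mhom q W ->
  str (mbr (p && r) Y X *m W) = - (-1) ^+ (p && (p (+) q)) * str (X *m mbr (p && q) Y W).
Proof.
move=> Yp Xr Wq; rewrite /mbr mulmxBl mulmxBr -scalemxAl -scalemxAr !strD !strN !strZ.
rewrite -[Y *m X *m W]mulmxA (str_mulC _ Yp) !mulmxA.
have [pqr|] := boolP (p (+) q (+) r); last first.
  case: p q r {Yp Xr Wq} => [] [] [] //= _; rewrite ?expr0 ?expr1; ring.
have z1 : str (X *m Y *m W) = 0.
  apply: str_odd; have -> : true = (r (+) p) (+) q by rewrite -pqr addbC addbA.
  exact: mhomM (mhomM Xr Yp) Wq.
have z2 : str (X *m W *m Y) = 0.
  apply: str_odd; have -> : true = (r (+) q) (+) p by rewrite -pqr [RHS]addbC [r (+)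
    q]addbC addbA.
  exact: mhomM (mhomM Xr Wq) Yp.
by rewrite z1 z2 !(mulr0, oppr0, addr0).
Qed.

Lemma dform_invariant p q y x w : hhom p y -> hhom q w ->
  dform (dbr y x) w = - (-1) ^+ (p && (p (+) q)) * dform x (dbr y w).
Proof.
move=> yp wq.
have main r z : hhom r z -> dform (dbr y z) w = - (-1) ^+ (p && (p (+) q)) * dform z
  (dbr y w).
  move=> zr; rewrite (dbr_hom yp zr) (dbr_hom yp wq) /dform /=.
  have [yp1 yp2] := hhom_mhom yp; have [wq1 wq2] := hhom_mhom wq;
    have [zr1 zr2] := hhom_mhom zr.
  rewrite (str_invariant yp1 zr1 wq1) (str_invariant yp2 zr2 wq2); ring.
rewrite [in LHS](hcompE x) [in RHS](hcompE x) dbrDr !dformDl mulrDr.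
by rewrite (main _ _ (@hhom_hcomp false x)) (main _ _ (@hhom_hcomp true x)).
Qed.

Lemma mbr_jacobi p q r A B W :
  mbr (p && (q (+) r)) A (mbr (q && r) B W) =
    mbr ((p (+) q) && r) (mbr (p && q) A B) W
    + (-1) ^+ (p && q) *: mbr (q && (p (+) r)) B (mbr (p && r) A W).
Proof.
rewrite /mbr !(mulmxBl, mulmxBr) -!(scalemxAl, scalemxAr) !mulmxA.
apply/matrixP => i j; rewrite !mxE.
by case: p q r => [] [] []; rewrite /= ?expr0 ?expr1; ring.
Qed.

Lemma dbr_jacobi p q r x y w : hhom p x -> hhom q y -> hhom r w ->
  dbr x (dbr y w) = dbr (dbr x y) w + (-1) ^+ (p && q) *: dbr y (dbr x w).
Proof.
move=> xp yq wr.
rewrite (dbr_hom xp (hhom_dbr yq wr)) (dbr_hom (hhom_dbr xp yq) wr) (dbr_hom yq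
  (hhom_dbr xp wr)).
rewrite (dbr_hom yq wr) (dbr_hom xp yq) (dbr_hom xp wr) /=.
by congr pair; rewrite mbr_jacobi.
Qed.

Lemma dbr_anti p q x y : hhom p x -> hhom q y ->
  dbr x y = - ((-1) ^+ (p && q) *: dbr y x).
Proof.
move=> xp yq; rewrite (dbr_hom xp yq) (dbr_hom yq xp) [q && p]andbC.
have e A B : mbr (p && q) A B = - ((-1) ^+ (p && q) *: mbr (p && q) B A).
  by rewrite /mbr scalerBr scalerA -expr2 sqrr_sign scale1r opprB.
by congr pair; rewrite e.
Qed.

Lemma dphi_antilinear z h x : dphi (z *: h + x) = z^* *: dphi h + dphi x.
Proof.
apply: hvalP => k; rewrite hvalD hvalZ !hval_dphi hvalD hvalZ rmorphD rmorphM /=.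
ring.
Qed.

Lemma hhom_dphi b h : hhom b h -> hhom b (dphi h).
Proof.
move=> hb k kb; rewrite hval_dphi hb ?conjC0 ?mulr0 ?oppr0 //.
by move: kb; rewrite /gpar /= addbC.
Qed.

Lemma conj_sign (b : bool) : ((-1) ^+ b : C)^* = (-1) ^+ b.
Proof. by rewrite rmorphXn rmorphN1. Qed.

Lemma dphi_square b h : hhom b h -> dphi (dphi h) = (-1) ^+ b *: h.
Proof.
move=> hb; apply: hvalP => k; rewrite hvalZ !hval_dphi kbarK rmorphN rmorphM /= conjCK.
have [<-|/hb->] := eqVneq (gpar k) b; last by rewrite !(mulr0, oppr0).
rewrite /ssgn conj_sign /gpar /=.
by case: (ipar k.2.1); case: (ipar k.2.2); rewrite /= ?expr0 ?expr1; ring.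
Qed.

Lemma dphi_dbr h x : dphi (dbr h x) = dbr (dphi h) (dphi x).
Proof.
apply: hvalP => -[s [i j]]; rewrite hval_dphi !hval_dbrE rmorph_sum mulr_sumr -sumrN.
apply: eq_bigr => l _; rewrite !hval_dphi /kbar /= rmorphB !rmorphM /= conj_sign /sgn2
  /ssgn /gpar /=.
by case: (ipar i); case: (ipar j); case: (ipar l); rewrite /= ?expr0 ?expr1; ring.
Qed.

(** [dphi] exchanges the two copies of sl(m|n), and complex conjugation exchanges their weights 'i /
    2 and - ('i / 2). *)
Lemma dform_dphi h x : dform (dphi h) (dphi x) = (dform h x)^*.
Proof.
rewrite !dformE rmorph_sum (reindex_inj (inv_inj (@kbarK m n)));
  apply: eq_bigr => -[s [i j]] _.
rewrite !hval_dphi /kbar /ktr /= negbK !rmorphM /= conj_sign /wgt /ssgn /=.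
have i2 : ('i / 2 : C)^* = - ('i / 2) by rewrite rmorphM /= conjCi fmorphV /= conjC_nat
  mulNr.
have -> : (if s then 'i / 2 else - ('i / 2) : C)^* = (if ~~ s then 'i / 2 else - ('i /
  2)).
  by case: s; rewrite /= ?rmorphN /= i2 ?opprK.
by case: (ipar i); case: (ipar j); rewrite /= ?expr0 ?expr1; ring.
Qed.

End Double.

(** * The subalgebras g and b, and the decomposition of d *)

Section Subalgebras.
Variables (C : numClosedFieldType) (m n : nat).
Local Notation dt := (dtype C m n).
Local Notation idx := (gidx m n).
Local Notation dspace := (@dspace C m n).
Local Notation gspace := (@gspace C m n).
Local Notation bspace := (@bspace C m n).
Implicit Types (h x y w : dt) (i j l : 'I_(m + n)) (s b c p q r : bool) (k : idx).

Record is_graded_subalgebra (E : set dt) : Prop := {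
  gsa_subspace : is_subspace E;
  gsa_dspace : forall h, E h -> dspace h;
  gsa_hcomp : forall b h, E h -> E (hcomp b h);
  gsa_dbr : forall h x, E h -> E x -> E (dbr h x);
  gsa_dphi : forall h, E h -> E (dphi h) }.

Definition isotropic (E : set dt) : Prop := forall h x, E h -> E x -> dform h x = 0.

Definition dstr (s : bool) h : C := \sum_i (-1) ^+ ipar i * hval h (s, (i, i)).

Lemma dspaceE h : dspace h <-> forall s, dstr s h = 0.
Proof.
have e : dspace h = (dstr false h = 0 /\ dstr true h = 0) by rewrite /dspace /= !strE.
by rewrite e; split=> [[h0 h1] []|hs].
Qed.

Lemma dstr_linear s z h x : dstr s (z *: h + x) = z * dstr s h + dstr s x.
Proof.
rewrite /dstr mulr_sumr -big_split; apply: eq_bigr => i _ /=.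
by rewrite hvalD hvalZ; ring.
Qed.

Lemma dstr0 s : dstr s 0 = 0.
Proof. by rewrite /dstr big1 // => i _; rewrite hval0 mulr0. Qed.

Lemma dspace_sub : is_subspace dspace.
Proof.
split=> [|z x y]; rewrite !dspaceE; first by move=> s; exact: dstr0.
move=> xs ys s.
by rewrite dstr_linear xs ys mulr0 addr0.
Qed.

Lemma dspace_hcomp b h : dspace h -> dspace (hcomp b h).
Proof.
rewrite !dspaceE => hs s; case: b; last first.
  by rewrite -(hs s); apply: eq_bigr => i _; rewrite hval_hcomp /gpar /= addbb.
by rewrite /dstr big1 // => i _; rewrite hval_hcomp /gpar /= addbb mulr0.
Qed.

(** Supertraces of supercommutators vanish: exchanging the two summation indices matches the two
    terms. *)
Lemma dspace_dbr h x : dspace (dbr h x).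
Proof.
rewrite dspaceE => s; rewrite /dstr.
under eq_bigr do rewrite hval_dbrE mulr_sumr.
under eq_bigr do under eq_bigr do rewrite mulrBr.
under eq_bigr do rewrite sumrB.
rewrite sumrB [X in _ - X]exchange_big -sumrB big1 // => i _.
rewrite -sumrB big1 // => l _; rewrite /sgn2 /gpar /=.
by case: (ipar i); case: (ipar l); rewrite /= ?expr0 ?expr1; ring.
Qed.

Lemma hval_dphi_diag h s i : hval (dphi h) (s, (i, i)) = - (hval h (~~ s, (i, i)))^*.
Proof. by rewrite hval_dphi /ssgn /kbar /= addbb mul1r. Qed.

Lemma dspace_dphi h : dspace h -> dspace (dphi h).
Proof.
rewrite !dspaceE => hs s; have := congr1 (fun z : C => - z^*) (hs (~~ s)).
rewrite rmorph0 oppr0 rmorph_sum -sumrN => e; rewrite -[RHS]e; apply: eq_bigr => i _.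
by rewrite hval_dphi_diag rmorphM /= conj_sign mulrN.
Qed.

Lemma gspaceE h : gspace h <->
  dspace h /\ forall i j, hval h (false, (i, j)) = hval h (true, (i, j)).
Proof.
split=> -[hd e]; split=> //; first by move=> i j; rewrite /hval /= e.
by apply/matrixP => i j; exact: e.
Qed.

Lemma gspace_gsa : is_graded_subalgebra gspace.
Proof.
split.
- split=> [|z x y]; rewrite !gspaceE.
    by split=> [|i j]; [exact: dspace_sub.1|rewrite !hval0].
  move=> [xd xe] [yd ye]; split; first exact: dspace_sub.2.
  by move=> i j; rewrite !hvalD !hvalZ xe ye.
- by move=> h [].
- move=> b h; rewrite !gspaceE => -[hd e]; split; first exact: dspace_hcomp.
  by move=> i j; rewrite !hval_hcomp e.
- move=> h x; rewrite !gspaceE => -[hd he] [xd xe]; split; first exact: dspace_dbr.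
  by move=> i j; rewrite !hval_dbrE; apply: eq_bigr => l _; rewrite !he !xe.
move=> h; rewrite !gspaceE => -[hd he]; split; first exact: dspace_dphi.
by move=> i j; rewrite !hval_dphi /kbar /= he.
Qed.

Lemma bspaceE h : bspace h <-> [/\ dspace h,
  forall s i j, (if s then j < i else i < j)%N -> hval h (s, (i, j)) = 0 &
  forall i, hval h (true, (i, i)) = - hval h (false, (i, i))].
Proof.
split=> [[hd lo up di]|[hd tr di]]; split=> //.
- by case=> i j ij; [exact: up|exact: lo].
- by move=> i; apply/eqP; rewrite -addr_eq0 addrC; exact/eqP/di.
- by move=> i j ij; exact: (tr false).
- by move=> i j ij; exact: (tr true).
- by move=> i; rewrite addrC; have := di i => /eqP; rewrite -addr_eq0 => /eqP.
Qed.

Lemma bspace_gsa : is_graded_subalgebra bspace.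
Proof.
split.
- split=> [|z x y]; rewrite !bspaceE.
    by split=> [|s i j|i]; [exact: dspace_sub.1|rewrite !hval0|rewrite !hval0 oppr0].
  move=> [xd xt xe] [yd yt ye]; split; first exact: dspace_sub.2.
    by move=> s i j ij; rewrite !hvalD !hvalZ xt // yt // mulr0 addr0.
  by move=> i; rewrite !hvalD !hvalZ xe ye; ring.
- by move=> h [].
- move=> b h; rewrite !bspaceE => -[hd ht e]; split; first exact: dspace_hcomp.
    by move=> s i j ij; rewrite !hval_hcomp ht // if_same.
  by move=> i; rewrite !hval_hcomp /gpar /= e; case: ifP; rewrite ?oppr0.
- move=> h x; rewrite !bspaceE => -[hd ht he] [xd xt xe]; split; first exact: dspace_dbr.
    (* For an entry on the forbidden side of the diagonal, any intermediate index puts one of the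
       two factors on that side as well. *)
    have z y w s i j l : bspace y -> bspace w -> (if s then j < i else i < j)%N ->
        hval y (s, (i, l)) * hval w (s, (l, j)) = 0.
      rewrite !bspaceE => -[_ yt _] [_ wt _] ij.
      have [li|li] := boolP (if s then l < i else i < l)%N; first by rewrite yt // mul0r.
      by rewrite wt ?mulr0 //; case: s ij li {yt wt}; lia.
    move=> s i j ij; rewrite !hval_dbrE big1 // => l _.
    by rewrite !(z _ _ _ _ _ _ _ _ ij) ?mulr0 ?subrr //; rewrite bspaceE.
  (* The bracket of two triangular matrices has zero diagonal, so the relation between the two
     diagonals holds trivially for it. *)
  have z s i : hval (dbr h x) (s, (i, i)) = 0.
    rewrite hval_dbrE big1 // => l _.
    have [<-|il] := eqVneq i l.
      by rewrite /sgn2 /gpar /= addbb mul1r [X in _ - X]mulrC subrr.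
    have [lt|le] := boolP (if s then l < i else i < l)%N.
      by rewrite (ht s i l lt) (xt s i l lt) !mul0r mulr0 subrr.
    have lt : (if s then i < l else l < i)%N.
      by case: s le; rewrite -leqNgt leq_eqVlt => /orP[/eqP/val_inj e|//];
        rewrite e eqxx in il.
    by rewrite (ht s l i lt) (xt s l i lt) !mulr0 subrr.
  by move=> i; rewrite !z oppr0.
move=> h; rewrite !bspaceE => -[hd ht he]; split; first exact: dspace_dphi.
  by move=> s i j ij; rewrite hval_dphi /kbar /= ht ?conjC0 ?mulr0 ?oppr0 //; case: s ij.
by move=> i; rewrite !hval_dphi_diag /= he rmorphN /= opprK.
Qed.

Lemma gspace_isotropic : isotropic gspace.
Proof. by move=> h x [_ he] [_ xe]; rewrite /dform he xe mulNr addNr. Qed.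

(** Triangularity leaves only products of diagonal entries. As the diagonals of the two components
    are opposite, these products coincide and cancel because of the opposite weights. *)
Lemma bspace_isotropic : isotropic bspace.
Proof.
move=> h x; rewrite !bspaceE => -[_ ht he] [_ xt xe].
have e (s : bool) : \sum_i \sum_j wgt C (s, (i, j)) * (hval h (s, (i, j)) * hval x (s,
  (j, i))) =
   \sum_(i < m + n) wgt C (s, (i, i)) * (hval h (s, (i, i)) * hval x (s, (i, i))).
  apply: eq_bigr => i _; rewrite (bigD1 i) //= big1 ?addr0 // => j ji.
  have [lt|le] := boolP (if s then j < i else i < j)%N;
    first by rewrite ht // mul0r mulr0.
  rewrite xt ?mulr0 //; case: s le; rewrite -leqNgt leq_eqVlt => /orP[/eqP/val_inj e|//];
    by rewrite e eqxx in ji.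
rewrite dformE sum_idx (e false) (e true) -big_split big1 // => i _ /=.
by rewrite he xe /wgt /=; ring.
Qed.

Lemma gb_cap x : gspace x -> bspace x -> x = 0.
Proof.
rewrite gspaceE bspaceE => -[_ e] [_ t d].
have z i j : hval x (false, (i, j)) = 0.
  case: (ltngtP i j) => [ij|ij|/val_inj <-]; first exact: (t false).
    by rewrite e; exact: (t true).
  have /eqP := e i i; rewrite d -addr_eq0 -mulr2n mulrn_eq0 /= => /eqP.
  exact.
by apply: hvalP => -[[] [i j]]; rewrite hval0 // -e.
Qed.

(** The component along b. Modulo g only D = A - B is known: its strictly lower part goes to the
    first matrix, minus its strictly upper part to the second, and its diagonal is shared equally
    with opposite signs. *)
Definition bpart h : dt :=
  let D i j := hval h (false, (i, j)) - hval h (true, (i, j)) in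
  (\matrix_(i, j) if (j < i)%N then D i j else if i == j then D i j / 2 else 0,
   \matrix_(i, j) - (if (i < j)%N then D i j else if i == j then D i j / 2 else 0)).

Lemma bpart_bspace h : dspace h -> bspace (bpart h).
Proof.
rewrite dspaceE bspaceE => hs.
have d i : hval (bpart h) (false, (i, i)) = 2^-1 * (hval h (false, (i, i)) - hval h
  (true, (i, i))).
  by rewrite /bpart [LHS]/hval /= mxE ltnn eqxx mulrC.
have d' i : hval (bpart h) (true, (i, i)) = - (2^-1 * (hval h (false, (i, i)) - hval h
  (true, (i, i)))).
  by rewrite /bpart [LHS]/hval /= mxE ltnn eqxx mulrC.
have e : dstr false h - dstr true h = 0 by rewrite !hs subrr.
split.
- rewrite dspaceE => s; transitivity ((if s then - 2^-1 else 2^-1) * (dstr false h -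
  dstr true h)).
    rewrite /dstr -sumrB mulr_sumr; apply: eq_bigr => i _.
    by case: s; rewrite ?d ?d'; ring.
  by rewrite e mulr0.
- case=> i j ij; rewrite /hval /= mxE; rewrite ltnNge ltnW //=;
    by case: eqP ij => [->|_]; rewrite ?ltnn ?oppr0.
by move=> i; rewrite d d'.
Qed.

Lemma bpart_gspace h : dspace h -> gspace (h - bpart h).
Proof.
move=> hd; rewrite gspaceE; split.
  have [_ lin_d] := dspace_sub; have bd : dspace (bpart h) by case: (bpart_bspace hd).
  by rewrite addrC -scaleN1r; exact: lin_d.
move=> i j; rewrite !hvalD !hvalN.
rewrite [hval (bpart h) (false, _)]/hval [hval (bpart h) (true, _)]/hval /= !mxE.
have [lt|gt|/val_inj<-] := ltngtP i j; rewrite ?eqxx.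
- have /negbTE-> : i != j by apply/eqP => ij; rewrite ij ltnn in lt.
  by ring.
- have /negbTE-> : i != j by apply/eqP => ij; rewrite ij ltnn in gt.
  by ring.
by field.
Qed.

Section Sublie.
Variable E : set dt.
Hypothesis gE : is_graded_subalgebra E.

Lemma sublie_lspace x : lspace (sublie E) x <-> E x.
Proof.
split=> [[x0 [x1 [[E0 _] [E1 _] ->]]]|Ex].
  have [_ El] := gsa_subspace gE; rewrite -[x0]scale1r; exact: El.
exists (hcomp false x), (hcomp true x); split; last exact: hcompE.
  by split; [exact: gsa_hcomp|exact: hhom_hcomp].
by split; [exact: gsa_hcomp|exact: hhom_hcomp].
Qed.

End Sublie.
End Subalgebras.

(** * Cotangent spaces of H/I and H/J *)

Section Cotangent.
Variables (C : numClosedFieldType) (m n : nat).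
Local Notation hser := (sps C (@gpar m n)).
Local Notation dt := (dtype C m n).
Local Notation idx := (gidx m n).
Local Notation dspace := (@dspace C m n).
Local Notation gspace := (@gspace C m n).
Local Notation bspace := (@bspace C m n).
Local Notation idealI := (@idealI C m n).
Local Notation idealJ := (@idealJ C m n).
Local Notation xm := (@xmx C m n).
Implicit Types (h x y w : dt) (i j l : 'I_(m + n)) (k : idx) (f g : hser) (K : set hser).

Lemma mem_lspan (V : lmodType C) (G : set V) v : G v -> lspan G v.
Proof. by move=> Gv W [_]; apply. Qed.

Lemma vpi_eq0 (V : lmodType C) (G : set V) v : vpi G v = 0 <-> lspan G v.
Proof.
rewrite -[0](linear0 (vpi G)); split; first by move/vquotP; rewrite subr0.
by move=> Gv; apply/vquotP; rewrite subr0.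
Qed.

Lemma OmegaP K z f g : Omega K (z *: f + g) = z *: Omega K f + Omega K g.
Proof. by rewrite /Omega !linearP. Qed.
Lemma Omega0 K : Omega K 0 = 0.
Proof. by rewrite /Omega !linear0. Qed.
Lemma OmegaD K f g : Omega K (f + g) = Omega K f + Omega K g.
Proof. by rewrite -[f]scale1r OmegaP !scale1r. Qed.
Lemma OmegaZ K z f : Omega K (z *: f) = z *: Omega K f.
Proof. by rewrite -[z *: f]addr0 OmegaP Omega0 addr0. Qed.
Lemma OmegaB K f g : Omega K (f - g) = Omega K f - Omega K g.
Proof. have -> : f - g = (-1) *: g + f by rewrite scaleN1r addrC.
by rewrite OmegaP scaleN1r addrC. Qed.
Lemma Omega_sum K (I : Type) (r : seq I) (P : pred I) (F : I -> hser) :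
  Omega K (\sum_(i <- r | P i) F i) = \sum_(i <- r | P i) Omega K (F i).
Proof. by apply: (big_morph (Omega K)) => [f g|]; [exact: OmegaD|exact: Omega0]. Qed.

Lemma Omega_ideal K f : K f -> Omega K f = 0.
Proof.
by move=> Kf; rewrite /Omega (proj2 (vpi_eq0 K f)) ?linear0 //; exact: mem_lspan.
Qed.

Lemma Omega_mul K f g : eps f = 0 -> eps g = 0 -> Omega K (f * g) = 0.
Proof.
move=> f0 g0; apply: (proj2 (vpi_eq0 (@ker_eps_sq C m n K) _)); apply: mem_lspan.
by exists f, g.
Qed.

Definition dt_of (F : idx -> C) : dt :=
  (\matrix_(i, j) F (false, (i, j)), \matrix_(i, j) F (true, (i, j))).

Lemma hval_dt_of F k : hval (dt_of F) k = F k.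
Proof. by case: k => -[] [i j]; rewrite /hval /= mxE. Qed.

(** By [ker_decomp], a series without constant and linear terms lies in the square of the kernel of
    the counit. *)
Lemma Omega_first_order K f g : eps f = eps g -> (forall x, delta x f = delta x g) ->
  Omega K f = Omega K g.
Proof.
move=> e d; apply/eqP; rewrite -subr_eq0 -OmegaB; apply/eqP.
have [|k|u [u0 ->]] := @ker_decomp _ _ _ (f - g).
- by rewrite epsD epsN e subrr.
- have := d (dt_of (fun l : idx => (l == k)%:R)); rewrite !deltaE.
  have de (f' : hser) : \sum_(l : idx) hval (dt_of (fun l : idx => (l == k)%:R)) l * lin
    f' l = lin f' k.
    rewrite (bigD1 k) //= big1 => [|l /negbTE lk]; last by rewrite hval_dt_of lk mul0r.
    by rewrite hval_dt_of eqxx mul1r addr0.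
  by rewrite !de linD linN => ->; rewrite subrr.
by rewrite Omega_sum big1 // => k _; apply: Omega_mul => //; exact: eps_gen.
Qed.

(** A derivation that kills [K] descends through both successive quotients, the second because the
    Leibniz rule makes it vanish on products of elements of the kernel of the counit. *)
Lemma Omega_annihilator K x f : (forall r, K r -> delta x r = 0) ->
  Omega K f = 0 -> delta x f = 0.
Proof.
move=> Kx; have Kx' r : lspan K r -> delta x r = 0.
  move=> Kr; apply: (Kr [set r | delta x r = 0]%classic); split=> //;
    split=> [|z f1 f2 /= f10 f20].
    by rewrite /= deltaE big1 // => k _; rewrite -coef_eunit coef_zero mulr0.
  by rewrite deltaD deltaZ f10 f20 mulr0 addr0.
have dvpi f1 f2 : vpi K f1 = vpi K f2 -> delta x f1 = delta x f2.
  by move/vquotP/Kx'; rewrite deltaD deltaN => /eqP; rewrite subr_eq0 => /eqP.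
(* [W] collects the classes all of whose representatives are killed: a subspace containing the
   generators of the second quotient. *)
move/vpi_eq0 => Wf; pose W := [set u | forall g, vpi K g = u -> delta x g = 0]%classic.
apply: (Wf W) => //; split; first split=> [g|z u v Wu Wv g].
- by rewrite -(linear0 (vpi K)) => /dvpi ->; rewrite deltaE big1 // => k _;
  rewrite -coef_eunit coef_zero mulr0.
- have ru : vpi K (generic_quotient.repr u) = u by exact: generic_quotient.reprK.
  have rv : vpi K (generic_quotient.repr v) = v by exact: generic_quotient.reprK.
  rewrite -ru -rv -linearP => /dvpi ->.
  by rewrite deltaD deltaZ (Wu _ ru) (Wv _ rv) mulr0 addr0.
move=> _ [f1 [f2 [f10 f20 ->]]] g /dvpi ->.
by rewrite delta_mul f10 f20 mul0r mulr0 addr0.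
Qed.

(** The Leibniz rule turns the common kernel of the counit and of [delta x] into an ideal; for that
    the vanishing of the counit has to be carried along. *)
Lemma ideal_gen_annihilator (G : set hser) x :
  (forall r, G r -> eps r = 0 /\ delta x r = 0) ->
  forall r, ideal_gen G r -> delta x r = 0.
Proof.
move=> Gx r Ir; suff [] : [set r | eps r = 0 /\ delta x r = 0]%classic r by [].
apply: Ir; split=> // {r}; split=> /= [|f g [f0 fx] [g0 gx]|f g [g0 gx]].
- by rewrite eps0 deltaE; split=> //; rewrite big1 // => k _;
  rewrite -coef_eunit coef_zero mulr0.
- by rewrite epsD deltaD f0 g0 fx gx addr0.
- by rewrite !epsM !delta_mul g0 gx !mulr0 !mul0r addr0.
Qed.

Lemma delta1 x : delta x 1 = 0.
Proof. by rewrite deltaE big1 // => k _; rewrite lin1 mulr0. Qed.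

Lemma mem_ideal_gen (G : set hser) f : G f -> ideal_gen G f.
Proof. by move=> Gf J [_]; apply. Qed.

Lemma sl_rel_first_order f : sl_rel f -> exists s : bool,
  f = sdet (1%:M + xm s) - 1 /\ eps f = 0 /\
  forall x, delta x f = dstr s x.
Proof.
case=> s _ <-; exists s; split=> //; split.
  by rewrite epsD epsN eps_sdet eps1 subrr.
by move=> x; rewrite deltaD deltaN delta1 subr0 delta_sdet strE; case: s.
Qed.

Lemma delta_y x i j : delta x (y_ C i j) = hval x (false, (i, j)).
Proof. exact: delta_xgen. Qed.
Lemma delta_z x i j : delta x (z_ C i j) = hval x (true, (i, j)).
Proof. exact: delta_xgen. Qed.
Lemma eps_y i j : eps (y_ C i j) = 0.
Proof. exact: eps_gen. Qed.
Lemma eps_z i j : eps (z_ C i j) = 0.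
Proof. exact: eps_gen. Qed.

Lemma delta_antipode_y x i j : delta x (antipode (y_ C i j)) = - hval x (false, (i, j)).
Proof.
rewrite -delta_y !deltaE -sumrN; apply: eq_bigr => k _.
by rewrite lin_antipode lin_xgen mulrN.
Qed.

Lemma idealI_annihilator x f : gspace x -> idealI f -> delta x f = 0.
Proof.
move=> /gspaceE[/dspaceE xd xe]; apply: ideal_gen_annihilator => r [|].
  by case/sl_rel_first_order => s [_ [r0 rx]]; rewrite rx xd.
case=> i [j ->]; rewrite epsD epsN eps_y eps_z subrr.
by rewrite deltaD deltaN delta_y delta_z xe subrr.
Qed.

Lemma idealJ_annihilator x f : bspace x -> idealJ f -> delta x f = 0.
Proof.
move=> /bspaceE[/dspaceE xd xt xe]; apply: ideal_gen_annihilator => r [[|]|].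
- by case/sl_rel_first_order => s [_ [r0 rx]]; rewrite rx xd.
- case=> i [j [ij [->|->]]]; first by rewrite eps_y delta_y xt.
  by rewrite eps_z delta_z xt.
case=> i ->; rewrite epsD epsN eps_antipode eps_z subrr.
by rewrite deltaD deltaN delta_antipode_y delta_z xe opprK addNr.
Qed.

(** A functional on diagonal matrices that kills those of supertrace zero is a multiple of the
    supertrace: testing it on differences of signed diagonal units shows that (-1)^|i| G i is
    constant. *)
Lemma str_dual (G : 'I_(m + n) -> C) :
  (forall d : 'I_(m + n) -> C, \sum_i (-1) ^+ ipar i * d i = 0 -> \sum_i d i * G i = 0) ->
  exists c, forall i, G i = c * (-1) ^+ ipar i.
Proof.
move=> G0; case: (pickP (fun _ : 'I_(m + n) => true)) => [i0 _|z]; last first.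
  by exists 0 => i; have := z i.
exists ((-1) ^+ ipar i0 * G i0) => i.
pose e i1 i : C := (-1) ^+ ipar i1 * (i == i1)%:R.
have se i1 (F : 'I_(m + n) -> C) : \sum_i e i1 i * F i = (-1) ^+ ipar i1 * F i1.
  rewrite (bigD1 i1) //= big1 => [|l /negbTE li]; last by rewrite /e li mulr0 mul0r.
  by rewrite /e eqxx mulr1 addr0.
have := G0 (fun l => e i l - e i0 l).
have -> : \sum_i1 (-1) ^+ ipar i1 * (e i i1 - e i0 i1) = 0.
  under eq_bigr do rewrite mulrC mulrBl.
  by rewrite sumrB !se -!expr2 !sqrr_sign subrr.
under eq_bigr do rewrite mulrBl.
rewrite sumrB !se => /(_ erefl) /eqP; rewrite subr_eq0 => /eqP <-.
by rewrite mulrAC -expr2 sqrr_sign mul1r.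
Qed.

Lemma delta_sum_idx x f : delta x f =
  \sum_i \sum_j (hval x (false, (i, j)) * lin f (false, (i, j))
                 + hval x (true, (i, j)) * lin f (true, (i, j))).
Proof.
rewrite deltaE sum_idx -big_split; apply: eq_bigr => i _.
by rewrite -big_split.
Qed.

Lemma sum_diag (G : 'I_(m + n) -> C) i :
  (forall j, j != i -> G j = 0) -> \sum_j G j = G i.
Proof. by move=> G0; rewrite (bigD1 i) //= big1 ?addr0. Qed.

(** For the converse, testing [f] on enough elements of g shows that its linear part is a
    combination of the linear parts of the relations generating the ideal. *)
Lemma OmegaI_eq0 f : eps f = 0 ->
  (Omega idealI f = 0) <-> (forall x, gspace x -> delta x f = 0).
Proof.
move=> f0; split=> [Of x xg|fx].
  by apply: Omega_annihilator Of => r; exact: idealI_annihilator.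
pose Fy i j := lin f (false, (i, j)); pose Fz i j := lin f (true, (i, j)).
have off i j : i != j -> Fy i j + Fz i j = 0.
  move=> ij; pose x := dt_of (fun k => (k.2 == (i, j))%:R).
  have <- : delta x f = Fy i j + Fz i j.
    rewrite delta_sum_idx (bigD1 i) //= [X in _ + X]big1 ?addr0 => [|l /negbTE li];
      last first.
      by rewrite big1 // => l' _; rewrite !hval_dt_of /= xpair_eqE li !mul0r addr0.
    rewrite (bigD1 j) //= big1 ?addr0 => [|l /negbTE li]; last first.
      by rewrite !hval_dt_of /= xpair_eqE li andbF !mul0r addr0.
    by rewrite !hval_dt_of /= eqxx !mul1r.
  apply: fx; rewrite gspaceE; split; last by move=> i' j'; rewrite !hval_dt_of.
  rewrite dspaceE => s; rewrite /dstr big1 // => l _; rewrite hval_dt_of /= xpair_eqE.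
  by case: eqP => [->|]; rewrite /= ?(negbTE ij) mulr0.
(* The diagonal elements (D, D) of g only see the sum of the two linear coefficients. *)
have [|c cP] := @str_dual (fun i => Fy i i + Fz i i).
  move=> d d0; pose x := dt_of (fun k => if k.2.1 == k.2.2 then d k.2.1 else 0).
  transitivity (delta x f).
    rewrite delta_sum_idx; apply: eq_bigr => i _; rewrite (@sum_diag _ i).
      by rewrite !hval_dt_of /= eqxx mulrDr.
    by move=> j /negbTE ji; rewrite !hval_dt_of /= eq_sym ji !mul0r addr0.
  apply: fx; rewrite gspaceE; split; last by move=> i' j'; rewrite !hval_dt_of.
  rewrite dspaceE => s; rewrite -d0; apply: eq_bigr => i _.
  by rewrite hval_dt_of /= eqxx.
(* An element of the ideal with the same linear part as [f]: the relations y - z give the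
   coefficients of y, and the superdeterminant of z corrects the diagonal ones of z. *)
pose r := c *: (sdet (1%:M + xm true) - 1) + \sum_i \sum_j Fy i j *: (y_ C i j - z_ C i
  j).
have srel : (sl_rel (sdet (1%:M + xm true) - 1 : hser)) by exists true.
have [s [_ [er dr]]] := sl_rel_first_order srel.
rewrite -(_ : Omega idealI r = 0).
  apply: Omega_first_order.
    rewrite f0 /r epsD epsZ er mulr0 add0r eps_sum big1 // => i _.
    by rewrite eps_sum big1 // => j _; rewrite epsZ epsD epsN eps_y eps_z subrr mulr0.
  move=> x; rewrite /r deltaD deltaZ.
  have -> : delta x (sdet (1%:M + xm true) - 1 : hser) = dstr true x.
    by rewrite deltaD deltaN delta1 subr0 delta_sdet strE.
  rewrite delta_sum_idx /dstr mulr_sumr delta_sum -big_split; apply: eq_bigr => i _ /=.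
  rewrite delta_sum.
  rewrite (_ : c * _ = \sum_j if j == i then c * ((-1) ^+ ipar i * hval x (true, (i,
    i))) else 0).
    rewrite -big_split; apply: eq_bigr => j _ /=.
    rewrite deltaZ deltaD deltaN delta_y delta_z -/(Fy i j) -/(Fz i j).
    have [->|ji] := eqVneq j i.
      have -> : Fz i i = c * (-1) ^+ ipar i - Fy i i by rewrite -cP addrC addKr.
      ring.
    have -> : Fz i j = - Fy i j by apply/eqP; rewrite -addr_eq0 addrC off // eq_sym.
    ring.
  by rewrite (@sum_diag _ i) ?eqxx // => j /negbTE->.
rewrite /r OmegaP Omega_ideal ?scaler0 ?add0r; last by apply: mem_ideal_gen; left.
rewrite Omega_sum big1 // => i _; rewrite Omega_sum big1 // => j _.
by rewrite OmegaZ Omega_ideal ?scaler0 //; apply: mem_ideal_gen; right; exists i, j.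
Qed.

(** The same strategy as for the other ideal, with test elements of b. *)
Lemma OmegaJ_eq0 f : eps f = 0 ->
  (Omega idealJ f = 0) <-> (forall x, bspace x -> delta x f = 0).
Proof.
move=> f0; split=> [Of x xg|fx].
  by apply: Omega_annihilator Of => r; exact: idealJ_annihilator.
pose Fy i j := lin f (false, (i, j)); pose Fz i j := lin f (true, (i, j)).
have off k : (if k.1 then k.2.1 < k.2.2 else k.2.2 < k.2.1)%N -> lin f k = 0.
  move=> kt; pose x := dt_of (fun l : idx => (l == k)%:R).
  have kd : (k.2.1 == k.2.2) = false.
    by apply/eqP => e; move: kt; rewrite e; case: ifP; rewrite ltnn.
  have <- : delta x f = lin f k.
    rewrite deltaE (bigD1 k) //= big1 => [|l /negbTE lk];
      last by rewrite hval_dt_of lk mul0r.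
    by rewrite hval_dt_of eqxx mul1r addr0.
  have xd s i : hval x (s, (i, i)) = 0.
    rewrite hval_dt_of; case: eqP => // e; move: kd; rewrite -e /= eqxx.
    by [].
  apply: fx; rewrite bspaceE; split.
  - by rewrite dspaceE => s; rewrite /dstr big1 // => i _; rewrite xd mulr0.
  - move=> s i j ij; rewrite hval_dt_of; case: eqP => // e.
    by move: kt ij; rewrite -e /=; case: (s); lia.
  - by move=> i; rewrite !xd oppr0.
(* The diagonal elements of b are the pairs (D, - D), hence the difference of coefficients. *)
have [|c cP] := @str_dual (fun i => Fy i i - Fz i i).
  move=> d d0; pose x := dt_of (fun k => if k.2.1 == k.2.2 then
    (if k.1 then - d k.2.1 else d k.2.1) else 0).
  transitivity (delta x f).
    rewrite delta_sum_idx; apply: eq_bigr => i _; rewrite (@sum_diag _ i).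
      by rewrite !hval_dt_of /= eqxx /Fy /Fz; ring.
    by move=> j /negbTE ji; rewrite !hval_dt_of /= eq_sym ji !mul0r addr0.
  apply: fx; rewrite bspaceE; split.
  - rewrite dspaceE => s; rewrite -[RHS](mulr0 ((-1) ^+ s)) -d0 mulr_sumr;
    apply: eq_bigr => i _.
    by rewrite hval_dt_of /= eqxx; case: s; rewrite /= ?expr0 ?expr1; ring.
  - move=> s i j ij; rewrite hval_dt_of /=; case: eqP => // e.
    by move: ij; rewrite e; case: s; rewrite ltnn.
  - by move=> i; rewrite !hval_dt_of /= eqxx.
(* The relation [antipode (y_ C i i) - z_ C i i] has linear part - y - z. The factor - Fz thus gives
   the right coefficient of z, and the superdeterminant of y supplies what is missing in that of
   y. *)
pose r := c *: (sdet (1%:M + xm false) - 1)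
  + \sum_(i < m + n) (\sum_(j < m + n) ((if (i < j)%N then Fy i j *: y_ C i j else 0)
      + (if (j < i)%N then Fz i j *: z_ C i j else 0))
      + (- Fz i i) *: (antipode (y_ C i i) - z_ C i i)).
rewrite -(_ : Omega idealJ r = 0).
  apply: Omega_first_order.
    rewrite f0 /r epsD epsZ epsD epsN eps_sdet eps1 subrr mulr0 add0r eps_sum big1 // =>
      i _.
    rewrite epsD epsZ epsD epsN eps_antipode eps_z subrr mulr0 addr0.
    rewrite eps_sum big1 // => j _; rewrite epsD.
    by do 2![case: ifP => _]; rewrite ?epsZ ?eps_y ?eps_z ?eps0 ?mulr0 addr0.
  move=> x; rewrite /r deltaD deltaZ.
  have -> : delta x (sdet (1%:M + xm false) - 1 : hser) = dstr false x.
    by rewrite deltaD deltaN delta1 subr0 delta_sdet strE.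
  have delta0 : delta x 0 = 0 by rewrite -(scale0r (0 : hser)) deltaZ mul0r.
  rewrite delta_sum_idx /dstr mulr_sumr delta_sum -big_split; apply: eq_bigr => i _ /=.
  rewrite deltaD delta_sum deltaZ deltaD deltaN delta_antipode_y delta_z.
  rewrite (bigD1 i) //= [in RHS](bigD1 i) //= ltnn addr0 delta0 add0r.
  have -> : \sum_(j < m + n | j != i) (hval x (false, (i, j)) * lin f (false, (i, j))
                 + hval x (true, (i, j)) * lin f (true, (i, j))) =
    \sum_(j < m + n | j != i) delta x ((if (i < j)%N then Fy i j *: y_ C i j else 0)
      + (if (j < i)%N then Fz i j *: z_ C i j else 0)).
    apply: eq_bigr => j ji; rewrite deltaD.
    have [ij|ij|/val_inj e] := ltngtP i j; last by rewrite e eqxx in ji.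
      by rewrite (off (true, (i, j))) // deltaZ delta_y delta0 mulr0 mulrC.
    by rewrite (off (false, (i, j))) // deltaZ delta_z delta0 mulr0 mulrC !add0r.
  move: (\sum_(j < m + n | j != i) _) => S; rewrite -/(Fy i i) -/(Fz i i).
  have -> : Fy i i = c * (-1) ^+ ipar i + Fz i i by rewrite -cP subrK.
  ring.
rewrite /r OmegaP Omega_ideal ?scaler0 ?add0r; last by apply: mem_ideal_gen; left; left;
  exists false.
rewrite Omega_sum big1 // => i _; rewrite OmegaD OmegaZ [X in _ *: X]Omega_ideal;
  last first.
  by apply: mem_ideal_gen; right; exists i.
rewrite scaler0 addr0 Omega_sum big1 // => j _; rewrite OmegaD.
have yj : (i < j)%N -> Omega idealJ (y_ C i j) = 0.
  by move=> ij; apply: Omega_ideal; apply: mem_ideal_gen; left; right; exists j, i;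
    split=> //; left.
have zj : (j < i)%N -> Omega idealJ (z_ C i j) = 0.
  by move=> ij; apply: Omega_ideal; apply: mem_ideal_gen; left; right; exists i, j;
    split=> //; right.
by case: ifP => [/yj ye|_]; case: ifP => [/zj ze|_];
  rewrite ?OmegaZ ?ye ?ze ?Omega0 ?scaler0 addr0.
Qed.

End Cotangent.

(** * Duality *)

Section Duality.
Variables (C : numClosedFieldType) (m n : nat).
Local Notation hser := (sps C (@gpar m n)).
Local Notation dt := (dtype C m n).
Local Notation idx := (gidx m n).
Local Notation dspace := (@dspace C m n).
Implicit Types (x y w u v : dt) (k : idx) (f g : hser) (p q r : bool).

Variables (T : finType) (h hd : T -> dt) (ph : T -> bool).
Hypotheses (hbasis : is_homog_basis h ph) (hdual : is_dual_basis h hd).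

Let dh a : dspace (h a). Proof. by case: hbasis. Qed.
Let dhd a : dspace (hd a). Proof. by case: hdual. Qed.
Let hhomh a : hhom (ph a) (h a). Proof. by case: hbasis. Qed.

Lemma dspace_lin z x y : dspace x -> dspace y -> dspace (z *: x + y).
Proof. exact: (dspace_sub C m n).2. Qed.
Lemma dspace0 : dspace 0.
Proof. exact: (dspace_sub C m n).1. Qed.
Lemma dspaceD x y : dspace x -> dspace y -> dspace (x + y).
Proof. by move=> dx dy; rewrite -[x]scale1r; exact: dspace_lin. Qed.
Lemma dspaceZ z x : dspace x -> dspace (z *: x).
Proof. by move=> dx; rewrite -[z *: x]addr0; apply: dspace_lin => //; exact: dspace0. Qed.
Lemma dspaceB x y : dspace x -> dspace y -> dspace (x - y).
Proof. by move=> dx dy; rewrite -scaleN1r addrC; exact: dspace_lin. Qed.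
Lemma dspace_sum (I : Type) (t : seq I) (P : pred I) (F : I -> dt) :
  (forall i, P i -> dspace (F i)) -> dspace (\sum_(i <- t | P i) F i).
Proof.
move=> dF; elim/big_ind: _ => //; [exact: dspace0|exact: dspaceD].
Qed.

Lemma basis_expand x : dspace x -> x = \sum_a dform x (hd a) *: h a.
Proof.
move=> dx; have [_ _ /(_ x dx)[c [xc _]]] := hbasis.
rewrite [LHS]xc; apply: eq_bigr => a _; congr (_ *: _).
rewrite [in RHS]xc dform_suml (bigD1 a) //= big1 => [|b /negbTE ba].
  by rewrite dformZl (proj2 hdual) eqxx mulr1 addr0.
by rewrite dformZl (proj2 hdual) ba mulr0.
Qed.

(** Nondegeneracy on [dspace] is read off from the dual basis. It is what breaks down for m = n > 0,
    where the identity matrix has supertrace zero and is orthogonal to sl(m|n). *)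
Lemma dform_nondeg y : dspace y -> (forall x, dspace x -> dform x y = 0) -> y = 0.
Proof.
move=> dy y0; rewrite (basis_expand dy) big1 // => a _.
(* The two arguments of the form can be exchanged only on homogeneous elements, so [y] is split
   first. *)
rewrite [y]hcompE dformDl.
rewrite (dformC _ (@hhom_hcomp _ _ _ false y)) (dformC _ (@hhom_hcomp _ _ _ true y)).
by rewrite -!dform_hcomp !y0 ?mulr0 ?addr0 ?scale0r //; exact: dspace_hcomp.
Qed.

Lemma dform_inj y w : dspace y -> dspace w ->
  (forall x, dspace x -> dform x y = dform x w) -> y = w.
Proof.
move=> dy dw e; apply/eqP; rewrite -subr_eq0; apply/eqP; apply: dform_nondeg.
  exact: dspaceB.
by move=> x dx; rewrite dformDr dformNr e // subrr.
Qed.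

Lemma dual_expand y : dspace y -> y = \sum_a dform (h a) y *: hd a.
Proof.
move=> dy; apply: dform_inj => //; first by apply: dspace_sum => a _; exact: dspaceZ.
move=> x dx; rewrite {1}(basis_expand dx) dform_suml dform_sumr.
by apply: eq_bigr => a _; rewrite dformZl dformZr mulrC.
Qed.

(** The form pairs only equal parities, so the dual basis inherits the parities of the basis. *)
Lemma hhom_hd a : hhom (ph a) (hd a).
Proof.
apply/hhomP; apply: dform_inj => // [|x dx]; first exact: dspace_hcomp.
rewrite (basis_expand dx) !dform_suml; apply: eq_bigr => b _; rewrite !dformZl.
congr (_ * _); rewrite -dform_hcomp (hcomp_hhom _ (@hhomh b)).
case: eqP => [//|ne]; rewrite dform0l (proj2 hdual).
by case: eqP => // ab; case: ne; rewrite ab.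
Qed.

(* [hat f] represents the linear part of f through the form. *)
Definition hat f : dt := \sum_a delta (h a) f *: hd a.

Lemma hat_dspace f : dspace (hat f).
Proof. by apply: dspace_sum => a _; exact: dspaceZ. Qed.

Lemma delta_linear z x y f : delta (z *: x + y) f = z * delta x f + delta y f.
Proof.
rewrite !deltaE mulr_sumr -big_split; apply: eq_bigr => k _ /=.
by rewrite hvalD hvalZ mulrDl mulrA.
Qed.
Lemma delta_hcomp p x f : delta x (hpart p f) = delta (hcomp p x) f.
Proof.
rewrite !deltaE; apply: eq_bigr => k _; rewrite lin_hpart hval_hcomp.
by case: ifP; rewrite ?mulr0 ?mul0r.
Qed.

Lemma hatP x f : dspace x -> dform x (hat f) = delta x f.
Proof.
move=> dx; rewrite {2}(basis_expand dx) dform_sumr.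
have -> : delta (\sum_a dform x (hd a) *: h a) f = \sum_a dform x (hd a) * delta (h a) f.
  have d0 : delta (0 : dt) f = 0 by rewrite deltaE big1 // => k _; rewrite hval0 mul0r.
  by elim/big_ind2: _ => [//|u1 s1 u2 s2 <- <-|a _];
    [rewrite -[s1]scale1r delta_linear mul1r scale1r|rewrite -[_ *: _]addr0 delta_linear
      d0 addr0].
by apply: eq_bigr => a _; rewrite dformZr mulrC.
Qed.

Lemma hat_unique f y : dspace y -> (forall x, dspace x -> dform x y = delta x f) -> hat
  f = y.
Proof.
move=> dy e; apply: dform_inj => // [|x dx]; first exact: hat_dspace.
by rewrite hatP // e.
Qed.

Lemma hat_linear z f g : hat (z *: f + g) = z *: hat f + hat g.
Proof.
apply: hat_unique => [|x dx]; first by apply: dspace_lin; exact: hat_dspace.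
by rewrite dformDr dformZr !hatP // deltaD deltaZ.
Qed.

Lemma hat_hpart p f : hat (hpart p f) = hcomp p (hat f).
Proof.
apply: hat_unique => [|x dx]; first exact/dspace_hcomp/hat_dspace.
by rewrite -dform_hcomp hatP ?delta_hcomp //; exact: dspace_hcomp.
Qed.

(** * A decomposition of d into two isotropic subalgebras *)

Section Splitting.
Variables (E E' : set dt).
Hypotheses (gE : is_graded_subalgebra E) (gE' : is_graded_subalgebra E').
Hypotheses (iE : isotropic E) (iE' : isotropic E').
Hypothesis cap0 : forall x, E x -> E' x -> x = 0.
Hypothesis split : forall x, dspace x -> exists y, E' y /\ E (x - y).

Local Notation P' := (dproj E' E).

Let E_lin z x y : E x -> E y -> E (z *: x + y). Proof. exact: (gsa_subspace gE).2. Qed.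
Let E'_lin z x y : E' x -> E' y -> E' (z *: x + y). Proof. exact: (gsa_subspace gE').2.
  Qed.
Let E_0 : E 0. Proof. exact: (gsa_subspace gE).1. Qed.
Let E'_0 : E' 0. Proof. exact: (gsa_subspace gE').1. Qed.
Let E_D x y : E x -> E y -> E (x + y). Proof. by move=> ? ?; rewrite -[x]scale1r;
  exact: E_lin. Qed.
Let E'_D x y : E' x -> E' y -> E' (x + y). Proof. by move=> ? ?; rewrite -[x]scale1r;
  exact: E'_lin. Qed.
Let E_Z z x : E x -> E (z *: x). Proof. by move=> Ex; rewrite -[z *: x]addr0;
  exact: E_lin. Qed.
Let E'_Z z x : E' x -> E' (z *: x). Proof. by move=> Ex; rewrite -[z *: x]addr0;
  exact: E'_lin. Qed.

Lemma projP x : dspace x -> E' (P' x) /\ E (x - P' x).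
Proof.
move=> dx; apply: (@xgetPex _ 0 [set y | E' y /\ E (x - y)]%classic); exact: split.
Qed.

Lemma proj_unique x y : E' y -> E (x - y) -> dspace x -> P' x = y.
Proof.
move=> Ey Exy /projP[E1 E2]; apply/eqP; rewrite -subr_eq0; apply/eqP; apply: cap0.
  have -> : P' x - y = (-1) *: (x - P' x) + (x - y).
    by rewrite scaleN1r opprB addrA subrK.
  exact: E_lin.
by rewrite addrC -scaleN1r; exact: E'_lin.
Qed.

Lemma proj_linear z x y : dspace x -> dspace y -> P' (z *: x + y) = z *: P' x + P' y.
Proof.
move=> dx dy; have [x1 x2] := projP dx; have [y1 y2] := projP dy.
apply: proj_unique; [exact: E'_lin| |exact: dspace_lin].
by rewrite opprD addrACA -scalerBr; exact: E_lin.
Qed.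

Lemma proj_hcomp p x : dspace x -> P' (hcomp p x) = hcomp p (P' x).
Proof.
move=> dx; have [x1 x2] := projP dx; apply: proj_unique; last exact: dspace_hcomp.
  exact: gsa_hcomp.
by rewrite -linearB; exact: gsa_hcomp.
Qed.

Lemma hcomp_dphi p x : hcomp p (dphi x) = dphi (hcomp p x).
Proof.
apply: hvalP => k; rewrite hval_hcomp !hval_dphi hval_hcomp.
have -> : gpar (kbar k) = gpar k by rewrite /gpar /= addbC.
by case: ifP; rewrite // conjC0 mulr0 oppr0.
Qed.

Lemma proj_dphi x : dspace x -> P' (dphi x) = dphi (P' x).
Proof.
move=> dx; have [x1 x2] := projP dx.
apply: proj_unique; [exact: (gsa_dphi gE')| |exact: dspace_dphi].
have -> : dphi x - dphi (P' x) = dphi (x - P' x).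
  have -> : x - P' x = (-1) *: P' x + x by rewrite scaleN1r addrC.
  by rewrite dphi_antilinear rmorphN1 scaleN1r addrC.
exact: (gsa_dphi gE).
Qed.

(** If [y] is orthogonal to E, then so is its component in E', which is also orthogonal to E' by
    isotropy; nondegeneracy makes it zero. *)
Lemma proj_eq0 y : dspace y -> (P' y = 0) <-> (forall x, E x -> dform x y = 0).
Proof.
move=> dy; have [y1 y2] := projP dy; split=> [y0 x Ex|y0].
  by apply: iE => //; move: y2; rewrite y0 subr0.
apply: dform_nondeg => [|x dx]; first exact: (gsa_dspace gE').
have [x1 x2] := projP dx; rewrite -[x](subrK (P' x)) dformDl (iE' x1 y1) addr0.
by rewrite -[P' y](subKr y) dformDr dformNr (iE x2 y2) subr0 y0.
Qed.

Variable sg : C.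
Hypothesis sg2 : sg * sg = 1.
Hypothesis sg_conj : sg^* = sg.
Hypothesis RdE : forall x, dspace x -> Rd x = sg *: (P' x - (x - P' x)).

Lemma sg_neq0 : sg != 0.
Proof. by apply/eqP => s0; move: sg2; rewrite s0 mul0r => /esym/eqP;
  rewrite oner_eq0. Qed.

Lemma Rd_dspace x : dspace x -> dspace (Rd x).
Proof.
move=> dx; have dP : dspace (P' x) by have [/(gsa_dspace gE')] := projP dx.
by rewrite RdE //; apply: dspaceZ; do !apply: dspaceB => //.
Qed.

Lemma Rd_linear z x y : dspace x -> dspace y -> Rd (z *: x + y) = z *: Rd x + Rd y.
Proof.
move=> dx dy; rewrite !RdE ?proj_linear //; last exact: dspace_lin.
by apply: hvalP => k; rewrite !(hvalD, hvalZ, hvalN); ring.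
Qed.

Lemma Rd0 : Rd (0 : dt) = 0.
Proof.
have := @Rd_linear (-1) 0 0 dspace0 dspace0.
by rewrite scaler0 addr0 scaleN1r addNr.
Qed.

Lemma Rd_sum (I : Type) (t : seq I) (F : I -> dt) (c : I -> C) : (forall i, dspace (F
  i)) ->
  Rd (\sum_(i <- t) c i *: F i) = \sum_(i <- t) c i *: Rd (F i).
Proof.
move=> dF; elim: t => [|i t IH]; first by rewrite !big_nil Rd0.
rewrite !big_cons Rd_linear ?IH //.
by apply: dspace_sum => j _; exact: dspaceZ.
Qed.

Lemma Rd_hcomp p x : dspace x -> Rd (hcomp p x) = hcomp p (Rd x).
Proof.
move=> dx; rewrite !RdE ?proj_hcomp //; last exact: dspace_hcomp.
by rewrite linearZ /= !linearB.
Qed.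

Lemma hhom_Rd p x : dspace x -> hhom p x -> hhom p (Rd x).
Proof. by move=> dx /hhomP xp; apply/hhomP; rewrite -(Rd_hcomp p dx) xp. Qed.

(** Isotropy leaves only pairings between E and E', and [Rd] has opposite signs on the two. *)
Lemma Rd_skew x y : dspace x -> dspace y -> dform (Rd x) y = - dform x (Rd y).
Proof.
move=> dx dy; have [x1 x2] := projP dx; have [y1 y2] := projP dy.
rewrite !RdE // dformZl dformZr -mulrN; congr (_ * _).
have ex : x = P' x + (x - P' x) by rewrite addrC subrK.
have ey : y = P' y + (y - P' y) by rewrite addrC subrK.
move: (P' x) (x - P' x) x1 x2 ex (P' y) (y - P' y) y1 y2 ey.
move=> x' x'' x1 x2 -> y' y'' y1 y2 ->.
by rewrite !(dformDl, dformDr, dformNl, dformNr) (iE x2 y2) (iE' x1 y1); ring.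
Qed.

Local Notation rm a b := (dform (Rd (hd a)) (hd b)).

Lemma sum_rm_h a : \sum_c rm a c *: h c = Rd (hd a).
Proof. by rewrite -basis_expand //; exact: Rd_dspace. Qed.

Lemma sum_bool_hcomp x : x = \sum_(q : bool) hcomp q x.
Proof. by rewrite big_bool /= addrC; exact: hcompE. Qed.

(** Test against [x]: contracting the bases in [delta_pbr] puts [Rd] on one of the two linear parts,
    and invariance of the form then frees [x] from the bracket. *)
Lemma hat_pbr f g (u := hat f) (v := hat g) : hat (pbr h hd ph f g) =
  2^-1 *: \sum_(p : bool) \sum_(q : bool) (-1) ^+ (p && q) *:
    (dbr (Rd (hcomp p u)) (hcomp q v) + dbr (hcomp p u) (Rd (hcomp q v))).
Proof.
have du : dspace u by exact: hat_dspace.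
have dv : dspace v by exact: hat_dspace.
apply: hat_unique => [|x dx].
  apply: dspaceZ; apply: dspace_sum => p _; apply: dspace_sum => q _; apply: dspaceZ.
  by apply: dspaceD; exact: dspace_dbr.
rewrite dformZr (@delta_pbr _ _ _ _ h hd ph hhomh) mulNr -mulrN; congr (_ * _).
rewrite dform_sumr -[RHS]sumrN; apply: eq_bigr => p _; rewrite dform_sumr.
set up := hcomp p u; have dup : dspace up by exact: dspace_hcomp.
have upp : hhom p up by exact: hhom_hcomp.
have dP y : dspace y -> delta y (hpart p f) = dform y up.
  by move=> dy; rewrite delta_hcomp -hatP ?dform_hcomp //; exact: dspace_hcomp.
transitivity (- (\sum_a \sum_c (-1) ^+ (p && ph a) * rm a c * (dform (h a) up * dform
  (dbr (h c) x) v)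
   + \sum_a \sum_c (-1) ^+ (p && ph a) * rm a c * (dform (dbr (h a) x) up * dform (h c)
     v))); last first.
  congr (- _); rewrite -big_split; apply: eq_bigr => a _; rewrite -big_split;
    apply: eq_bigr => c _ /=.
  rewrite !dP ?[delta _ g](esym (hatP _ _)) //; [|exact: dspace_dbr..].
  by rewrite -mulrDr.
have -> : \sum_a \sum_c (-1) ^+ (p && ph a) * rm a c * (dform (h a) up * dform (dbr (h
  c) x) v)
    = - \sum_(q : bool) (-1) ^+ (p && q) * dform x (dbr (Rd up) (hcomp q v)).
  (* Contracting a with [up] and c with the matrix of [Rd] rebuilds [Rd up]. Only basis elements of
     parity p survive, so the sign becomes (-1)^p. *)
  transitivity ((-1) ^+ p * dform (dbr (Rd up) x) v).
    rewrite {2}(dual_expand dup) Rd_sum // dbr_suml dform_suml mulr_sumr;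
      apply: eq_bigr => a _.
    rewrite -[in RHS]sum_rm_h dbrZl dformZl dbr_suml dform_suml !mulr_sumr;
      apply: eq_bigr => c _.
    rewrite dbrZl dformZl.
    have [->|ne] := eqVneq (ph a) p; first by rewrite andbb; ring.
    by rewrite (dform_neq (@hhomh a) upp ne) !(mul0r, mulr0).
  rewrite [X in dform _ X]sum_bool_hcomp dform_sumr mulr_sumr -sumrN;
    apply: eq_bigr => q _.
  rewrite (dform_invariant _ (hhom_Rd dup upp) (@hhom_hcomp _ _ _ q v)).
  by case: p {dP upp dup} @up; case: q; rewrite /= ?expr0 ?expr1; ring.
have -> : \sum_a \sum_c (-1) ^+ (p && ph a) * rm a c * (dform (dbr (h a) x) up * dform
  (h c) v)
    = - \sum_(q : bool) (-1) ^+ (p && q) * dform x (dbr up (Rd (hcomp q v))).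
  transitivity (\sum_(q : bool) - ((-1) ^+ (p && q) * (-1) ^+ q * dform (dbr (Rd (hcomp
    q v)) x) up)).
    transitivity (\sum_a \sum_(q : bool) - ((-1) ^+ (p && q) * (-1) ^+ q * dform (Rd
      (hcomp q v)) (hd a) * dform (dbr (h a) x) up)).
      apply: eq_bigr => a _.
      (* Here c is contracted first, which puts [Rd] on [hd a]. Skewness moves it to [v], and
         supersymmetry of the form then exposes the coordinates of [Rd (hcomp q v)] in the basis. *)
      transitivity ((-1) ^+ (p && ph a) * dform (dbr (h a) x) up * dform (Rd (hd a)) v).
        rewrite -[in RHS]sum_rm_h dform_suml mulr_sumr; apply: eq_bigr => c _.
        by rewrite dformZl; ring.
      rewrite {1}[v]sum_bool_hcomp dform_sumr mulr_sumr; apply: eq_bigr => q _.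
      have dq : dspace (hcomp q v) by exact: dspace_hcomp.
      have qq : hhom q (hcomp q v) by exact: hhom_hcomp.
      have Rqq := hhom_Rd dq qq.
      rewrite Rd_skew // (dformC _ (@hhom_hd a)).
      have [->|ne] := eqVneq (ph a) q; first by ring.
      by rewrite (dform_neq Rqq (@hhom_hd a)) 1?eq_sym // !(mulr0, mul0r, oppr0).
    rewrite exchange_big; apply: eq_bigr => q _; rewrite sumrN; congr (- _).
    have dR : dspace (Rd (hcomp q v)) by exact/Rd_dspace/dspace_hcomp.
    rewrite {2}(basis_expand dR) dbr_suml dform_suml mulr_sumr; apply: eq_bigr => a _.
    by rewrite dbrZl dformZl mulrA.
  rewrite -sumrN; apply: eq_bigr => q _; congr (- _).
  have dq : dspace (hcomp q v) by exact: dspace_hcomp.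
  have Rqq := hhom_Rd dq (@hhom_hcomp _ _ _ q v).
  rewrite (dform_invariant _ Rqq upp) (dbr_anti Rqq upp) dformNr dformZr.
  by case: p {dP upp dup} @up; case: q {dq Rqq}; rewrite /= ?expr0 ?expr1; ring.
rewrite -opprD opprK -big_split; apply: eq_bigr => q _ /=.
by rewrite dformZr dformDr mulrDr.
Qed.

Lemma dbrNl x y : dbr (- x) y = - dbr x y.
Proof. by rewrite -scaleN1r dbrZl scaleN1r. Qed.
Lemma dbrNr x y : dbr x (- y) = - dbr x y.
Proof. by rewrite -scaleN1r dbrZr scaleN1r. Qed.

(** As [Rd] has opposite signs on E' and E, the mixed brackets cancel. Only the brackets internal to
    the two subalgebras remain, so that no projection of a mixed bracket is ever needed. *)
Lemma Rd_bracket x y : dspace x -> dspace y -> dbr (Rd x) y + dbr x (Rd y) =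
  (2 * sg) *: (dbr (P' x) (P' y) - dbr (x - P' x) (y - P' y)).
Proof.
move=> dx dy; rewrite !RdE //.
have ex : x = P' x + (x - P' x) by rewrite addrC subrK.
have ey : y = P' y + (y - P' y) by rewrite addrC subrK.
move: (P' x) (x - P' x) ex (P' y) (y - P' y) ey => x' x'' -> y' y'' ->.
rewrite dbrZl dbrZr !(dbrDl, dbrDr, dbrNl, dbrNr); apply: hvalP => k.
by rewrite !(hvalZ, hvalD, hvalN); ring.
Qed.

Lemma proj_hat_pbr f g (u := P' (hat f)) (v := P' (hat g)) : P' (hat (pbr h hd ph f g)) =
  sg *: \sum_(p : bool) \sum_(q : bool) (-1) ^+ (p && q) *: dbr (hcomp p u) (hcomp q v).
Proof.
have du := hat_dspace f; have dv := hat_dspace g.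
have [u1 u2] := projP du; have [v1 v2] := projP dv.
apply: proj_unique; last exact: hat_dspace.
  apply: E'_Z; elim/big_ind: _ => // p _; elim/big_ind: _ => // q _.
  exact: E'_Z (gsa_dbr gE' (gsa_hcomp gE' p u1) (gsa_hcomp gE' q v1)).
(* What is left is, up to sign, the same expression in the components along E, hence an element of
   E. *)
have -> : hat (pbr h hd ph f g) - sg *: (\sum_(p : bool) \sum_(q : bool)
      (-1) ^+ (p && q) *: dbr (hcomp p u) (hcomp q v)) =
    (- sg) *: (\sum_(p : bool) \sum_(q : bool) (-1) ^+ (p && q) *:
      dbr (hcomp p (hat f - u)) (hcomp q (hat g - v))).
  rewrite hat_pbr; apply/eqP; rewrite subr_eq; apply/eqP.
  rewrite scaleNr addrC -scalerBr -sumrB !scaler_sumr; apply: eq_bigr => p _.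
  rewrite -sumrB !scaler_sumr; apply: eq_bigr => q _.
  rewrite (Rd_bracket (dspace_hcomp p du) (dspace_hcomp q dv)) (proj_hcomp p du)
    (proj_hcomp q dv).
  rewrite -/u -/v (linearB (hcomp p)) (linearB (hcomp q)) /=.
  apply: hvalP => k; rewrite !(hvalZ, hvalD, hvalN).
  by field.
apply: E_Z; elim/big_ind: _ => // p _; elim/big_ind: _ => // q _; apply: E_Z.
exact: gsa_dbr (gsa_hcomp gE p u2) (gsa_hcomp gE q v2).
Qed.

Lemma dphiD x y : dphi (x + y) = dphi x + dphi y.
Proof. by rewrite -[x in LHS]scale1r dphi_antilinear conjC1 scale1r. Qed.
Lemma dphi0 : dphi (0 : dt) = 0.
Proof. by apply: hvalP => k; rewrite hval_dphi !hval0 conjC0 mulr0 oppr0. Qed.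
Lemma dphiZ z x : dphi (z *: x) = z^* *: dphi x.
Proof. by rewrite -[z *: x]addr0 dphi_antilinear dphi0 addr0. Qed.

Lemma hat_star f (u := hat f) : hat (star f) = dphi (hcomp false u) - dphi (hcomp true u).
Proof.
have du : dspace u := hat_dspace f.
apply: hat_unique => [|x dx]; first by apply: dspaceB; exact/dspace_dphi/dspace_hcomp.
rewrite delta_star -hatP -/u; last exact: dspace_dphi.
(* Moving [dphi] across the form inserts its square on a part of parity p, which is where the sign
   (-1)^p comes from. *)
have e p : dform x (dphi (hcomp p u)) = (-1) ^+ p * (dform (dphi (hcomp p x)) u)^*.
  rewrite -hcomp_dphi -dform_hcomp -dform_dphi (dphi_square (@hhom_hcomp _ _ _ p x)).
  by rewrite dformZl mulrA -expr2 sqrr_sign mul1r.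
rewrite dformDr dformNr !e [x in RHS]hcompE dphiD dformDl [in RHS]rmorphD /= expr0 expr1.
by rewrite mul1r mulN1r opprK.
Qed.

(* The cobracket induces sg (-1)^(pq) [ , ] on E' in parities p and q; rescaling
   the odd part by 'i absorbs the sign. *)
Definition twist v : dt := sg *: hcomp false v + 'i *: hcomp true v.
Definition tw p : C := if p then 'i else sg.

Lemma tw_neq0 p : tw p != 0.
Proof. by case: p; [exact: neq0Ci|exact: sg_neq0]. Qed.

Lemma hcomp_twist p v : hcomp p (twist v) = tw p *: hcomp p v.
Proof.
rewrite /twist linearP linearZ /= !(hcomp_hhom _ (@hhom_hcomp _ _ _ _ v)).
by case: p; rewrite /= scaler0 ?addr0 ?add0r.
Qed.

Lemma twist_hom p v : hhom p v -> twist v = tw p *: v.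
Proof.
by move=> vp; rewrite /twist !(hcomp_hhom _ vp); case: p {vp};
  rewrite /= scaler0 ?addr0 ?add0r.
Qed.

Lemma twist_linear z x y : twist (z *: x + y) = z *: twist x + twist y.
Proof.
rewrite /twist !(linearP (hcomp _)) /=; apply: hvalP => k.
by rewrite !(hvalZ, hvalD); ring.
Qed.

Lemma twist0 : twist 0 = 0.
Proof. by have := twist_linear (-1) 0 0; rewrite scaler0 addr0 scaleN1r addNr. Qed.

Lemma twist_eq0 v : twist v = 0 -> v = 0.
Proof.
move=> v0; have z p : hcomp p v = 0.
  have /eqP := hcomp_twist p v; rewrite v0 linear0 eq_sym scaler_eq0.
  by rewrite (negbTE (tw_neq0 p)) => /eqP.
by rewrite [v]hcompE !z addr0.
Qed.

Lemma E'_twist v : E' v -> E' (twist v).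
Proof. by move=> Ev; apply: E'_D; apply: E'_Z; exact: (gsa_hcomp gE'). Qed.

(** Amounts to tw p tw q = sg (-1)^(pq) tw (p + q); the odd-odd case is 'i * 'i = - (sg * sg). *)
Lemma twist_dbr u v :
  twist (sg *: \sum_(p : bool) \sum_(q : bool) (-1) ^+ (p && q) *: dbr (hcomp p u)
    (hcomp q v)) =
  dbr (twist u) (twist v).
Proof.
have twD x y : twist (x + y) = twist x + twist y.
  by rewrite -[x in LHS]scale1r twist_linear scale1r.
have twZ z x : twist (z *: x) = z *: twist x.
  by rewrite -[z *: x]addr0 twist_linear twist0 addr0.
have e p q : twist (dbr (hcomp p u) (hcomp q v)) = tw (p (+) q) *: dbr (hcomp p u)
  (hcomp q v).
  by apply/twist_hom/hhom_dbr; exact: hhom_hcomp.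
rewrite twZ !big_bool /= !(twD, twZ, e) /twist !(dbrDl, dbrDr, dbrZl, dbrZr) /tw /=.
move: (dbr (hcomp true u) (hcomp true v)) (dbr (hcomp true u) (hcomp false v))
  (dbr (hcomp false u) (hcomp true v)) (dbr (hcomp false u) (hcomp false v)) => a b c d.
apply: hvalP => k; rewrite !(hvalZ, hvalD) ?expr0 ?expr1.
have ii : 'i * 'i = - (sg * sg) by rewrite sg2 -expr2 sqrCi.
transitivity ('i * 'i * hval a k + sg * 'i * hval b k + sg * 'i * hval c k + sg * sg *
  hval d k).
  by rewrite ii; ring.
ring.
Qed.

(** The isomorphism from the cotangent space to E', still defined on functions; it becomes a map on
    classes by choosing representatives. *)
Definition beta f : dt := twist (P' (hat f)).

Lemma beta_linear z f g : beta (z *: f + g) = z *: beta f + beta g.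
Proof.
by rewrite /beta hat_linear proj_linear ?twist_linear //; exact: hat_dspace.
Qed.

Lemma beta_E' f : E' (beta f).
Proof. by apply: E'_twist; have [] := projP (hat_dspace f). Qed.

Lemma beta_eq0 f : beta f = 0 <-> (forall x, E x -> delta x f = 0).
Proof.
have df := hat_dspace f; split=> [/twist_eq0/(proj_eq0 df) f0 x Ex|f0].
  by rewrite -hatP ?f0 //; exact: (gsa_dspace gE).
rewrite /beta (proj2 (proj_eq0 df)) ?twist0 //.
by move=> x Ex; rewrite hatP ?f0 //; exact: (gsa_dspace gE).
Qed.

Lemma beta_hpart p f : beta (hpart p f) = hcomp p (beta f).
Proof.
rewrite /beta hat_hpart (proj_hcomp _ (hat_dspace f)) hcomp_twist.
by rewrite (twist_hom (@hhom_hcomp _ _ _ p _)).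
Qed.

Lemma beta_pbr f g : beta (pbr h hd ph f g) = dbr (beta f) (beta g).
Proof. by rewrite /beta proj_hat_pbr twist_dbr. Qed.

(** On odd parts the conjugate of 'i is - 'i, which cancels the sign of [hat_star]; on even parts
    [sg] is real. *)
Lemma beta_star f : beta (star f) = dphi (beta f).
Proof.
have df := hat_dspace f; rewrite /beta hat_star.
have dp p : dspace (dphi (hcomp p (hat f))) by exact/dspace_dphi/dspace_hcomp.
have -> : dphi (hcomp false (hat f)) - dphi (hcomp true (hat f)) =
    (-1) *: dphi (hcomp true (hat f)) + dphi (hcomp false (hat f)) by rewrite scaleN1r
      addrC.
rewrite proj_linear // !proj_dphi; try exact: dspace_hcomp.
rewrite !(proj_hcomp _ df) twist_linear; set w := P' _.
rewrite !(@twist_hom _ (dphi (hcomp _ _)) (hhom_dphi (@hhom_hcomp _ _ _ _ w))) /tw.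
rewrite /twist dphiD !dphiZ sg_conj conjCi addrC scalerA.
by rewrite mulN1r.
Qed.

Lemma beta_surj p x : E' x -> hhom p x -> exists f, [/\ eps f = 0, homog p f & beta f =
  x].
Proof.
move=> Ex xp; pose y := (tw p)^-1 *: x.
have Ey : E' y by exact: E'_Z.
have yp : hhom p y by exact: hhomZ.
have dy : dspace y by exact: (gsa_dspace gE').
(* The linear function with these coefficients is the pairing with [y], so its [hat] is [y];
   dividing by [tw p] beforehand compensates the twist. *)
pose F k := wgt C k * hval y (ktr k); exists (\sum_k F k *: gen k); split.
- by rewrite eps_sum big1 // => k _; rewrite epsZ eps_gen mulr0.
- have fp : parity_of p (\sum_k F k *: (gen k : hser)).
    apply: parity_of_sum => k _ a ap; rewrite coef_scale.
    have [kp|kp] := eqVneq (gpar k) p.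
      by rewrite parity_of_gen ?mulr0 // kp.
    by rewrite /F yp ?mulr0 ?mul0r // gpar_ktr.
  apply: spsPr => a ra; rewrite coef_mksps //; case: eqVneq => // ap.
  by rewrite fp.
have -> : beta (\sum_k F k *: gen k) = twist (P' y).
  congr (twist (P' _)); apply: hat_unique => // z dz.
  rewrite dformE deltaE; apply: eq_bigr => k _;
    rewrite lin_sum (bigD1 k) //= big1 => [|l /negbTE lk].
    by rewrite linZ lin_gen eqxx mulr1 addr0 /F mulrCA.
  by rewrite linZ lin_gen eq_sym lk mulr0.
rewrite (@proj_unique _ y) ?subrr // (twist_hom yp) scalerA mulfV ?scale1r //.
exact: tw_neq0.
Qed.

End Splitting.
End Duality.

(** * Transport of the structure of E to the cotangent space *)

Section Transport.
Variables (C : numClosedFieldType) (m n : nat).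
Local Notation hser := (sps C (@gpar m n)).
Local Notation dt := (dtype C m n).
Implicit Types (x y w : dt) (f g : hser) (p q r : bool).

Variables (K : set hser) (pb : hser -> hser -> hser) (beta : hser -> dt) (E : set dt).
Hypothesis gE : is_graded_subalgebra E.
Hypothesis beta_linear : forall z f g, beta (z *: f + g) = z *: beta f + beta g.
Hypothesis beta_eq0 : forall f, eps f = 0 -> beta f = 0 <-> Omega K f = 0.
Hypothesis beta_E : forall f, E (beta f).
Hypothesis beta_hpart : forall p f, beta (hpart p f) = hcomp p (beta f).
Hypothesis beta_surj : forall p x, E x -> hhom p x ->
  exists f, [/\ eps f = 0, homog p f & beta f = x].
Hypothesis beta_pb : forall f g, beta (pb f g) = dbr (beta f) (beta g).
Hypothesis beta_star : forall f, beta (star f) = dphi (beta f).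
Hypothesis eps_pb : forall f g, eps (pb f g) = 0.

Local Notation V := (cotangent K).
Implicit Types (u v : V).

(** The ambient space [cotangent K] contains the classes of all series, including those with a
    nonzero constant term. The representative is sought in the kernel of the counit; the default 0
    serves for classes without one, which lie outside [lspace]. *)
Definition rep u : hser := xget 0 [set f | eps f = 0 /\ Omega K f = u]%classic.
Definition tbr u v : V := Omega K (pb (rep u) (rep v)).
Definition tphi u : V := Omega K (star (rep u)).
Definition tiso u : dt := beta (rep u).

Lemma eps_hpart p f : eps f = 0 -> eps (hpart p f) = 0.
Proof. by rewrite !epsE => f0; rewrite coef_mksps ?reduced0 // f0 if_same. Qed.

Lemma coef_hpart p f a :
  coef (hpart p f) a = if epar (@gpar m n) a == p then coef f a else 0.
Proof.
have [ra|ra] := boolP (reduced (@gpar m n) a); first exact: coef_mksps.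
by rewrite !coef_reduced ?if_same.
Qed.

Lemma hpart_homog p f : homog p (hpart p f).
Proof. by apply: spsPr => a ra; rewrite !coef_hpart; case: eqP. Qed.

Lemma hpart_sum f : f = hpart false f + hpart true f.
Proof.
apply: spsPr => a ra; rewrite coefD !coef_hpart.
by case: (epar _ a); rewrite /= ?addr0 ?add0r.
Qed.

Lemma beta_Omega f g : eps f = 0 -> eps g = 0 -> beta f = beta g <-> Omega K f = Omega K
  g.
Proof.
move=> f0 g0; have e : eps ((-1) *: g + f) = 0 by rewrite epsD epsZ f0 g0 mulr0 addr0.
have := beta_eq0 e; rewrite beta_linear OmegaP !scaleN1r ![- _ + _]addrC => be.
by split=> /eqP; rewrite -subr_eq0 => /eqP/be/eqP; rewrite subr_eq0 => /eqP.
Qed.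

Lemma repP f : eps f = 0 -> eps (rep (Omega K f)) = 0 /\ beta (rep (Omega K f)) = beta f.
Proof.
move=> f0; have [e o] := @xgetPex _ 0 [set g | eps g = 0 /\ Omega K g = Omega K f]%classic
  (ex_intro _ f (conj f0 erefl)).
by split=> //; apply/(beta_Omega e f0).
Qed.

Lemma tisoE f : eps f = 0 -> tiso (Omega K f) = beta f.
Proof. by case/repP. Qed.

Lemma eps_star0 f : eps f = 0 -> eps (star f) = 0.
Proof. by move=> f0; rewrite eps_starE f0 conjC0. Qed.

(** The result does not depend on the representatives, because the image under [beta] of a bracket
    or of a star depends only on the images of its arguments. *)
Lemma transport_induced : is_induced pb tbr tphi.
Proof.
split=> [f g f0 g0|f f0].
  have [rf bf] := repP f0; have [rg bg] := repP g0.
  by apply/(beta_Omega (eps_pb _ _) (eps_pb _ _)); rewrite !beta_pb bf bg.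
have [rf bf] := repP f0.
by apply/beta_Omega; rewrite ?eps_star0 // !beta_star bf.
Qed.

Let L := dual_lie tbr tphi.

Definition ker_class u : Prop := exists f, eps f = 0 /\ Omega K f = u.

Lemma compP p u : gcomp L p u <-> exists f, [/\ eps f = 0, homog p f & Omega K f = u].
Proof. by split=> [[f [f0 fp] fu]|[f [f0 fp fu]]]; exists f. Qed.

Lemma comp_ker p u : gcomp L p u -> ker_class u.
Proof. by case/compP => f [f0 _ fu]; exists f. Qed.

Lemma lspaceP u : lspace L u <-> ker_class u.
Proof.
split=> [[u0 [u1 [/compP[f [f0 _ <-]] /compP[g [g0 _ <-]] ->]]]|[f [f0 <-]]].
  by exists (f + g); rewrite epsD f0 g0 addr0 OmegaD.
exists (Omega K (hpart false f)), (Omega K (hpart true f)); split.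
- by apply/compP; exists (hpart false f); split; [exact: eps_hpart|exact: hpart_homog|].
- by apply/compP; exists (hpart true f); split; [exact: eps_hpart|exact: hpart_homog|].
by rewrite -OmegaD -hpart_sum.
Qed.

Lemma ker_class_lin z u v : ker_class u -> ker_class v -> ker_class (z *: u + v).
Proof.
move=> [f [f0 <-]] [g [g0 <-]]; exists (z *: f + g).
by rewrite epsD epsZ f0 g0 mulr0 addr0 OmegaP.
Qed.

Lemma tiso_linear z u v : ker_class u -> ker_class v -> tiso (z *: u + v) = z *: tiso u
  + tiso v.
Proof.
move=> [f [f0 <-]] [g [g0 <-]]; rewrite -OmegaP !tisoE ?beta_linear //.
by rewrite epsD epsZ f0 g0 mulr0 addr0.
Qed.

Lemma tiso_inj u v : ker_class u -> ker_class v -> tiso u = tiso v -> u = v.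
Proof. by move=> [f [f0 <-]] [g [g0 <-]]; rewrite !tisoE // => /(beta_Omega f0 g0). Qed.

Lemma tbr_ker u v : ker_class (tbr u v).
Proof. by exists (pb (rep u) (rep v)). Qed.

Lemma tphi_ker u : ker_class u -> ker_class (tphi u).
Proof. by move=> [f [f0 <-]]; exists (star (rep (Omega K f))); rewrite eps_star0 //;
  case: (repP f0). Qed.

Lemma tiso_tbr u v : tiso (tbr u v) = dbr (tiso u) (tiso v).
Proof. by rewrite tisoE // beta_pb. Qed.

Lemma tiso_tphi u : ker_class u -> tiso (tphi u) = dphi (tiso u).
Proof.
by move=> [f [f0 <-]]; rewrite /tphi tisoE ?beta_star // eps_star0 //; case: (repP f0).
Qed.

(** For the converse, a homogeneous image has a homogeneous preimage by [beta_surj], and injectivity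
    identifies its class with [u]. *)
Lemma tiso_comp p u : ker_class u -> gcomp L p u <-> hhom p (tiso u).
Proof.
move=> ku; split=> [/compP[f [f0 fp <-]]|up].
  by rewrite tisoE // -fp beta_hpart; exact: hhom_hcomp.
have Eu : E (tiso u) by exact: beta_E.
have [f [f0 fp fu]] := beta_surj Eu up; apply/compP; exists f; split=> //.
by apply: tiso_inj => //; [exists f|rewrite tisoE].
Qed.

Lemma ker_class0 : ker_class 0.
Proof. by exists 0; rewrite Omega0 eps0. Qed.

Lemma tiso0 : tiso 0 = 0.
Proof.
rewrite -(Omega0 K) tisoE ?eps0 //; apply/(beta_eq0 (eps0 _ _)).
exact: Omega0.
Qed.

Lemma transport_lie : is_graded_real_lie L.
Proof.
have cl := lspaceP; have k1 z u : ker_class u -> ker_class (z *: u).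
  by move=> ku; rewrite -[z *: u]addr0; apply: ker_class_lin => //; exact: ker_class0.
have tZ z u : ker_class u -> tiso (z *: u) = z *: tiso u.
  by move=> ku; rewrite -[z *: u]addr0 tiso_linear ?tiso0 ?addr0 //; exact: ker_class0.
(* Every axiom of the form t = z *: u + v is now checked after applying [tiso], in d. *)
have lin2 z u v (t : V) : ker_class u -> ker_class v -> ker_class t ->
    tiso t = z *: tiso u + tiso v -> t = z *: u + v.
  by move=> ku kv kw e; apply: tiso_inj => //; [exact: ker_class_lin|rewrite tiso_linear].
split; split.
- move=> p; split=> [|z u v up vp].
    by apply/(tiso_comp _ ker_class0) => k _; rewrite tiso0 hval0.
  have ku := comp_ker up; have kv := comp_ker vp.
  apply/(tiso_comp _ (ker_class_lin z ku kv)); rewrite tiso_linear //.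
  by apply: hhomD; [apply/hhomZ/tiso_comp|apply/tiso_comp].
- move=> u u0 u1; have ku := comp_ker u0.
  apply: tiso_inj => //; first exact: ker_class0.
  move/(tiso_comp _ ku): u0 => u0; move/(tiso_comp _ ku): u1 => u1.
  rewrite tiso0; apply: hvalP => k; rewrite hval0.
  by case: (boolP (gpar k)) => kp; [apply: u0; rewrite kp|apply: u1; rewrite (negbTE kp)].
- move=> p q u v up vq; apply/(tiso_comp _ (tbr_ker u v)); rewrite tiso_tbr.
  by apply: hhom_dbr; [apply/(tiso_comp _ (comp_ker up))|apply/(tiso_comp _ (comp_ker
    vq))].
- move=> z u u' v /cl ku /cl ku' /cl kv; apply: lin2; try exact: tbr_ker.
  by rewrite !tiso_tbr tiso_linear // dbr_linearl.
- move=> z u v v' /cl ku /cl kv /cl kv'; apply: lin2; try exact: tbr_ker.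
  by rewrite !tiso_tbr tiso_linear // dbr_linearr.
- move=> p q u v up vq; rewrite -scaleN1r; apply: tiso_inj; [exact: tbr_ker| |].
    by do 2!apply: (k1); exact: tbr_ker.
  rewrite !tZ ?tiso_tbr; [|exact: tbr_ker|by apply: (k1); exact: tbr_ker].
  rewrite scaleN1r; apply: dbr_anti; first exact/(tiso_comp _ (comp_ker up)).
  exact/(tiso_comp _ (comp_ker vq)).
(* The Jacobi identity is reordered to put the scaled term first, as [lin2] expects. *)
- move=> p q r u v t up vq wr; rewrite addrC; apply: lin2; try exact: tbr_ker.
  rewrite !tiso_tbr addrC; apply: (@dbr_jacobi _ _ _ p q r).
  + exact/(tiso_comp _ (comp_ker up)).
  + exact/(tiso_comp _ (comp_ker vq)).
  + exact/(tiso_comp _ (comp_ker wr)).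
- move=> p u up; have ku := comp_ker up; apply/(tiso_comp _ (tphi_ker ku)).
  by rewrite tiso_tphi //; apply: hhom_dphi; apply/(tiso_comp _ ku).
- move=> z u v /cl ku /cl kv; apply: lin2; try exact: tphi_ker.
    by apply: tphi_ker; exact: ker_class_lin.
  by rewrite !tiso_tphi ?tiso_linear ?dphi_antilinear //; exact: ker_class_lin.
- move=> p u up; have ku := comp_ker up; apply: tiso_inj.
  + by do 2!apply: tphi_ker.
  + exact: k1.
  rewrite tZ // !tiso_tphi //; last exact: tphi_ker.
  by apply: dphi_square; apply/(tiso_comp _ ku).
move=> u v /cl ku /cl kv; apply: tiso_inj; [exact/tphi_ker/tbr_ker|exact: tbr_ker|].
by rewrite tiso_tphi ?tiso_tbr ?tiso_tphi ?dphi_dbr //; exact: tbr_ker.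
Qed.

Lemma transport_iso : grlie_iso L (sublie E).
Proof.
exists tiso; split.
- by move=> z u v /lspaceP ku /lspaceP kv; exact: tiso_linear.
- by move=> p u up; split; [exact: beta_E|apply/(tiso_comp _ (comp_ker up))].
- split=> [u _|u v /set_mem/lspaceP ku /set_mem/lspaceP kv|x /(sublie_lspace gE) Ex].
  + by apply/(sublie_lspace gE); exact: beta_E.
  + exact: tiso_inj.
  (* [beta_surj] only lifts homogeneous elements, so the even and odd parts are lifted separately
     and added. *)
  have [f [f0 _ fx]] := beta_surj (gsa_hcomp gE false Ex) (@hhom_hcomp _ _ _ false x).
  have [g [g0 _ gx]] := beta_surj (gsa_hcomp gE true Ex) (@hhom_hcomp _ _ _ true x).
  have fg0 : eps (1 *: f + g) = 0 by rewrite scale1r epsD f0 g0 addr0.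
  exists (Omega K (1 *: f + g)); first by apply/lspaceP; exists (1 *: f + g).
  by rewrite tisoE // beta_linear scale1r fx gx -hcompE.
- by move=> u v _ _; exact: tiso_tbr.
by move=> u /lspaceP ku; exact: tiso_tphi.
Qed.

End Transport.

(** * Application to the two orderings of g and b *)

Section Main.
Variables (C : numClosedFieldType) (m n : nat).
Variables (T : finType) (h hd : T -> dtype C m n) (ph : T -> bool).
Hypotheses (hbasis : is_homog_basis h ph) (hdual : is_dual_basis h hd).
Local Notation hser := (sps C (@gpar m n)).
Local Notation gspace := (@gspace C m n).
Local Notation bspace := (@bspace C m n).

Lemma duality (E E' : set (dtype C m n)) (K : set hser) (sg : C) :
    is_graded_subalgebra E -> is_graded_subalgebra E' -> isotropic E -> isotropic E' ->
    (forall x, E x -> E' x -> x = 0) ->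
    (forall x, dspace x -> exists y, E' y /\ E (x - y)) ->
    sg * sg = 1 -> sg^* = sg ->
    (forall x, dspace x -> Rd x = sg *: (dproj E' E x - (x - dproj E' E x))) ->
    (forall f, eps f = 0 -> Omega K f = 0 <-> forall x, E x -> delta x f = 0) ->
  exists br phi, [/\ is_induced (K := K) (pbr h hd ph) br phi,
    is_graded_real_lie (dual_lie br phi) & grlie_iso (dual_lie br phi) (sublie E')].
Proof.
move=> gE gE' iE iE' cap spl sg2 sgc RdE OK.
pose b := beta h hd E E' sg.
have bl := beta_linear hbasis hdual gE gE' cap spl sg.
have b0 f : eps f = 0 -> b f = 0 <-> Omega K f = 0.
  move=> f0; rewrite OK //.
  exact: (beta_eq0 hbasis hdual gE gE' iE iE' spl sg2).
have bE : forall f, E' (b f) := beta_E' hdual gE' spl sg.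
have bh := beta_hpart hbasis hdual gE gE' cap spl sg.
have bs := beta_surj hbasis hdual gE gE' cap spl sg2.
have bp := beta_pbr hbasis hdual gE gE' iE iE' cap spl sg2 RdE.
have bst := beta_star hbasis hdual gE gE' cap spl sgc.
have hh : forall a, hhom (ph a) (h a) by case: hbasis.
have ep := eps_pbr hd hh.
exists (tbr (pbr h hd ph)), (@tphi C m n K); split.
- exact: (transport_induced bl b0 bp bst ep).
- exact: (@transport_lie _ _ _ K _ b E').
exact: (@transport_iso _ _ _ K _ b E').
Qed.

Lemma split_b (x : dtype C m n) : dspace x -> exists y, bspace y /\ gspace (x - y).
Proof. by move=> dx; exists (bpart x); split; [exact: bpart_bspace|exact: bpart_gspace].
  Qed.

Lemma split_g (x : dtype C m n) : dspace x -> exists y, gspace y /\ bspace (x - y).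
Proof.
move=> dx; exists (x - bpart x); split; first exact: bpart_gspace.
by rewrite subKr; exact: bpart_bspace.
Qed.

(** [Rd] is defined with two independently chosen projections; this expresses one through the
    other. *)
Lemma dproj_gE (x : dtype C m n) : dspace x -> dproj gspace bspace x = x - dproj bspace
  gspace x.
Proof.
move=> dx; have [Px Qx] := projP split_b dx.
apply: (proj_unique (bspace_gsa C m n) (gspace_gsa C m n)
  (fun y By Gy => gb_cap Gy By) split_g) => //.
by rewrite subKr.
Qed.

End Main.

Theorem theorem3p2 (R : realType) (m n : nat) (hmn : m <> n)
    (T : finType) (h hd : T -> dtype R[i] m n) (ph : T -> bool)
    (hbasis : is_homog_basis h ph) (hdual : is_dual_basis h hd) :
  (exists br phi,
     [/\ is_induced (K := @idealI R[i] m n) (pbr h hd ph) br phi,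
         is_graded_real_lie (dual_lie br phi) &
         grlie_iso (dual_lie br phi) (blie R[i] m n)]) /\
  (exists br phi,
     [/\ is_induced (K := @idealJ R[i] m n) (pbr h hd ph) br phi,
         is_graded_real_lie (dual_lie br phi) &
         grlie_iso (dual_lie br phi) (glie R[i] m n)]).
Proof.
have gG := gspace_gsa R[i] m n; have gB := bspace_gsa R[i] m n.
have iG := @gspace_isotropic R[i] m n; have iB := @bspace_isotropic R[i] m n.
split.
  (* The target is b, on which [Rd] is the identity. *)
  apply: (duality hbasis hdual (sg := 1) gG gB iG iB).
  - exact: gb_cap.
  - exact: split_b.
  - exact: mulr1.
  - exact: conjC1.
  - by move=> x dx; rewrite scale1r /Rd dproj_gE.
  - exact: OmegaI_eq0.
(* With the roles exchanged the target is g, on which [Rd] is minus the identity. *)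
apply: (duality hbasis hdual (sg := -1) gB gG iB iG).
- by move=> x Bx Gx; exact: gb_cap.
- exact: split_g.
- by rewrite mulrNN mulr1.
- by rewrite rmorphN1.
- by move=> x dx; rewrite scaleN1r opprB /Rd dproj_gE // subKr.
- exact: OmegaJ_eq0.
Qed.
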